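(* Let $p\in(1,\infty)$, $\sigma\in(0,1/2)$, and $\alpha\in(\sigma,1/2)$. Define $$w_{p,\sigma,\alpha}(x):=\frac{1}{a_p+1}\frac{\Delta^\sigma k_{-\alpha}^{a_p}(x)}{k_{-\alpha}^{a_p}(x)}+\frac{a_p}{a_p+1}\frac{\Delta^\sigma k_{-\alpha}(x)}{k_{-\alpha}(x)},\qquad x\in\mathbb Z .$$ If $u\in\ell^p(\mathbb Z,(1+|x|)^{-2\sigma})$, then $$\mathcal E_p^{\mathbb Z,\sigma}(u)\geq\sum_{x\in\mathbb Z}w_{p,\sigma,\alpha}(x)|u(x)|^p .$$ The Hardy weight $w_{p,\sigma,\alpha}$ is strictly positive and, as $|x|\to\infty$, $$w_{p,\sigma,\alpha}(x)=\frac{\Psi(p,\sigma,\alpha)}{|x|^{2\sigma}}+O\left(\frac{1}{|x|^{2\sigma+1-\max\{2\sigma,1-2\alpha\}}}\right),$$ where $$\Psi(p,\sigma,\alpha):=\frac{1}{a_p+1}\frac{\mathcal A_{\gamma_p-\sigma}}{\mathcal A_{\gamma_p}}+\frac{a_p}{a_p+1}\frac{\mathcal A_{\alpha-\sigma}}{\mathcal A_{\alpha}},\qquad \gamma_p:=\frac{1-a_p(1-2\alpha)}{2}.$$ Moreover, $w_{p,\sigma,\alpha}$ is critical whenever $$\alpha\leq\frac{2\sigma+a_p}{2(a_p+1)}.$$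
   Context: For $p\in(1,\infty)$, $p'=p/(p-1)$ and $a_p:=\min\{p-1,p'-1\}$. For $a\in\mathbb R$, $\beta>0$: $a^{\langle\beta\rangle}:=|a|^\beta\operatorname{sgn}a$. For $s\in(-1,1/2)\setminus\{0\}$ put $\mathcal A_{s}:=\dfrac{4^{-s}\,\Gamma(1/2-s)}{\sqrt\pi\,|\Gamma(s)|}$. For $\sigma\in(0,1)$, $k_\sigma:\mathbb Z\to[0,\infty)$ is given by $k_\sigma(0)=0$ and $k_\sigma(z)=\mathcal A_{-\sigma}\dfrac{\Gamma(|z|-\sigma)}{\Gamma(|z|+1+\sigma)}$ for $z\ne0$. For $\theta\in(-1/2,0)$, $k_\theta(z):=\mathcal A_{-\theta}\dfrac{\Gamma(|z|-\theta)}{\Gamma(|z|+1+\theta)}$ for all $z\in\mathbb Z$ (strictly positive on $\mathbb Z$); in particular $k_{-\alpha}$ is this function with $\theta=-\alpha$. $k_{-\alpha}^{a}$ denotes the pointwise power. The fractional Laplacian is $\Delta^\sigma u(x):=\sum_{y\in\mathbb Z}(u(x)-u(y))k_\sigma(x-y)$, for all $u:\mathbb Z\to\mathbb R$ with $\sum_{y}k_\sigma(x-y)|u(y)|<\infty$ for every $x\in\mathbb Z$. The Sobolev--Bregman form is $$\mathcal E_p^{\mathbb Z,\sigma}(u):=\frac12\sum_{x\in\mathbb Z}\sum_{y\in\mathbb Z}(u(x)-u(y))\bigl(u(x)^{\langle p-1\rangle}-u(y)^{\langle p-1\rangle}\bigr)k_\sigma(x-y)\in[0,\infty].$$ $u\in\ell^p(\mathbb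 Z,\mu)$ means $u:\mathbb Z\to\mathbb R$ and $\sum_{x\in\mathbb Z}|u(x)|^p\mu(x)<\infty$. A Hardy weight for $\mathcal E_p^{\mathbb Z,\sigma}$ (on $\mathbb Z$) is a function $w:\mathbb Z\to[0,\infty)$ such that $\mathcal E_p^{\mathbb Z,\sigma}(u)\ge\sum_{x}w(x)|u(x)|^p$ for all finitely supported $u:\mathbb Z\to\mathbb R$. A Hardy weight $w$ is critical if every Hardy weight $\widetilde w\ge w$ (pointwise) coincides with $w$. *)

(* Defs.v *)
From mathcomp Require Import all_boot all_order all_algebra.
From mathcomp Require Import all_classical all_reals all_analysis.

Set Implicit Arguments.
Unset Strict Implicit.
Unset Printing Implicit Defensive.

Import Order.TTheory GRing.Theory Num.Theory.

Local Open Scope classical_set_scope.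
Local Open Scope ring_scope.

(* Euler's integral, meaningful for [0 < x]. *)
Definition gamma_integral (R : realType) (x : R) : R :=
  \int[@lebesgue_measure R]_(t in `]0, +oo[) (t `^ (x - 1) * expR (- t)).

(* For a negative non-integer [x], [n := `|floor x|] is the least [n] with
   [0 < x + n]; the value is the one forced by [Gamma (x + 1) = x * Gamma x]. *)
Definition Gamma (R : realType) (x : R) : R :=
  if 0 < x then gamma_integral x
  else let n := `|Num.floor x|%N in
       gamma_integral (x + n%:R) / \prod_(i < n) (x + i%:R).

(* Used for [s] in ]-1, 1/2[ with [s != 0]. *)
Definition cA (R : realType) (s : R) : R :=
  4 `^ (- s) * Gamma (1 / 2 - s) / (Num.sqrt pi * `|Gamma s|).

(* Used for [t] in ]0, 1[ (value 0 at the origin) and for [t] in ]-1/2, 0[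
   (positive everywhere). *)
Definition ker (R : realType) (t : R) (z : int) : R :=
  if (0 < t) && (z == 0) then 0
  else cA (- t) * Gamma (`|z|%N%:R - t) / Gamma (`|z|%N%:R + 1 + t).

Definition conj_exp (R : realType) (p : R) : R := p / (p - 1).

Definition a_ (R : realType) (p : R) : R := Num.min (p - 1) (conj_exp p - 1).

Definition spow (R : realType) (a b : R) : R := `|a| `^ b * Num.sg a.

(* Sum of an absolutely summable real family. *)
Definition zsum (R : realType) (f : int -> R) : R :=
  fine (\esum_(y in [set: int]) (Num.max (f y) 0)%:E)
  - fine (\esum_(y in [set: int]) (Num.max (- f y) 0)%:E).

Definition fracLap_dom (R : realType) (sigma : R) (u : int -> R) : Prop :=
  forall x : int,
    (\esum_(y in [set: int]) (ker sigma (x - y) * `|u y|)%:E < +oo)%E.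

(* Meaningful for [u] satisfying [fracLap_dom sigma]. *)
Definition fracLap (R : realType) (sigma : R) (u : int -> R) (x : int) : R :=
  zsum (fun y => (u x - u y) * ker sigma (x - y)).

(* All terms are nonnegative, hence the unconditional sum in [0, +oo]. *)
Definition SBform (R : realType) (p sigma : R) (u : int -> R) : \bar R :=
  ((2^-1)%:E * \esum_(x in [set: int]) \esum_(y in [set: int])
     ((u x - u y) * (spow (u x) (p - 1) - spow (u y) (p - 1))
       * ker sigma (x - y))%:E)%E.

Definition ellp (R : realType) (p : R) (mu : int -> R) (u : int -> R) : Prop :=
  (\esum_(x in [set: int]) (`|u x| `^ p * mu x)%:E < +oo)%E.

Definition wsum (R : realType) (p : R) (w u : int -> R) : \bar R :=
  \esum_(x in [set: int]) (w x * `|u x| `^ p)%:E.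

Definition hardy_weight (R : realType) (p sigma : R) (w : int -> R) : Prop :=
  (forall x, 0 <= w x) /\
  (forall u : int -> R, finite_set [set x | u x != 0] ->
     (wsum p w u <= SBform p sigma u)%E).

Definition critical (R : realType) (p sigma : R) (w : int -> R) : Prop :=
  hardy_weight p sigma w /\
  (forall w' : int -> R, hardy_weight p sigma w' ->
     (forall x, w x <= w' x) -> forall x, w' x = w x).

Definition kpow (R : realType) (alpha a : R) (x : int) : R :=
  ker (- alpha) x `^ a.

Definition hardy_w (R : realType) (p sigma alpha : R) (x : int) : R :=
  1 / (a_ p + 1)
    * (fracLap sigma (kpow alpha (a_ p)) x / kpow alpha (a_ p) x)
  + a_ p / (a_ p + 1)
    * (fracLap sigma (ker (- alpha)) x / ker (- alpha) x).

Definition gamma_ (R : realType) (p alpha : R) : R :=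
  (1 - a_ p * (1 - 2 * alpha)) / 2.

Definition Psi (R : realType) (p sigma alpha : R) : R :=
  1 / (a_ p + 1) * (cA (gamma_ p alpha - sigma) / cA (gamma_ p alpha))
  + a_ p / (a_ p + 1) * (cA (alpha - sigma) / cA alpha).

(* [f x = O(g x)] as [|x| --> +oo] in the integers. *)
Definition bigO_at_infty (R : realType) (f g : int -> R) : Prop :=
  exists (C : R) (N : nat),
    forall x : int, (N <= `|x|)%N -> `|f x| <= C * `|g x|.

(* Main.v *)
Require Import Defs.
From mathcomp Require Import all_boot all_order all_algebra.
From mathcomp Require Import all_classical all_reals all_analysis.
From mathcomp Require Import measurable_realfun.
From mathcomp Require Import ring lra zify.

Set Implicit Arguments.
Unset Strict Implicit.
Unset Printing Implicit Defensive.

Import Order.TTheory GRing.Theory Num.Theory.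
Import numFieldNormedType.Exports.

Local Open Scope classical_set_scope.
Local Open Scope ring_scope.

(** Write [h] for the kernel [ker (- alpha)], [k] for [ker sigma], [a] for [a_ p],
    [l = 1 / (a + 1)] and [U x = |u x| ^ p]. Among [1 / p] and [1 - 1 / p] one is [l] and
    the other [1 - l], so that
      [(u x - u y) (u x ^<p - 1> - u y ^<p - 1>) >=
         U x + U y - U x ^ l U y ^ (1 - l) - U y ^ l U x ^ (1 - l)],
    and the weighted AM-GM inequality gives
      [U x ^ l U y ^ (1 - l) <= l (h y / h x) ^ a U x + (1 - l) (h x / h y) U y].
    After multiplication by [k (x - y)] and summation, the factor of [U x] is the
    sum over [y] of [k (x - y)] times [hardy_density a (h x) (h y)], which is the
    weight. The density changes sign; its positive part has a sum of order
    [(1 + |x|) ^ (- 2 sigma)], because the density is nonpositive for [|y| <= |x|], where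
    [h y >= h x], and [h] decreases slowly beyond [x]. So for the functions [u] of the
    statement the terms may be rearranged. This yields an identity, [hardy_identity]:
    the form is the weighted sum plus half the double sum of a nonnegative remainder.

    The weight is positive because the fractional Laplacian of [h] is the kernel
    [ker (- (alpha - sigma))] and because [t ^ a] is concave. The formula for the
    Laplacian is a convolution law: [- k], completed at [0], and [h] are the Fourier
    coefficients [coef t] of [(2 - 2 cos) ^ t] for [t = sigma] and [t = - alpha]. It is
    proved without Fourier series. The sequences [coef t] are characterised by a first
    order recurrence, and the convolution of two of them satisfies the recurrence of
    the sum of the exponents since the defect telescopes ([conv_rec]). The remaining
    constant is unchanged when both exponents are increased by the same integer
    ([conv_law_add_nat]), and is squeezed to [1] by a comparison with large integer
    exponents, where the law follows from [coef 0] being the unit mass at the origin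
    ([conv_law_constant]). The estimates on the Gamma function which enter here, and the
    power asymptotics of the kernels, come from its logarithmic convexity.

    For the asymptotics of the weight, [h ^ b] with [b = a] or [b = 1] differs from a
    multiple of [ker (- g)], [g = (1 - b (1 - 2 alpha)) / 2], by a sequence which decays
    one power faster; the Laplacian of the multiple is explicit and that of the
    difference is bounded by [conv_decay].

    For criticality, all the inequalities above are equalities at [U = h ^ (a + 1)].
    For [U = h ^ (a + 1) psi ^ 2] with a logarithmic cutoff [psi] of parameter [L], the
    remainder is bounded by [(h x h y ^ a + h x ^ a h y) (psi x - psi y) ^ 2 k (x - y)]
    ([young_density_upper]). Under the condition on [alpha] the double sum of this bound
    is at most a constant times the harmonic sum up to [exp L] divided by [L ^ 2], so it
    tends to [0] ([remainder_vanishes]) and leaves no room for a larger weight. *)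

(** * Real powers *)

Section RealPowers.
Context {R : realType}.
Implicit Types (x y t r s l : R).

(** Tangents of the exponential: with [G] the geometric mean, both [x] and [y] are
    at least [G * (1 + ln z - ln G)] at [z = x], [z = y], and the weighted sum of these
    bounds is [G]. The values with a vanishing base or exponent are treated apart. *)
Lemma weighted_AMGM l x y : 0 <= l -> l <= 1 -> 0 <= x -> 0 <= y ->
  x `^ l * y `^ (1 - l) <= l * x + (1 - l) * y.
Proof.
move=> l0 l1 x0 y0.
have [->|ln0] := eqVneq l 0.
  by rewrite powRr0 mul1r mul0r add0r subr0 powRr1 // mul1r.
have [->|ln1] := eqVneq l 1.
  by rewrite subrr powRr0 mulr1 mul1r powRr1 // mul0r addr0.
have nl1 : 1 - l != 0 by rewrite subr_eq0 eq_sym.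
have [->|xn0] := eqVneq x 0.
  by rewrite powR0 // mul0r mulr0 add0r mulr_ge0 // subr_ge0.
have [->|yn0] := eqVneq y 0.
  by rewrite (powR0 nl1) // mulr0 mulr0 addr0 mulr_ge0.
have {xn0}x0 : 0 < x by rewrite lt_neqAle eq_sym xn0.
have {yn0}y0 : 0 < y by rewrite lt_neqAle eq_sym yn0.
set G := x `^ l * y `^ (1 - l).
have G0 : 0 < G by rewrite mulr_gt0 // powR_gt0.
have lnG : ln G = l * ln x + (1 - l) * ln y.
  by rewrite lnM ?posrE ?powR_gt0 // !ln_powR.
have tangent z : 0 < z -> G * (1 + ln z - ln G) <= z.
  move=> z0; rewrite -ler_pdivlMl // mulrC -addrA -ln_div ?posrE //.
  have := expR_ge1Dx (ln (z / G)); rewrite lnK //.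
  by rewrite posrE divr_gt0.
have := tangent _ x0; have := tangent _ y0; rewrite lnG.
move=> hy hx.
have := ler_wpM2l l0 hx; have := ler_wpM2l (_ : 0 <= 1 - l) hy.
rewrite subr_ge0 => /(_ l1) h1 h2.
by have := lerD h2 h1; apply: le_trans; rewrite le_eqVlt; apply/orP; left; apply/eqP; ring.
Qed.

End RealPowers.

(** * Sums over the integers *)

Section IntegerSums.
Context {R : realType}.
Implicit Types (f g v : int -> R) (x y : int) (c : R).

Definition zsummable f : Prop :=
  (\esum_(y in [set: int]) `|f y|%:E < +oo)%E.

(** Pairing [i] with [- i - 1] makes these the sums over the intervals [[- n, n[], for
    which differences [v y - v (y - 1)] telescope. *)
Definition zpartial f (n : nat) : R :=
  \sum_(0 <= i < n) (f (Posz i) + f (Negz i)).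

Lemma esum_int_series (F : int -> \bar R) : (forall y, 0 <= F y)%E ->
  (\esum_(y in [set: int]) F y =
   \sum_(0 <= i <oo) (F (Posz i) + F (Negz i)))%E.
Proof.
move=> F0.
rewrite (esumID (range Posz)) // setTI.
have -> : [set: int] `&` ~` (range Posz) = range Negz.
  rewrite setTI; apply/seteqP; split => [[n|n] /= h|_ [n _ <-] [m _]] //.
  - by exfalso; apply: h; exists n.
  - by exists n.
rewrite !esum_image; last 2 first.
- by move=> i j _ _ [].
- by move=> i j _ _ [].
rewrite -!nneseries_esumT // -nneseriesD //.
Qed.

Lemma esum_int_cvg f : (forall y, 0 <= f y) ->
  (zpartial f n)%:E @[n --> \oo] --> \esum_(y in [set: int]) (f y)%:E.
Proof.
move=> f0; rewrite esum_int_series; last by move=> y; rewrite lee_fin.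
have -> : (fun n => (zpartial f n)%:E) =
    (fun n => \sum_(0 <= i < n) ((f (Posz i))%:E + (f (Negz i))%:E))%E.
  by apply/funext => n; rewrite /zpartial -sumEFin.
apply: is_cvg_nneseries => n _ _.
by rewrite adde_ge0 ?lee_fin.
Qed.

Lemma esum_int_le f c : (forall y, 0 <= f y) -> (forall n, zpartial f n <= c) ->
  (\esum_(y in [set: int]) (f y)%:E <= c%:E)%E.
Proof.
move=> f0 h; have := esum_int_cvg f0 => /cvg_lim <- //.
apply: lime_le; first by apply/cvg_ex; eexists; exact: esum_int_cvg.
by apply: nearW => n; rewrite lee_fin.
Qed.

Lemma zsummable_bounded f g c : (forall y, `|f y| <= g y) ->
  (forall n, zpartial g n <= c) -> zsummable f.
Proof.
move=> fg gc; apply: (@le_lt_trans _ _ c%:E); last exact: ltry.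
apply: (@le_trans _ _ (\esum_(y in [set: int]) (g y)%:E)).
  by apply: le_esum => y _; rewrite lee_fin.
by apply: esum_int_le => // y; exact: le_trans (fg y).
Qed.

Lemma zsummable_le f g : (forall y, `|f y| <= `|g y|) -> zsummable g ->
  zsummable f.
Proof.
move=> fg; apply: le_lt_trans; apply: le_esum => y _; by rewrite lee_fin.
Qed.

Lemma zsummableD f g : zsummable f -> zsummable g ->
  zsummable (fun y => f y + g y).
Proof.
move=> sf sg; apply: le_lt_trans (lte_add_pinfty sf sg).
rewrite -esumD; [|by move=> *; rewrite lee_fin..].
by apply: le_esum => y _; rewrite -EFinD lee_fin ler_normD.
Qed.

Lemma zsummableN f : zsummable f -> zsummable (fun y => - f y).
Proof. by apply: zsummable_le => y; rewrite normrN. Qed.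

Lemma zsummable_abs f : zsummable f -> zsummable (fun y => `|f y|).
Proof. by apply: zsummable_le => y; rewrite normr_id. Qed.

Lemma zsum_ge0_esum f : (forall y, 0 <= f y) -> zsummable f ->
  (zsum f)%:E = (\esum_(y in [set: int]) (f y)%:E)%E.
Proof.
move=> f0 sf; rewrite /zsum.
under eq_esum do rewrite (max_idPl _) //.
rewrite [X in _ - fine X]esum1; last first.
  by move=> y _; rewrite (max_idPr _) // oppr_le0.
rewrite subr0 fineK // ge0_fin_numE; last by apply: esum_ge0 => y _; rewrite lee_fin.
by move: sf; rewrite /zsummable; under eq_esum do rewrite ger0_norm //.
Qed.

(** This reduces the algebra of [zsum], which is defined through positive and
    negative parts, to that of finite sums. *)
Lemma cvg_zsum f : zsummable f -> zpartial f n @[n --> \oo] --> zsum f.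
Proof.
move=> sf.
have key g : (forall y, 0 <= g y) -> (forall y, g y <= `|f y|) ->
    zpartial g n @[n --> \oo] --> fine (\esum_(y in [set: int]) (g y)%:E)%E.
  move=> g0 gf.
  have h : (zpartial g n)%:E @[n --> \oo] -->
      (fine (\esum_(y in [set: int]) (g y)%:E))%:E.
    rewrite fineK; first exact: esum_int_cvg.
    rewrite ge0_fin_numE; last by apply: esum_ge0 => y _; rewrite lee_fin.
    by apply: le_lt_trans sf; apply: le_esum => y _; rewrite lee_fin.
  exact: (fine_cvg h).
have h1 := key (fun y => Num.max (f y) 0).
have h2 := key (fun y => Num.max (- f y) 0).
have -> : zpartial f = (fun n => zpartial (fun y => Num.max (f y) 0) n -
    zpartial (fun y => Num.max (- f y) 0) n).
  apply/funext => n; rewrite /zpartial -sumrB; apply: eq_bigr => i _.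
  have e (t : R) : t = Num.max t 0 - Num.max (- t) 0.
    by case: (lerP t 0); case: (lerP (- t) 0); lra.
  by rewrite {1}(e (f (Posz i))) {1}(e (f (Negz i))); ring.
apply: cvgB; [apply: h1|apply: h2] => y.
- by rewrite le_max lexx orbT.
- by rewrite ge_max ler_norm normr_ge0.
- by rewrite le_max lexx orbT.
- by rewrite ge_max normr_ge0 andbT -normrN ler_norm.
Qed.

Lemma zsum_unique f (l : R) : zsummable f -> zpartial f n @[n --> \oo] --> l ->
  zsum f = l.
Proof. by move=> /cvg_zsum h1 h2; exact: (cvg_unique _ h1 h2). Qed.

Lemma zpartialS f n :
  zpartial f n.+1 = zpartial f n + (f (Posz n) + f (Negz n)).
Proof. by rewrite /zpartial big_nat_recr. Qed.

Lemma zpartialD f g n :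
  zpartial (fun y => f y + g y) n = zpartial f n + zpartial g n.
Proof. by rewrite /zpartial -big_split; apply: eq_bigr => i _ /=; ring. Qed.

Lemma zpartialZ c f n : zpartial (fun y => c * f y) n = c * zpartial f n.
Proof. by rewrite /zpartial mulr_sumr; apply: eq_bigr => i _ /=; ring. Qed.

Lemma ler_zpartial f g n : (forall y, f y <= g y) -> zpartial f n <= zpartial g n.
Proof. by move=> fg; apply: ler_sum => i _; exact: lerD. Qed.

Lemma zpartial_le_zsum f n : (forall y, 0 <= f y) -> zsummable f ->
  zpartial f n <= zsum f.
Proof.
move=> f0 sf; have h := cvg_zsum sf; have /cvg_lim <- // := h.
apply: nondecreasing_cvgn_le; last by apply/cvg_ex; eexists; exact: h.
apply/nondecreasing_seqP => k; rewrite zpartialS lerDl.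
by rewrite addr_ge0.
Qed.

Lemma zsummableZ c f : zsummable f -> zsummable (fun y => c * f y).
Proof.
move=> sf; apply: (@zsummable_bounded _ (fun y => `|c| * `|f y|)
    (`|c| * zsum (fun y => `|f y|))).
  by move=> y; rewrite normrM.
move=> n; rewrite zpartialZ ler_wpM2l //.
by apply: zpartial_le_zsum => //; exact: zsummable_abs.
Qed.

Lemma zsummableB f g : zsummable f -> zsummable g ->
  zsummable (fun y => f y - g y).
Proof. by move=> sf sg; apply: zsummableD => //; exact: zsummableN. Qed.

Lemma zsumD f g : zsummable f -> zsummable g ->
  zsum (fun y => f y + g y) = zsum f + zsum g.
Proof.
move=> sf sg; apply: zsum_unique; first exact: zsummableD.
rewrite (funext (zpartialD f g)).
by apply: cvgD; exact: cvg_zsum.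
Qed.

Lemma zsumZ c f : zsummable f -> zsum (fun y => c * f y) = c * zsum f.
Proof.
move=> sf; apply: zsum_unique; first exact: zsummableZ.
rewrite (funext (zpartialZ c f)).
by apply: cvgMr; exact: cvg_zsum.
Qed.

Lemma zsumN f : zsummable f -> zsum (fun y => - f y) = - zsum f.
Proof.
by move=> sf; rewrite -mulN1r -zsumZ //; congr zsum; apply/funext => y; rewrite mulN1r.
Qed.

Lemma zsumB f g : zsummable f -> zsummable g ->
  zsum (fun y => f y - g y) = zsum f - zsum g.
Proof. by move=> sf sg; rewrite zsumD ?zsumN //; exact: zsummableN. Qed.

Lemma ler_zsum f g : zsummable f -> zsummable g -> (forall y, f y <= g y) ->
  zsum f <= zsum g.
Proof.
move=> sf sg fg; have hf := cvg_zsum sf; have hg := cvg_zsum sg.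
by apply: (ler_cvg_to hf hg); apply: nearW => n; exact: ler_zpartial.
Qed.

Lemma zsum_ge0 f : (forall y, 0 <= f y) -> 0 <= zsum f.
Proof.
move=> f0; rewrite /zsum [X in _ - fine X]esum1; last first.
  by move=> y _; rewrite (max_idPr _) // oppr_le0.
by rewrite subr0 fine_ge0 // esum_ge0 // => y _; rewrite lee_fin le_max lexx orbT.
Qed.

Lemma normr_zsum f : zsummable f -> `|zsum f| <= zsum (fun y => `|f y|).
Proof.
move=> sf; have sa := zsummable_abs sf.
rewrite ler_norml -zsumN //; apply/andP; split; apply: ler_zsum => //.
- exact: zsummableN.
- by move=> y; rewrite lerNl -normrN ler_norm.
- by move=> y; exact: ler_norm.
Qed.

Lemma zsum_le f c : zsummable f -> (forall n, zpartial f n <= c) -> zsum f <= c.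
Proof.
move=> sf h; have /cvg_lim <- // := cvg_zsum sf.
by apply: limr_le; [apply/cvg_ex; eexists; exact: cvg_zsum|exact: nearW].
Qed.

Lemma zsummable_reindex (e : int -> int) f : bijective e -> zsummable f ->
  zsummable (fun y => f (e y)).
Proof.
move=> be; rewrite /zsummable (reindex_esum [set: int] [set: int] e) //.
by rewrite setTT_bijective.
Qed.

Lemma zsum_reindex (e : int -> int) f : bijective e ->
  zsum (fun y => f (e y)) = zsum f.
Proof.
move=> be; have b : set_bij [set: int] [set: int] e by rewrite setTT_bijective.
rewrite /zsum (reindex_esum _ _ e (fun y => (Num.max (f y) 0)%:E) b).
by rewrite (reindex_esum _ _ e (fun y => (Num.max (- f y) 0)%:E) b).
Qed.

Lemma bij_subz x : bijective (fun y => x - y).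
Proof. by exists (fun y => x - y) => y; rewrite opprB addrC subrK. Qed.

Lemma bij_addz x : bijective (fun y => y + x).
Proof. by exists (fun y => y - x) => y; rewrite ?addrK ?subrK. Qed.

Lemma zsum_sub x f : zsum (fun y => f (x - y)) = zsum f.
Proof. exact: zsum_reindex (bij_subz x). Qed.

Lemma zsummable_sub x f : zsummable f -> zsummable (fun y => f (x - y)).
Proof. exact: zsummable_reindex (bij_subz x). Qed.

(** The partial sum over [[- n, n[] is [v (n - 1) - v (- n - 1)]; [v] itself may fail
    to be summable. *)
Lemma zsum_telescope v : zsummable (fun y => v y - v (y - 1)) ->
  v (Posz n) @[n --> \oo] --> 0 -> v (Negz n) @[n --> \oo] --> 0 ->
  zsum (fun y => v y - v (y - 1)) = 0.
Proof.
move=> sv vp vn; apply: zsum_unique => //.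
have e n : zpartial (fun y => v y - v (y - 1)) n = v (Posz n - 1) - v (Negz n).
  elim: n => [|n IH]; first by rewrite /zpartial big_nil -[Posz 0 - 1]/(Negz 0) subrr.
  rewrite zpartialS IH.
  rewrite (_ : Posz n.+1 - 1 = n); last by lia.
  by rewrite (_ : Negz n - 1 = Negz n.+1); [ring|lia].
rewrite (funext e) -[X in _ --> X]subr0; apply: cvgB => //.
rewrite -(cvg_shiftn 1) /=; move: vp; apply: cvg_trans.
by apply: near_eq_cvg; apply: nearW => n; rewrite addn1; congr v; lia.
Qed.

End IntegerSums.

(** * Sums of powers *)

Section PowerSums.
Context {R : realType}.
Implicit Types (x y s : R).

Lemma mulr_powRB1_gt0 x s : 0 < x -> x * x `^ (s - 1) = x `^ s.
Proof.
move=> x0; rewrite -{1}[x]powRr1 ?ltW // -powRD ?(gt_eqF x0) ?implybT //.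
by rewrite addrC subrK.
Qed.

(** Concavity of the power, in the form of the weighted AM-GM inequality for [y]
    and [x]. *)
Lemma powR_le_tangent s x y : 0 <= s -> s <= 1 -> 0 < x -> 0 <= y ->
  y `^ s <= x `^ s + s * x `^ (s - 1) * (y - x).
Proof.
move=> s0 s1 x0 y0.
have := weighted_AMGM s0 s1 y0 (ltW x0).
have xs : 0 < x `^ (1 - s) by rewrite powR_gt0.
rewrite -ler_pdivlMr // => /le_trans; apply.
rewrite -powRN opprB le_eqVlt; apply/orP; left; apply/eqP.
by rewrite -(mulr_powRB1_gt0 s x0); ring.
Qed.

Lemma powRN_ge_tangent s x y : 0 <= s -> 0 < x -> 0 < y ->
  x `^ (- s) - s * x `^ (- s - 1) * (y - x) <= y `^ (- s).
Proof.
move=> s0 x0 y0; have z0 : 0 < y / x by rewrite divr_gt0.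
have h : 1 - s * (y / x - 1) <= (y / x) `^ (- s).
  rewrite /powR (gt_eqF z0); apply: le_trans (expR_ge1Dx _).
  rewrite mulNr lerD2l lerN2 ler_wpM2l //.
  have := @le_ln1Dx R (y / x - 1); rewrite [1 + _]addrC subrK; apply.
  by rewrite ltrBrDr addNr.
have xs : 0 < x `^ (- s) by rewrite powR_gt0.
have -> : y `^ (- s) = x `^ (- s) * (y / x) `^ (- s).
  rewrite -powRM ?(ltW x0) ?(ltW z0) //; congr powR; field.
  by rewrite gt_eqF.
apply: le_trans (ler_wpM2l (ltW xs) h); rewrite le_eqVlt; apply/orP; left.
apply/eqP; rewrite -(mulr_powRB1_gt0 (- s) x0); field.
by rewrite gt_eqF.
Qed.

(** By convexity the term of index [i] is at most [s^-1] times the decrement of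
    [t ^ (- s)] from [i] to [i + 1]. *)
Lemma sum_powR_tail s (m n : nat) : 0 < s -> (0 < m)%N ->
  \sum_(m <= i < n) i.+1%:R `^ (- s - 1) <= s^-1 * m%:R `^ (- s).
Proof.
move=> s0 m0; case: (leqP n m) => [nm|/ltnW mn].
  by rewrite big_geq // mulr_ge0 ?powR_ge0 // invr_ge0 ltW.
suff : \sum_(m <= i < n) i.+1%:R `^ (- s - 1) <=
    s^-1 * (m%:R `^ (- s) - n%:R `^ (- s)).
  move=> /le_trans; apply; rewrite ler_wpM2l ?invr_ge0 ?(ltW s0) //.
  by rewrite gerBl powR_ge0.
elim: n mn => [|n IH]; first by rewrite leqn0 => /eqP ->; rewrite big_geq // subrr mulr0.
rewrite leq_eqVlt => /predU1P[<-|mn]; first by rewrite big_geq // subrr mulr0.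
rewrite big_nat_recr //=; apply: le_trans (lerD (IH mn) (lexx _)) _.
have n0 : 0 < n%:R :> R by rewrite ltr0n (leq_trans m0).
have h := @powRN_ge_tangent s n.+1%:R n%:R (ltW s0) (ltr0Sn _ _) n0.
rewrite (_ : n%:R - n.+1%:R = -1 :> R) in h; last by rewrite -natr1; ring.
have -> : n.+1%:R `^ (- s - 1) = s^-1 * (s * n.+1%:R `^ (- s - 1)) :> R.
  by rewrite mulKf // gt_eqF.
rewrite -mulrDr ler_wpM2l ?invr_ge0 ?(ltW s0) //.
move: h; move: (s * _) (n.+1%:R `^ (- s)) (n%:R `^ (- s)) (m%:R `^ (- s)) => *; lra.
Qed.

(** By concavity the term of index [i] is at most [s^-1] times the increment of
    [t ^ s] from [i] to [i + 1]. *)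
Lemma sum_powR_head s (n : nat) : 0 < s -> s <= 1 ->
  \sum_(0 <= i < n) i.+1%:R `^ (s - 1) <= s^-1 * n%:R `^ s.
Proof.
move=> s0 s1; elim: n => [|n IH].
  by rewrite big_geq // mulr_ge0 ?powR_ge0 // invr_ge0 ltW.
rewrite big_nat_recr //=; apply: le_trans (lerD IH (lexx _)) _.
have h := @powR_le_tangent s n.+1%:R n%:R (ltW s0) s1 (ltr0Sn _ _) (ler0n _ _).
rewrite (_ : n%:R - n.+1%:R = -1 :> R) in h; last by rewrite -natr1; ring.
have -> : n.+1%:R `^ (s - 1) = s^-1 * (s * n.+1%:R `^ (s - 1)) :> R.
  by rewrite mulKf // gt_eqF.
rewrite -mulrDr ler_wpM2l ?invr_ge0 ?(ltW s0) //.
move: h; move: (s * _) (n.+1%:R `^ s) (n%:R `^ s) => *; lra.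
Qed.

(** The indices [i + 1] and [- i - 1] share the bound [g i]; only the origin is
    special. *)
Lemma zpartial_le_even (f : int -> R) (g : nat -> R) c n : 0 <= c ->
  (forall i, 0 <= g i) -> f 0 <= c ->
  (forall i, f (Posz i.+1) <= g i) -> (forall i, f (Negz i) <= g i) ->
  zpartial f n <= c + 2 * \sum_(0 <= i < n) g i.
Proof.
move=> c0 g0 f0 fp fn.
rewrite /zpartial big_split /= mulr2n mulrDl mul1r addrA; apply: lerD; last first.
  exact: ler_sum.
case: n => [|n]; first by rewrite !big_nil addr0.
rewrite big_nat_recl // lerD // big_nat_recr //= -[leLHS]addr0.
by rewrite lerD // ler_sum.
Qed.

Definition wt (x : int) : R := 1 + `|x|%N%:R.

Lemma wt_ge1 (x : int) : 1 <= wt x. Proof. by rewrite lerDl. Qed.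
Lemma wt_gt0 (x : int) : 0 < wt x. Proof. exact: lt_le_trans (wt_ge1 x). Qed.
Lemma wt_nat (x : int) : wt x = (`|x|%N).+1%:R. Proof. by rewrite /wt -natr1 addrC. Qed.

Lemma powRN_abs_wt (p : R) (z : int) : 0 <= p -> z != 0 ->
  `|z|%N%:R `^ (- p) <= 2 `^ p * wt z `^ (- p).
Proof.
move=> p0 z0; have z1 : 0 < `|z|%N%:R :> R by rewrite ltr0n absz_gt0.
rewrite !powRN ler_pdivlMr ?powR_gt0 ?wt_gt0 // mulrC.
rewrite ler_pdivrMr ?powR_gt0 // -powRM ?(ltW z1) //.
apply: ge0_ler_powR; rewrite ?nnegrE ?(ltW (wt_gt0 _)) ?mulr_ge0 ?(ltW z1) //.
by rewrite /wt mulr_natl mulr2n lerD2r ler1n absz_gt0.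
Qed.

Lemma zsummable_wt s : 0 < s -> zsummable (fun y : int => wt y `^ (- s - 1)).
Proof.
move=> s0; apply: (@zsummable_bounded _ _ (fun y : int => wt y `^ (- s - 1))
  (1 + 2 * (1 + s^-1))).
  by move=> y; rewrite ger0_norm // powR_ge0.
move=> n; apply: le_trans (@zpartial_le_even _ (fun i => i.+1%:R `^ (- s - 1)) 1 n _ _ _ _ _) _.
- by [].
- by move=> i; rewrite powR_ge0.
- by rewrite wt_nat powR1.
- move=> i; rewrite wt_nat; rewrite -!(opprD s) !powRN lef_pV2 ?posrE ?powR_gt0 //.
  by apply: ge0_ler_powR; rewrite ?nnegrE ?addr_ge0 ?ler_nat // ltW.
- move=> i; rewrite wt_nat; rewrite -!(opprD s) !powRN lef_pV2 ?posrE ?powR_gt0 //.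
  by apply: ge0_ler_powR; rewrite ?nnegrE ?addr_ge0 ?ler_nat // ltW.
rewrite lerD2l ler_pM2l //; case: n => [|n].
  by rewrite big_nil addr_ge0 // invr_ge0 ltW.
rewrite big_ltn // powR1 lerD2l.
by apply: le_trans (@sum_powR_tail s 1 n.+1 s0 isT) _; rewrite powR1 mulr1.
Qed.

(** With [d = |z|], the terms with [d <= m] are summed with the linear part
    of the minimum, where [d ^ (- 2 s)] has divergent sums of order [m ^ (1 - 2 s)], and those
    with [d > m] with the power [s], which leaves the summable [d ^ (- s - 1)]. *)
Lemma zpartial_kernel_modulus (s A : R) (f : int -> R) (m n : nat) :
  0 < s -> s < 2^-1 -> 0 <= A -> (0 < m)%N -> f 0 <= 0 ->
  (forall z, z != 0 -> f z <= A * `|z|%N%:R `^ (- (2 * s) - 1) *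
     Num.min (`|z|%N%:R / m%:R) ((`|z|%N%:R / m%:R) `^ s)) ->
  zpartial f n <= A * (2 * ((1 - 2 * s)^-1 + s^-1)) * m%:R `^ (- (2 * s)).
Proof.
move=> s0 s1 A0 m0 f0 fle.
have m0R : 0 < m%:R :> R by rewrite ltr0n.
pose g i : R := A * i.+1%:R `^ (- (2 * s) - 1) *
   Num.min (i.+1%:R / m%:R) ((i.+1%:R / m%:R) `^ s).
have g0 i : 0 <= g i.
  by rewrite mulr_ge0 ?(mulr_ge0 A0) ?powR_ge0 // le_min powR_ge0 divr_ge0.
apply: le_trans (@zpartial_le_even f g 0 n _ _ _ _ _) _ => //.
- by move=> i; exact: fle.
- by move=> i; exact: fle.
have -> : A * (2 * ((1 - 2 * s)^-1 + s^-1)) * m%:R `^ (- (2 * s)) =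
    2 * (A * ((1 - 2 * s)^-1 * m%:R `^ (- (2 * s))) +
         A * (s^-1 * m%:R `^ (- (2 * s)))) by ring.
rewrite add0r ler_pM2l //.
have minl (a b : R) : Num.min a b <= a by rewrite ge_min lexx.
have minr (a b : R) : Num.min a b <= b by rewrite ge_min lexx orbT.
have le1 i : g i <= A * (i.+1%:R `^ (1 - 2 * s - 1) * m%:R^-1).
  rewrite /g -mulrA ler_wpM2l //.
  apply: le_trans (ler_wpM2l (powR_ge0 _ _) (minl _ _)) _.
  rewrite mulrA le_eqVlt; apply/orP; left; apply/eqP; congr (_ * _).
  rewrite mulrC mulr_powRB1_gt0 //; congr powR; ring.
have le2 i : g i <= A * (i.+1%:R `^ (- s - 1) * m%:R `^ (- s)).
  rewrite /g -mulrA ler_wpM2l //.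
  apply: le_trans (ler_wpM2l (powR_ge0 _ _) (minr _ _)) _.
  rewrite powRM ?invr_ge0 // mulrA -powRD ?pnatr_eq0 ?implybT //.
  rewrite -(powR_inv1 (ler0n _ m)) -powRrM mulN1r.
  rewrite le_eqVlt; apply/orP; left; apply/eqP; congr (_ `^ _ * _); ring.
have sum1 k : (k <= m)%N -> \sum_(0 <= i < k) g i <=
    A * ((1 - 2 * s)^-1 * m%:R `^ (- (2 * s))).
  move=> km; apply: (@le_trans _ _ (\sum_(0 <= i < k) A * (i.+1%:R `^ (1 - 2 * s - 1) * m%:R^-1))).
    by apply: ler_sum => i _; exact: le1.
  rewrite -mulr_sumr ler_wpM2l // -mulr_suml.
  have t0 : 0 < 1 - 2 * s by move: s1; rewrite -div1r ltr_pdivlMr // mulrC; lra.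
  have := sum_powR_head k t0; rewrite gerBl mulr_ge0 ?(ltW s0) // => /(_ isT) h.
  apply: le_trans (ler_wpM2r _ h) _; first by rewrite invr_ge0 ltW.
  rewrite -mulrA ler_wpM2l ?invr_ge0 ?(ltW t0) //.
  apply: (@le_trans _ _ (m%:R `^ (1 - 2 * s) / m%:R)).
    rewrite ler_wpM2r ?invr_ge0 ?(ltW m0R) //.
    by apply: ge0_ler_powR; rewrite ?nnegrE ?ler_nat // ltW.
  rewrite ler_pdivrMr // powRD ?(gt_eqF m0R) ?implybT // powRr1 ?(ltW m0R) //.
  by rewrite mulrC.
have sum2 : \sum_(m <= i < n) g i <= A * (s^-1 * m%:R `^ (- (2 * s))).
  apply: (@le_trans _ _ (\sum_(m <= i < n) A * (i.+1%:R `^ (- s - 1) * m%:R `^ (- s)))).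
    by apply: ler_sum => i _; exact: le2.
  rewrite -mulr_sumr ler_wpM2l // -mulr_suml.
  apply: le_trans (ler_wpM2r (powR_ge0 _ _) (sum_powR_tail _ s0 m0)) _.
  rewrite -mulrA -powRD ?(gt_eqF m0R) ?implybT //.
  by rewrite (_ : - s + - s = - (2 * s)) //; ring.
case: (leqP n m) => nm.
  apply: le_trans (sum1 _ nm) _; rewrite lerDl.
  by rewrite !mulr_ge0 ?powR_ge0 // invr_ge0 ltW.
by rewrite (@big_cat_nat _ _ _ m) ?(ltnW nm) //=; apply: lerD => //; exact: sum1.
Qed.

End PowerSums.

(** * Euler's integral *)

Section GammaFunction.
Context {R : realType}.
Implicit Types (x y t a b s : R).
Local Notation mu := (@lebesgue_measure R).

Let gf x t : R := t `^ (x - 1) * expR (- t).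

Let gf_ge0 x t : 0 <= gf x t.
Proof. by rewrite mulr_ge0 ?powR_ge0 ?expR_ge0. Qed.

Let is_derive_expRN t : is_derive t 1 (fun u => expR (- u)) (- expR (- t)).
Proof.
have h := @is_derive1_comp R expR (fun u => - u) t (expR (- t)) (-1).
rewrite -[- expR _]mulrN1 //; apply: h.
Qed.

Let is_derive_gf x t : 0 < t ->
  is_derive t 1 (gf x) ((x - 1) * t `^ (x - 1 - 1) * expR (- t) - gf x t).
Proof.
move=> t0; have h1 := is_derive1_powR (x - 1) t0; have h2 := is_derive_expRN t.
apply: (is_derive_eq (@is_deriveM _ _ _ _ _ _ _ _ h1 h2)).
by rewrite /gf /GRing.scale /=; ring.
Qed.

Let derivable_cont (F : R -> R) t : derivable F t 1 -> {for t, continuous F}.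
Proof. by move=> /derivable1_diffP/differentiable_continuous. Qed.

Let cont_within (F : R -> R) a b : 0 < a ->
  (forall t, 0 < t -> {for t, continuous F}) -> {within `[a, b], continuous F}.
Proof.
move=> a0 cF; apply: continuous_in_subspaceT => t /set_mem /=.
by rewrite in_itv /= => /andP[at_ _]; apply: cF; exact: lt_le_trans at_.
Qed.

Let derivable_LR (F : R -> R) a b : 0 < a -> a < b ->
  (forall t, 0 < t -> derivable F t 1) -> derivable_oo_LRcontinuous F a b.
Proof.
move=> a0 ab dF; split.
- by move=> t; rewrite in_itv /= => /andP[at_ _]; apply: dF; exact: lt_trans at_.
- by apply: cvg_at_right_filter; apply: derivable_cont; exact: dF.
- apply: cvg_at_left_filter; apply: derivable_cont; apply: dF.
  exact: lt_trans ab.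
Qed.

Let gf_cont x t : 0 < t -> {for t, continuous (gf x)}.
Proof. by move=> t0; apply: derivable_cont; have [] := is_derive_gf x t0. Qed.

Let pos_measurable (F : R -> R) : (forall t, 0 < t -> {for t, continuous F}) ->
  measurable_fun (`]0%R, +oo[%classic : set R) F.
Proof.
move=> cF; apply: open_continuous_measurable_fun => //.
by move=> t /set_mem /=; rewrite in_itv /= andbT => /cF.
Qed.

Let int_ab (F : R -> R) a b := (\int[mu]_(t in `[a, b]) (F t)%:E)%E.

Let int_0y (F : R -> R) := (\int[mu]_(t in `]0%R, +oo[) (F t)%:E)%E.

(** Improper integrals as limits over compact intervals, where integration by parts
    and substitution apply. The exponent [k] is there for the substitution
    [t = s ^ 2], which maps the intervals for [k = 1] to those for [k = 2]. *)
Let exhaustion (F : R -> R) k : (0 < k)%N ->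
  (forall t, 0 < t -> {for t, continuous F}) -> (forall t, 0 <= F t) ->
  int_ab F (n.+1%:R ^+ k)^-1 (n.+1%:R ^+ k) @[n --> \oo] --> int_0y F.
Proof.
move=> k0 cF F0; rewrite /int_ab /int_0y.
have -> : `]0%R, +oo[%classic =
    \bigcup_n `[(n.+1%:R ^+ k)^-1, n.+1%:R ^+ k]%classic :> set R.
  apply/seteqP; split => t /=.
    rewrite in_itv /= andbT => t0.
    have [n hn] : exists n : nat, Num.max t t^-1 <= n.+1%:R.
      exists (Num.bound (Num.max t t^-1)).
      have M0 : 0 <= Num.max t t^-1 by rewrite le_max ltW.
      by apply: ltW; apply: lt_le_trans (archi_boundP M0) _; rewrite ler_nat.
    have le1 : n.+1%:R <= n.+1%:R ^+ k :> R.
      by rewrite -[leLHS]expr1; apply: ler_weXn2l; rewrite ?ler1n.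
    have := le_trans hn le1; rewrite ge_max => /andP[h1 h2].
    exists n => //=; rewrite in_itv /= h1 andbT.
    by rewrite -[t]invrK lef_pV2 ?posrE ?exprn_gt0 ?invr_gt0.
  move=> [n _] /=; rewrite !in_itv /= andbT => /andP[+ _]; apply: lt_le_trans.
  by rewrite invr_gt0 exprn_gt0.
apply: ge0_nondecreasing_set_cvg_integral.
- apply/nondecreasing_seqP => n; rewrite subsetEset => t /=.
  have h : n.+1%:R ^+ k <= n.+2%:R ^+ k :> R.
    by apply: lerXn2r; rewrite ?nnegrE ?ler_nat.
  rewrite !in_itv /= => /andP[h1 h2]; rewrite (le_trans h2 h) andbT.
  by apply: le_trans h1; rewrite lef_pV2 ?posrE ?exprn_gt0.
- by move=> n; exact: measurable_itv.
- move=> n; apply/measurable_EFinP.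
  apply: measurable_funS (pos_measurable cF) => // t /=.
  rewrite !in_itv /= andbT => /andP[+ _]; apply: lt_le_trans.
  by rewrite invr_gt0 exprn_gt0.
- by move=> n t _; rewrite lee_fin.
Qed.

Let gf_parts x a b : 0 < a -> a < b ->
  int_ab (gf (x + 1)) a b =
  ((a `^ x * expR (- a) - b `^ x * expR (- b))%:E + x%:E * int_ab (gf x) a b)%E.
Proof.
move=> a0 ab; rewrite /int_ab.
have cgf y : {within `[a, b], continuous (gf y)}.
  by apply: cont_within => // t; exact: gf_cont.
have intgf y : mu.-integrable `[a, b] (EFin \o gf y).
  by apply: continuous_compact_integrable; [exact: segment_compact|exact: cgf].
have -> : (\int[mu]_(t in `[a, b]) (gf (x + 1) t)%:E =
    \int[mu]_(t in `[a, b]) ((fun t => t `^ x) t * (fun t => expR (- t)) t)%:E)%E.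
  by apply: eq_integral => t _; rewrite /gf addrK.
rewrite (@integration_by_parts R (fun t => t `^ x) (fun t => - expR (- t))
  (fun t => x * t `^ (x - 1)) (fun t => expR (- t)) a b) //; last 6 first.
- apply: cont_within => // t t0; apply: continuousM; first exact: cst_continuous.
  by apply: derivable_cont; have [] := is_derive1_powR (x - 1) t0.
- by apply: derivable_LR => // t t0; have [] := is_derive1_powR x t0.
- move=> t; rewrite in_itv /= => /andP[at_ _]; rewrite derive1E.
  by have [_ ->] := is_derive1_powR x (lt_trans a0 at_).
- apply: cont_within => // t t0.
  by apply: derivable_cont; have [] := is_derive_expRN t.
- by apply: derivable_LR.
- move=> t _; rewrite derive1E.
  by have [_ ->] := is_deriveN (is_derive_expRN t); rewrite opprK.
have -> : (\int[mu]_(t in `[a, b]) (x * t `^ (x - 1) * - expR (- t))%:E =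
    - (x%:E * \int[mu]_(t in `[a, b]) (gf x t)%:E))%E.
  rewrite -mulNe -EFinN -integralZl //; last exact: intgf.
  by apply: eq_integral => t _; rewrite /gf -EFinM; congr EFin; ring.
by rewrite oppeK; congr (_ + _)%E; congr EFin; ring.
Qed.

Let cvg_pow_exp0 x : 0 < x ->
  (n.+1%:R^-1 `^ x * expR (- n.+1%:R^-1) - n.+1%:R `^ x * expR (- n.+1%:R))
    @[n --> \oo] --> (0 : R).
Proof.
move=> x0.
have harm : (n.+1%:R^-1 : R) @[n --> \oo] --> 0 by exact: cvg_harmonic.
rewrite -[X in _ --> X]subr0; apply: cvgB.
  apply: (@squeeze_cvgr _ _ _ _ (fun=> 0) (fun n => n.+1%:R^-1 `^ x)).
  - apply: nearW => n; rewrite mulr_ge0 ?powR_ge0 ?expR_ge0 //=.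
    by rewrite ler_piMr ?powR_ge0 // expR_le1 oppr_le0 invr_ge0.
  - exact: cvg_cst.
  - by have /cvg_at_rightP := powR_cvg0 x0; apply; split.
apply: (@squeeze_cvgr _ _ _ _ (fun=> 0)
  (fun n => (x + 1) `^ (x + 1) * n.+1%:R^-1)).
- apply: nearW => n; rewrite mulr_ge0 ?powR_ge0 ?expR_ge0 //=.
  have x1 : 0 < x + 1 by rewrite addr_gt0.
  rewrite ler_pdivlMr // mulrAC -[X in _ * X * _]powRr1 // -powRD; last first.
    by rewrite pnatr_eq0 implybT.
  rewrite expRN ler_pdivrMr ?expR_gt0 //.
  have -> : expR (n.+1%:R : R) = (expR (n.+1%:R / (x + 1))) `^ (x + 1).
    by rewrite -expRM mulfVK // gt_eqF.
  rewrite -powRM ?expR_ge0 ?(ltW x1) //; apply: ge0_ler_powR; rewrite ?nnegrE //.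
  + exact: ltW.
  + by rewrite mulr_ge0 ?expR_ge0 // ltW.
  + rewrite mulrC -ler_pdivrMr //; apply: le_trans (expR_ge1Dx _).
    by rewrite lerDr.
- exact: cvg_cst.
- by rewrite -[X in _ --> X](mulr0 ((x + 1) `^ (x + 1))); apply: cvgMr.
Qed.

Let gf0y_rec x : 0 < x -> (int_0y (gf (x + 1)) = x%:E * int_0y (gf x))%E.
Proof.
move=> x0.
have h y := @exhaustion (gf y) 1%N isT (@gf_cont y) (gf_ge0 y).
apply: (cvg_unique _ (h (x + 1))) => //=.
have h2 : ((n.+1%:R^-1 `^ x * expR (- n.+1%:R^-1)
     - n.+1%:R `^ x * expR (- n.+1%:R))%:E +
    x%:E * int_ab (gf x) (n.+1%:R ^- 1) (n.+1%:R ^+ 1))%E @[n --> \oo] -->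
    (0%:E + x%:E * int_0y (gf x))%E.
  apply: cvgeD.
  - by rewrite fin_num_adde_defr.
  - by apply: cvg_EFin; [exact: nearW|exact: cvg_pow_exp0].
  - by apply: cvgeZl => //; exact: h.
rewrite add0e in h2; apply: cvg_trans h2; apply: near_eq_cvg.
exists 1%N => // n /= n1; rewrite gf_parts ?expr1 ?invr_gt0 //.
by rewrite (lt_trans (_ : _ < 1)) ?invf_lt1 ?ltr1n.
Qed.

(** By the recurrence it is enough to treat [x + 1]; there [t ^ x <= C * expR (t / 2)],
    and an exponential is left. *)
Let gf0y_lty x : 0 < x -> (int_0y (gf x) < +oo)%E.
Proof.
move=> x0; suff h : (int_0y (gf (x + 1)) < +oo)%E.
  move: h; rewrite gf0y_rec //; case: (int_0y (gf x)) => [h _||]; rewrite ?ltry //.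
  by rewrite gt0_muley ?lte_fin.
pose C := (x *+ 2) `^ x.
have le t : 0 < t -> gf (x + 1) t <= C * expR (- 2^-1 * t).
  move=> t0; rewrite /gf addrK.
  have -> : expR (- t) = expR (- (t / 2)) * expR (- 2^-1 * t).
    by rewrite -expRD; congr expR; field.
  rewrite mulrA ler_wpM2r ?expR_ge0 // expRN ler_pdivrMr ?expR_gt0 //.
  have -> : expR (t / 2) = (expR (t / (x *+ 2))) `^ x.
    by rewrite -expRM; congr expR; field; rewrite gt_eqF.
  have x2 : 0 < x *+ 2 by rewrite pmulrn_rgt0.
  rewrite /C -powRM ?expR_ge0 ?(ltW x2) //; apply: ge0_ler_powR; rewrite ?nnegrE.
  + exact: ltW.
  + exact: ltW.
  + by rewrite mulr_ge0 ?expR_ge0 ?ltW.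
  + rewrite mulrC -ler_pdivrMr //; apply: le_trans (expR_ge1Dx _).
    by rewrite lerDr.
have cE t : {for t, continuous (fun t : R => C * expR (- 2^-1 * t))}.
  apply: continuousM; first exact: cst_continuous.
  apply: (@continuous_comp _ _ _ (fun t : R => - 2^-1 * t) expR); last exact: continuous_expR.
  by apply: continuousM; [exact: cst_continuous|exact: cvg_id].
apply: (@le_lt_trans _ _ (\int[mu]_(t in `[0%R, +oo[) (C * expR (- 2^-1 * t))%:E)%E).
  apply: (@le_trans _ _ (\int[mu]_(t in `]0%R, +oo[) (C * expR (- 2^-1 * t))%:E)%E).
    apply: ge0_le_integral => //=.
    - by move=> t _; rewrite lee_fin.
    - apply/measurable_EFinP; apply: pos_measurable => t; exact: gf_cont.
    - by apply/measurable_EFinP; apply: pos_measurable => t _; exact: cE.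
    - by move=> t; rewrite in_itv /= andbT lee_fin; exact: le.
  apply: ge0_subset_integral => //=.
  - apply/measurable_EFinP; apply: measurable_funTS.
    by apply: continuous_measurable_fun => t; exact: cE.
  - by move=> t _; rewrite lee_fin mulr_ge0 ?powR_ge0 ?expR_ge0.
  - by move=> t /=; rewrite !in_itv /= !andbT; exact: ltW.
have dF (t : R) : is_derive t 1 (fun t => - (2 * C) * expR (- 2^-1 * t))
    (C * expR (- 2^-1 * t)).
  have h1 : is_derive t 1 (fun t => - 2^-1 * t) (- 2^-1).
    apply: (is_derive_eq (@is_deriveZ _ _ _ id (- 2^-1) t 1 1 _)).
    by rewrite /GRing.scale /= mulr1.
  have h2 := is_derive1_comp (is_derive_expR (- 2^-1 * t)) h1.
  apply: (is_derive_eq (@is_deriveZ _ _ _ _ (- (2 * C)) t 1 _ h2)).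
  by rewrite /GRing.scale /=; field.
rewrite (@ge0_continuous_FTC2y _ _ (fun t => - (2 * C) * expR (- 2^-1 * t)) _ 0).
- by rewrite -EFinB ltry.
- by move=> t _; rewrite mulr_ge0 ?powR_ge0 ?expR_ge0.
- by apply: continuous_subspaceT => t; exact: cE.
- rewrite -[X in _ --> X](mulr0 (- (2 * C))); apply: cvgMr.
  under eq_fun do rewrite mulNr.
  apply: (@cvg_comp _ _ _ (fun t : R => 2^-1 * t) (fun u : R => expR (- u)) _ +oo%R).
    by apply: gt0_cvgMry.
  exact: cvgr_expR.
- by move=> t _; have [] := dF t.
- have cF0 : {for 0, continuous (fun t : R => - (2 * C) * expR (- 2^-1 * t))}.
    by apply: derivable_cont; have [] := dF 0.
  exact: cvg_at_right_filter cF0.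
- by move=> t _; rewrite derive1E; have [_ ->] := dF t.
Qed.

Let gf_integrable x : 0 < x -> mu.-integrable `]0%R, +oo[ (EFin \o gf x).
Proof.
move=> x0; apply/integrableP; split.
  by apply/measurable_EFinP; apply: pos_measurable => t; exact: gf_cont.
under eq_integral do rewrite /= ger0_norm //.
exact: gf0y_lty.
Qed.

Lemma gamma_integral_rec x : 0 < x ->
  gamma_integral (x + 1) = x * gamma_integral x.
Proof.
move=> x0; have := gf0y_rec x0; rewrite /gamma_integral /Rintegral => h.
rewrite [X in fine X]h; apply: fineM => //.
by apply: integrable_fin_num => //; exact: gf_integrable.
Qed.

(** On the interval from [1] to [2] both [|ln t| <= 1] and [t <= 2], whence the lower
    bound [c] of the integrand. *)
Lemma gamma_integral_gt0 x : 0 < x -> 0 < gamma_integral x.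
Proof.
move=> x0; pose c := expR (- `|x - 1| - 2).
have sub : `[1, 2]%classic `<=` (`]0, +oo[%classic : set R).
  by move=> t /=; rewrite !in_itv /= andbT => /andP[+ _]; apply: lt_le_trans.
suff : c <= gamma_integral x by apply: lt_le_trans; exact: expR_gt0.
rewrite -lee_fin fineK; last by apply: integrable_fin_num => //; exact: gf_integrable.
apply: (@le_trans _ _ (\int[mu]_(t in `[1%R, 2%R]) c%:E)%E).
  rewrite integral_cst //= lebesgue_measure_itv /= lte_fin ltr1n /=.
  by rewrite -EFinB -EFinM lee_fin (_ : 2 - 1 = 1 :> R) ?mulr1 //; ring.
apply: (@le_trans _ _ (\int[mu]_(t in `[1%R, 2%R]) (gf x t)%:E)%E).
  apply: ge0_le_integral => //=.
  - by move=> t _; rewrite lee_fin expR_ge0.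
  - apply/measurable_EFinP; apply: measurable_funS (pos_measurable (@gf_cont x)) => //.
  - move=> t; rewrite in_itv /= => /andP[t1 t2].
    have t0 : 0 < t by exact: lt_le_trans t1.
    rewrite lee_fin /gf /powR gt_eqF // -expRD ler_expR.
    apply: lerB => //; rewrite lerNl -mulNr.
    apply: (@le_trans _ _ (`|x - 1| * ln t)).
      by rewrite ler_wpM2r ?ln_ge0 // -normrN ler_norm.
    rewrite ler_piMr //.
    have h : -1 < (t : R) - 1 by rewrite ltrBrDr addNr.
    have := le_ln1Dx h; rewrite addrC subrK => /le_trans; apply.
    by rewrite lerBlDr.
apply: ge0_subset_integral => //=.
- by apply/measurable_EFinP; apply: pos_measurable => t; exact: gf_cont.
- by move=> t _; rewrite lee_fin gf_ge0.
Qed.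

Let gamma_integral_le c d x y z : 0 < x -> 0 < y -> 0 < z ->
  (forall t, 0 < t -> gf z t <= c * gf x t + d * gf y t) ->
  gamma_integral z <= c * gamma_integral x + d * gamma_integral y.
Proof.
move=> x0 y0 z0 le.
have ix := gf_integrable x0; have iy := gf_integrable y0.
have iz := gf_integrable z0.
have icx : mu.-integrable `]0%R, +oo[ (EFin \o (fun t => c * gf x t)).
  exact: integrableZl ix.
have idy : mu.-integrable `]0%R, +oo[ (EFin \o (fun t => d * gf y t)).
  exact: integrableZl iy.
have icd : mu.-integrable `]0%R, +oo[ (EFin \o (fun t => c * gf x t + d * gf y t)).
  exact: (integrableD _ icx idy).
have h := @le_Rintegral _ _ _ mu `]0%R, +oo[%classic _ _ (measurable_itv _) iz icd.
rewrite RintegralD // !RintegralZl // in h.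
by apply: h => t /=; rewrite in_itv /= andbT; exact: le.
Qed.

(** Logarithmic convexity: the weighted AM-GM inequality applied to the
    integrands, after rescaling each of them to have the same integral. *)
Lemma gamma_integral_logconvex (l x y : R) : 0 <= l -> l <= 1 -> 0 < x -> 0 < y ->
  gamma_integral (l * x + (1 - l) * y) <=
  gamma_integral x `^ l * gamma_integral y `^ (1 - l).
Proof.
move=> l0 l1 x0 y0.
have z0 : 0 < l * x + (1 - l) * y.
  have [->|ln0] := eqVneq l 0; first by rewrite mul0r add0r subr0 mul1r.
  rewrite ltr_wpDr ?mulr_ge0 ?subr_ge0 ?(ltW y0) // mulr_gt0 //.
  by rewrite lt_neqAle eq_sym ln0.
have le c d := @gamma_integral_le c d x y _ x0 y0 z0.
have := gamma_integral_gt0 x0; have := gamma_integral_gt0 y0.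
move: (gamma_integral x) (gamma_integral y) le => X Y le Y0 X0.
have [G GE] : {G | G = X `^ l * Y `^ (1 - l)} by eexists.
have G0 : 0 < G by rewrite GE mulr_gt0 // powR_gt0.
rewrite -GE.
have -> : G = (l * (G / X)) * X + ((1 - l) * (G / Y)) * Y.
  by rewrite -!mulrA !mulVf ?gt_eqF // !mulr1 -mulrDl addrC subrK mul1r.
apply: le => t t0.
have e : gf (l * x + (1 - l) * y) t = gf x t `^ l * gf y t `^ (1 - l).
  rewrite /gf !powRM ?powR_ge0 ?expR_ge0 // mulrACA -!powRrM -!expRM -expRD.
  rewrite -powRD; last by rewrite (gt_eqF t0) implybT.
  by congr (_ `^ _ * expR _); ring.
rewrite [leLHS]e.
have -> A B : 0 <= A -> 0 <= B -> A `^ l * B `^ (1 - l) =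
    (G / X * A) `^ l * (G / Y * B) `^ (1 - l).
  move=> A0 B0.
  have GX0 : 0 <= G / X by rewrite divr_ge0 // ltW.
  have GY0 : 0 <= G / Y by rewrite divr_ge0 // ltW.
  rewrite !(powRM _ GX0) // !(powRM _ GY0) // mulrACA -[LHS]mul1r; congr (_ * _).
  rewrite !powRM ?invr_ge0 ?(ltW X0) ?(ltW Y0) ?(ltW G0) // mulrACA.
  rewrite -powRD; last by rewrite (gt_eqF G0) implybT.
  rewrite addrC subrK powRr1 ?(ltW G0) //.
  rewrite -!powR_inv1 ?(ltW X0) ?(ltW Y0) // -!powRrM !mulN1r !powRN -invfM -GE.
  by rewrite divff // gt_eqF.
- rewrite -!mulrA; apply: weighted_AMGM => //.
    by apply: mulr_ge0; [exact: ltW|apply: mulr_ge0; rewrite ?gf_ge0 ?invr_ge0 // ltW].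
  by apply: mulr_ge0; [exact: ltW|apply: mulr_ge0; rewrite ?gf_ge0 ?invr_ge0 // ltW].
- exact: gf_ge0.
- exact: gf_ge0.
Qed.

Let gauss_sqr_substitution a b : 0 < a -> a < b ->
  int_ab (gf 2^-1) (a ^+ 2) (b ^+ 2) = int_ab (fun t => 2 * gauss_fun t) a b.
Proof.
move=> a0 ab.
have dE : (fun t : R => t ^+ 2)^`()%classic = (fun t => 2 * t).
  by apply/funext => t; rewrite exp_derive1 expr1.
have c2 (t : R) : {for t, continuous (fun t : R => 2 * t)}.
  by apply: continuousM; [exact: cst_continuous|exact: cvg_id].
rewrite /int_ab (@integration_by_substitution_increasing R (fun t => t ^+ 2)) //.
- apply: eq_integral => t /set_mem /=; rewrite in_itv /= => /andP[at_ _].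
  have t0 : 0 < t by exact: lt_le_trans at_.
  rewrite dE; congr EFin.
  have pointwise u : 0 < u -> gf 2^-1 (u ^+ 2) * (2 * u) = 2 * gauss_fun u.
    move=> u0; rewrite /gf /gauss_fun -[in X in X `^ _]powR_mulrn ?(ltW u0) //.
    rewrite -powRrM (_ : 2 * (2^-1 - 1) = -1 :> R); last by field.
    by rewrite powR_inv1 ?(ltW u0) //; field; rewrite gt_eqF.
  exact: pointwise t0.
- exact: ltW.
- move=> s t; rewrite !in_itv /= => /andP[as_ _] /andP[at_ _] st.
  by rewrite ltrXn2r // ?nnegrE (le_trans (ltW a0)).
- by rewrite dE => t _; exact: c2.
- by rewrite dE; apply/cvg_ex; exists (2 * a); apply: cvg_at_right_filter; exact: c2.
- by rewrite dE; apply/cvg_ex; exists (2 * b); apply: cvg_at_left_filter; exact: c2.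
- by apply: derivable_LR => // t _; exact: exprn_derivable.
- apply: cont_within; [by rewrite exprn_gt0|exact: gf_cont].
Qed.

(** The substitution [t = s ^ 2] turns this integral into twice the Gauss integral
    over the half line. *)
Lemma gamma_integral_half : gamma_integral (2^-1) = Num.sqrt pi :> R.
Proof.
pose g2 t : R := 2 * gauss_fun t.
have cg2 t : {for t, continuous g2}.
  by apply: continuousM; [exact: cst_continuous|exact: continuous_gauss_fun].
have g2_ge0 t : 0 <= g2 t by rewrite mulr_ge0 // gauss_fun_ge0.
have h1 := @exhaustion (gf 2^-1) 2 isT (@gf_cont _) (gf_ge0 _).
have h2 := @exhaustion g2 1 isT (fun t _ => cg2 t) g2_ge0.
have e : int_0y (gf 2^-1) = int_0y g2.
  suff h3 : int_ab (gf 2^-1) (n.+1%:R ^+ 2)^-1 (n.+1%:R ^+ 2) @[n --> \oo] -->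
    int_0y g2 by exact: (cvg_unique _ h1 h3).
  apply: cvg_trans h2; apply: near_eq_cvg.
  exists 1%N => // n n1; rewrite expr1 -exprVn.
  rewrite gauss_sqr_substitution ?invr_gt0 //.
  by rewrite (lt_trans (_ : _ < 1)) ?invf_lt1 ?ltr1n.
rewrite /gamma_integral /Rintegral [X in fine X]e /int_0y.
rewrite (integral_itv_obnd_cbnd _); last first.
  by apply/measurable_EFinP; apply: pos_measurable => t _; exact: cg2.
under eq_integral do rewrite /g2 EFinM.
rewrite ge0_integralZl //=; last first.
- by move=> t _; rewrite lee_fin gauss_fun_ge0.
- by apply/measurable_EFinP; apply: measurable_funTS; exact: measurable_gauss_fun.
by rewrite integral0y_gauss -EFinM /=; field.
Qed.

Lemma gamma_integral_1 : gamma_integral 1 = 1 :> R.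
Proof.
have dF (t : R) : is_derive t 1 (fun u => - expR (- u)) (expR (- t)).
  have h := @is_derive1_comp R expR (fun u => - u) t (expR (- t)) (-1).
  apply: (is_derive_eq (is_deriveN (h _ _))); by rewrite mulrN1 opprK.
have cF (t : R) : {for t, continuous (fun u => - expR (- u))}.
  by apply: differentiable_continuous; apply/derivable1_diffP; have [] := dF t.
have cE (t : R) : {for t, continuous (fun u => expR (- u))}.
  have -> : (fun u : R => expR (- u)) = (fun u => - - expR (- u)).
    by apply/funext => u; rewrite opprK.
  by apply: continuousN; exact: cF.
rewrite /gamma_integral.
under eq_Rintegral do rewrite subrr powRr0 mul1r.
rewrite /Rintegral integral_itv_obnd_cbnd; last first.
  apply/measurable_EFinP; apply: measurable_funTS.
  by apply: continuous_measurable_fun => t; exact: cE.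
rewrite (@ge0_continuous_FTC2y _ _ (fun t => - expR (- t)) _ 0).
- by rewrite oppr0 expR0 -EFinB /= opprK add0r.
- by move=> t _; rewrite expR_ge0.
- by apply: continuous_subspaceT => t; exact: cE.
- by rewrite -oppr0; apply: cvgN; exact: cvgr_expR.
- by move=> t _; have [] := dF t.
- exact: cvg_at_right_filter (cF 0).
- by move=> t _; rewrite derive1E; have [_ ->] := dF t.
Qed.

End GammaFunction.

(** * Gamma quotients *)

Section GammaConsequences.
Context {R : realType}.
Implicit Types (x y s t : R).

Lemma GammaE x : 0 < x -> Gamma x = gamma_integral x.
Proof. by rewrite /Gamma => ->. Qed.

Lemma Gamma_gt0 x : 0 < x -> 0 < Gamma x.
Proof. by move=> x0; rewrite GammaE // gamma_integral_gt0. Qed.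

Lemma GammaS x : 0 < x -> Gamma (x + 1) = x * Gamma x.
Proof. by move=> x0; rewrite !GammaE ?addr_gt0 // gamma_integral_rec. Qed.

Lemma Gamma_half : Gamma (1 / 2) = Num.sqrt pi :> R.
Proof. by rewrite GammaE ?div1r // gamma_integral_half. Qed.

Lemma Gamma_1 : Gamma 1 = 1 :> R.
Proof. by rewrite GammaE // gamma_integral_1. Qed.

(** Below [0] the definition shifts the argument once, as [floor (- t) = - 1]. *)
Lemma GammaN t : 0 < t -> t < 1 -> Gamma (- t) = - (Gamma (1 - t) / t).
Proof.
move=> t0 t1; rewrite /Gamma oppr_gt0 ltNge (ltW t0) /= subr_gt0 t1.
have -> : Num.floor (- t) = -1.
  apply/eqP; rewrite -[-1 : int]/(- 1%:Z) floor_eq //=.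
  by rewrite mulrN1z mulr0z lerN2 (ltW t1) oppr_lt0 t0.
rewrite /= big_ord1 mulr1n addr0 [- t + _]addrC invrN mulrN.
by [].
Qed.

Lemma Gamma_logconvex l x y : 0 <= l -> l <= 1 -> 0 < x -> 0 < y ->
  Gamma (l * x + (1 - l) * y) <= Gamma x `^ l * Gamma y `^ (1 - l).
Proof.
move=> l0 l1 x0 y0; rewrite !GammaE //; first exact: gamma_integral_logconvex.
have [->|ln0] := eqVneq l 0; first by rewrite mul0r add0r subr0 mul1r.
rewrite ltr_wpDr ?mulr_ge0 ?subr_ge0 ?(ltW y0) // mulr_gt0 //.
by rewrite lt_neqAle eq_sym ln0.
Qed.

(** Log-convexity between [x] and [x + 1]. *)
Lemma Gamma_shift_le x s : 0 < x -> 0 <= s -> s <= 1 ->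
  Gamma (x + s) <= x `^ s * Gamma x.
Proof.
move=> x0 s0 s1.
have l0 : 0 <= 1 - s by rewrite subr_ge0.
have l1 : 1 - s <= 1 by rewrite gerBl.
have := Gamma_logconvex l0 l1 x0 (addr_gt0 x0 ltr01).
rewrite (_ : (1 - s) * x + _ = x + s); last by ring.
rewrite GammaS // subKr powRM ?(ltW x0) ?(ltW (Gamma_gt0 x0)) //.
rewrite mulrCA -powRD ?(gt_eqF (Gamma_gt0 x0)) ?implybT // subrK powRr1 //.
by rewrite ltW // Gamma_gt0.
Qed.

Lemma Gamma_shift_ge x s : 0 < x -> 0 <= s -> s <= 1 ->
  x * Gamma x <= (x + s) `^ (1 - s) * Gamma (x + s).
Proof.
move=> x0 s0 s1; rewrite -GammaS // (_ : x + 1 = x + s + (1 - s)); last by ring.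
by apply: Gamma_shift_le; rewrite ?subr_ge0 ?gerBl // ltr_wpDr.
Qed.

(** Gautschi's inequality, with the error term made explicit. *)
Lemma Gamma_shift_bounds s n : 0 <= s -> s <= 1 -> (0 < n)%N ->
  n%:R / n.+1%:R * (n%:R `^ s * Gamma n%:R) <= Gamma (n%:R + s) <=
  n%:R `^ s * Gamma (n%:R : R).
Proof.
move=> s0 s1 n0; have n0R : 0 < n%:R :> R by rewrite ltr0n.
rewrite Gamma_shift_le // andbT.
have ns0 : 0 < n%:R + s by rewrite ltr_wpDr.
have h := Gamma_shift_ge n0R s0 s1.
rewrite mulrAC ler_pdivrMr // mulrCA.
apply: le_trans (ler_wpM2l (powR_ge0 _ _) h) _.
rewrite mulrCA mulrA [leRHS]mulrC.
rewrite ler_wpM2r ?(ltW (Gamma_gt0 ns0)) //.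
apply: (@le_trans _ _ ((n%:R + s) `^ (1 - s) * (n%:R + s) `^ s)).
  by rewrite ler_wpM2l ?powR_ge0 // ge0_ler_powR ?nnegrE ?(ltW ns0) // lerDl.
rewrite -powRD ?(gt_eqF ns0) ?implybT // subrK powRr1 ?(ltW ns0) //.
by rewrite -natr1 lerD2l.
Qed.

Lemma Gamma_ratio_asymp s n : 0 <= s -> s <= 1 -> (0 < n)%N ->
  `|Gamma (n%:R + s) / Gamma (n%:R + 1 - s) - n%:R `^ (2 * s - 1)| <=
  n%:R `^ (2 * s - 1) / n%:R.
Proof.
move=> s0 s1 n0; have n0R : 0 < n%:R :> R by rewrite ltr0n.
have /andP[a1 a2] := Gamma_shift_bounds s0 s1 n0.
have : 0 <= 1 - s by rewrite subr_ge0.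
have : 1 - s <= 1 by rewrite gerBl.
move=> t1 t0; have /andP[b1 b2] := Gamma_shift_bounds t0 t1 n0.
rewrite -addrA.
have -> : n%:R `^ (2 * s - 1) = n%:R `^ s / n%:R `^ (1 - s) :> R.
  by rewrite -powRB ?(gt_eqF n0R) ?implybT //; congr powR; ring.
move: (Gamma_gt0 n0R) (powR_gt0 s n0R) (powR_gt0 (1 - s) n0R) a1 a2 b1 b2.
have : 0 < Gamma (n%:R + (1 - s)) by rewrite Gamma_gt0 // ltr_wpDr.
move: (Gamma (n%:R + s)) (Gamma (n%:R + (1 - s))) (Gamma n%:R) (n%:R `^ s)
  (n%:R `^ (1 - s)) => X Y G p q Y0 G0 p0 q0 a1 a2 b1 b2.
have S0 : 0 < n.+1%:R :> R by [].
have SE : n.+1%:R = n%:R + 1 :> R by rewrite natr1.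
move: n.+1%:R S0 SE a1 b1 => N1 S0 SE a1 b1.
have r1 : X / Y <= (p / q) * (N1 / n%:R).
  rewrite ler_pdivrMr //; apply: le_trans a2 _.
  have c0 : 0 <= (p / q) * (N1 / n%:R) by rewrite !mulr_ge0 ?invr_ge0 ?ler0n // ltW.
  apply: le_trans (ler_wpM2l c0 b1); rewrite le_eqVlt; apply/orP; left.
  by apply/eqP; field; rewrite (gt_eqF q0) (gt_eqF n0R) (gt_eqF S0).
have r2 : (p / q) * (n%:R / N1) <= X / Y.
  rewrite ler_pdivlMr //; apply: le_trans a1.
  apply: le_trans (ler_wpM2l _ b2) _; first by rewrite !mulr_ge0 ?invr_ge0 // ltW.
  rewrite le_eqVlt; apply/orP; left; apply/eqP; field.
  by rewrite (gt_eqF q0) (gt_eqF S0).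
have pq0 : 0 < p / q by rewrite divr_gt0.
rewrite ler_norml; apply/andP; split.
  rewrite lerBrDl; apply: le_trans r2.
  rewrite -{1}[p / q]mulr1 -mulrBr ler_wpM2l ?(ltW pq0) //.
  rewrite ler_pdivlMr // mulrBl mul1r SE mulrDr mulr1.
  rewrite mulVf ?gt_eqF //; have : 0 < n%:R^-1 :> R by rewrite invr_gt0.
  lra.
rewrite lerBlDr; apply: le_trans r1 _.
rewrite -{3}[p / q]mulr1 -mulrDr ler_wpM2l ?(ltW pq0) //.
by rewrite SE mulrDl mul1r divff ?gt_eqF // addrC.
Qed.

(** Both Gamma values are brought to arguments in [[n, n + 1]] by the functional
    equation; the factor [3] absorbs the resulting [n (n + 1) / (n ^ 2 - s ^ 2)]. *)
Lemma Gamma_kernel_le s n : 0 < s -> s < 2^-1 -> (0 < n)%N ->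
  Gamma (n%:R - s) / Gamma (n%:R + 1 + s) <= 3 * n%:R `^ (- (2 * s) - 1).
Proof.
move=> s0 s1 n0; have n0R : 0 < n%:R :> R by rewrite ltr0n.
have n1R : 1 <= n%:R :> R by rewrite ler1n.
have s11 : s <= 1 by apply: le_trans (ltW s1) _; rewrite invf_le1 // ler1n.
have /andP[b1 b2] := Gamma_shift_bounds (ltW s0) s11 n0.
have : 0 <= 1 - s by rewrite subr_ge0.
have : 1 - s <= 1 by rewrite gerBl ltW.
move=> t1 t0; have /andP[a1 a2] := Gamma_shift_bounds t0 t1 n0.
have ns0 : 0 < n%:R - s by lra.
have ns1 : 0 < n%:R + s by rewrite addr_gt0.
rewrite addrAC GammaS // ler_pdivrMr ?mulr_gt0 ?Gamma_gt0 //.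
have e : Gamma (n%:R + (1 - s)) = (n%:R - s) * Gamma (n%:R - s).
  by rewrite -GammaS //; congr Gamma; ring.
rewrite e in a2.
rewrite -(ler_pM2l ns0); apply: le_trans a2 _.
have -> : n%:R `^ (1 - s) = n%:R `^ (- (2 * s) - 1) * n%:R `^ s * n%:R ^+ 2 :> R.
  rewrite -powR_mulrn ?(ltW n0R) // -!powRD ?(gt_eqF n0R) ?implybT //.
  by congr powR; ring.
move: (powR_gt0 (- (2 * s) - 1) n0R) b1 (powR_gt0 s n0R) (Gamma_gt0 n0R) (Gamma_gt0 ns1).
move: (n%:R `^ (- (2 * s) - 1)) (n%:R `^ s) (Gamma n%:R) (Gamma (n%:R + s)) => q p G X q0 b1 p0 G0 X0.
have -> : (n%:R - s) * (3 * q * ((n%:R + s) * X)) = q * (3 * (n%:R ^+ 2 - s ^+ 2) * X) by ring.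
have -> : q * p * n%:R ^+ 2 * G = q * (p * G * n%:R ^+ 2) by ring.
rewrite ler_pM2l //.
have h1 : p * G * n%:R <= X * n.+1%:R by rewrite -ler_pdivrMr //; apply: le_trans b1; rewrite [leRHS]mulrC mulrA.
have h2 : n.+1%:R * n%:R <= 3 * (n%:R ^+ 2 - s ^+ 2).
  by rewrite -natr1; nra.
apply: (@le_trans _ _ (X * n.+1%:R * n%:R)).
  by rewrite expr2 mulrA ler_wpM2r // ltW.
by rewrite -mulrA mulrC ler_wpM2r // ltW.
Qed.

(** [gammaq t] is, up to the factor [4 ^ t / sqrt pi], the central coefficient
    of the symbol [(2 - 2 cos) ^ t]. *)
Definition gammaq t : R := Gamma (1 / 2 + t) / Gamma (1 + t).

Lemma gammaq_gt0 t : - (1 / 2) < t -> 0 < gammaq t.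
Proof. by move=> h; rewrite divr_gt0 // Gamma_gt0 //; lra. Qed.

Lemma gammaqS t : - (1 / 2) < t ->
  gammaq (t + 1) = gammaq t * ((1 / 2 + t) / (1 + t)).
Proof.
move=> h; rewrite /gammaq !addrA.
have h1 : 0 < 1 / 2 + t by lra.
have h2 : 0 < 1 + t by lra.
by rewrite !GammaS // invfM mulrACA mulrC.
Qed.

(** Log-convexity between [1 / 2 + s] and [1 + t]: the points [1 / 2 + t] and [1 + s]
    lie between them and have the same sum. *)
Lemma gammaq_decreasing s t : - (1 / 2) < s -> s <= t -> gammaq t <= gammaq s.
Proof.
move=> hs st.
have a0 : 0 < 1 / 2 + s by lra.
have b0 : 0 < 1 + t by lra.
have u0 : 0 < 1 / 2 + t by lra.
have v0 : 0 < 1 + s by lra.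
have D0 : 0 < 1 / 2 + t - s by lra.
pose l := (1 / 2) / (1 / 2 + t - s).
have l0 : 0 <= l by rewrite divr_ge0 // ltW.
have l1 : l <= 1 by rewrite ler_pdivrMr // mul1r; lra.
have l0' : 0 <= 1 - l by rewrite subr_ge0.
have l1' : 1 - l <= 1 by rewrite gerBl.
have h1 := Gamma_logconvex l0 l1 a0 b0.
have h2 := Gamma_logconvex l0' l1' a0 b0.
rewrite (_ : l * (1 / 2 + s) + _ = 1 / 2 + t) in h1; last first.
  by rewrite /l; field; rewrite gt_eqF //; lra.
rewrite (_ : (1 - l) * (1 / 2 + s) + _ = 1 + s) in h2; last first.
  by rewrite /l; field; rewrite gt_eqF //; lra.
have {h1 h2}h := ler_pM (ltW (Gamma_gt0 u0)) (ltW (Gamma_gt0 v0)) h1 h2.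
rewrite subKr in h.
rewrite mulrACA -!powRD ?(gt_eqF (Gamma_gt0 a0)) ?(gt_eqF (Gamma_gt0 b0)) ?implybT // in h.
rewrite subrK [_ + (1 - l)]addrC subrK !powRr1 ?(ltW (Gamma_gt0 a0)) ?(ltW (Gamma_gt0 b0)) // in h.
by rewrite /gammaq ler_pdivrMr ?Gamma_gt0 // mulrAC ler_pdivlMr ?Gamma_gt0.
Qed.

End GammaConsequences.

(** * Coefficients of the powers of 2 - 2 cos *)

Section SymbolCoefficients.
Context {R : realType}.
Implicit Types (t s : R) (z : int) (n : nat).

Definition coef_ratio t n : R := \prod_(i < n) ((i%:R - t) / (i%:R + 1 + t)).

Definition center_coef t : R := 4 `^ t / Num.sqrt pi * gammaq t.

(** The [z]-th Fourier coefficient of [(2 - 2 cos) ^ t], written as a product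
    that stays meaningful at the poles of the closed formula. *)
Definition coef t z : R := center_coef t * coef_ratio t `|z|%N.

Lemma coef_ratio0 t : coef_ratio t 0 = 1.
Proof. by rewrite /coef_ratio big_ord0. Qed.

Lemma coef_ratioS t n :
  coef_ratio t n.+1 = coef_ratio t n * ((n%:R - t) / (n%:R + 1 + t)).
Proof. by rewrite /coef_ratio big_ord_recr. Qed.

Lemma coef_at0 t : coef t 0 = center_coef t.
Proof. by rewrite /coef coef_ratio0 mulr1. Qed.

Lemma sqrt_pi_gt0 : 0 < Num.sqrt pi :> R.
Proof. by rewrite sqrtr_gt0 pi_gt0. Qed.

Lemma center_coef_gt0 t : - (1 / 2) < t -> 0 < center_coef t.
Proof.
by move=> h; rewrite mulr_gt0 ?gammaq_gt0 // divr_gt0 ?sqrt_pi_gt0 // powR_gt0.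
Qed.

Lemma center_coef_0 : center_coef 0 = 1.
Proof.
rewrite /center_coef powRr0 /gammaq !addr0 Gamma_half Gamma_1 divr1 mul1r mulVf //.
by rewrite gt_eqF // sqrt_pi_gt0.
Qed.

Lemma center_coefS t : - (1 / 2) < t ->
  center_coef (t + 1) = center_coef t * (4 * ((1 / 2 + t) / (1 + t))).
Proof.
move=> h; rewrite /center_coef gammaqS // powRD ?pnatr_eq0 ?implybT // powRr1 //.
by ring.
Qed.

(** This is the differential equation [(1 - e) f' = - i t (1 + e) f], [e = exp (i theta)],
    of [f = (2 - 2 cos theta) ^ t], read on Fourier coefficients. *)
Lemma coef_rec t z : - (1 / 2) < t ->
  (z%:~R + 1 + t) * coef t (z + 1) = (z%:~R - t) * coef t z.
Proof.
move=> ht; rewrite /coef; case: z => n.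
  rewrite (_ : Posz n + 1 = Posz n.+1); last by lia.
  rewrite !absz_nat coef_ratioS -pmulrn; field.
  by rewrite gt_eqF //; have := ler0n R n; lra.
rewrite (_ : Negz n + 1 = - Posz n) ?NegzE; last by lia.
rewrite !abszN !absz_nat coef_ratioS mulrNz -pmulrn -natr1; field.
by rewrite gt_eqF //; have := ler0n R n; lra.
Qed.

Lemma coef_ratio_shift t n : - (1 / 2) < t ->
  coef_ratio (t + 1) n.+1 = - (coef_ratio t n * ((1 + t) ^+ 2 /
    ((n%:R + 1 + t) * (n%:R + 2 + t)))).
Proof.
move=> ht; elim: n => [|n IH].
  rewrite coef_ratioS !coef_ratio0; field.
  by rewrite !gt_eqF //; lra.
rewrite coef_ratioS IH [coef_ratio t n.+1]coef_ratioS -natr1; field.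
have := ler0n R n => h.
by rewrite !gt_eqF //; lra.
Qed.

(** Increasing the exponent by [1] multiplies the symbol by [2 - 2 cos], hence takes
    a second difference of the coefficients. *)
Lemma coef_shift t z : - (1 / 2) < t ->
  coef (t + 1) z = 2 * coef t z - coef t (z + 1) - coef t (z - 1).
Proof.
move=> ht.
suff pos n : coef (t + 1) (Posz n) =
    2 * coef t (Posz n) - coef t (Posz n + 1) - coef t (Posz n - 1).
  case: z => [//|n]; rewrite NegzE.
  have even s y : coef s (- y) = coef s y by rewrite /coef abszN.
  rewrite (_ : - Posz n.+1 + 1 = - (Posz n.+1 - 1)); last by lia.
  rewrite (_ : - Posz n.+1 - 1 = - (Posz n.+1 + 1)); last by lia.
  by rewrite !even pos; ring.
rewrite /coef center_coefS //; case: n => [|n].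
  rewrite (_ : absz (Posz 0 + 1)%R = 1%N) // (_ : absz (Posz 0 - 1)%R = 1%N) //.
  rewrite !coef_ratioS !coef_ratio0; field.
  by rewrite gt_eqF //; lra.
rewrite (_ : Posz n.+1 + 1 = Posz n.+2); last by lia.
rewrite (_ : Posz n.+1 - 1 = Posz n); last by lia.
rewrite !absz_nat coef_ratio_shift // !coef_ratioS -natr1; field.
have := ler0n R n => h.
by rewrite !gt_eqF //; lra.
Qed.

Lemma coef_0 z : coef 0 z = (z == 0)%:R.
Proof.
rewrite /coef center_coef_0 mul1r -absz_eq0; case: `|z|%N => [|n].
  by rewrite coef_ratio0.
by rewrite /coef_ratio big_ord_recl subr0 mul0r mul0r.
Qed.

(** Upwards and downwards from [0], the recurrence is solved by dividing by
    [n + 1 + t], which never vanishes. *)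
Lemma rec_unique t (u : int -> R) : - (1 / 2) < t ->
  (forall z, (z%:~R + 1 + t) * u (z + 1) = (z%:~R - t) * u z) ->
  forall z, u z = u 0 / center_coef t * coef t z.
Proof.
move=> ht hu z; rewrite /coef mulrA divfK ?gt_eqF ?center_coef_gt0 //.
have nz n : n%:R + 1 + t != 0 by rewrite gt_eqF //; have := ler0n R n; lra.
case: z => n.
  elim: n => [|n IH]; first by rewrite coef_ratio0 mulr1.
  have := hu (Posz n); rewrite (_ : Posz n + 1 = Posz n.+1); last by lia.
  rewrite -pmulrn IH !absz_nat coef_ratioS => h.
  by apply: (mulfI (nz n)); rewrite h; field.
elim: n => [|n IH].
  have := hu (- 1); rewrite addNr mulrNz mulr1z addNr add0r => h.
  apply: (mulfI (nz 0%N)); rewrite -[Negz 0]/(- 1 : int) /= coef_ratioS coef_ratio0.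
  have := nz 0%N; move: h; rewrite mul1r add0r => h n0.
  rewrite [RHS](_ : _ = - (t * u 0)); last by field; exact: n0.
  by rewrite h; ring.
have := hu (Negz n.+1); rewrite (_ : Negz n.+1 + 1 = Negz n); last by lia.
rewrite IH !NegzE !abszN !absz_nat mulrNz -pmulrn [coef_ratio t n.+2]coef_ratioS => h.
apply: (mulfI (nz n.+1)); rewrite mulrCA mulrA.
have := nz n.+1; move: h; rewrite -[n.+2%:R]natr1 => h n1.
rewrite [RHS](_ : _ = (n.+1%:R - t) * (u 0 * coef_ratio t n.+1)); last first.
  by move: n1; rewrite -natr1 => n1; field; move: n1; rewrite [n%:R + 1]addrC.
have -> : (n.+1%:R + 1 + t) * u (- Posz n.+2) = - ((- (n.+1%:R + 1) - t) * u (- Posz n.+2)) by ring.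
by rewrite -h; ring.
Qed.

End SymbolCoefficients.

Section KernelCoefficients.
Context {R : realType}.
Implicit Types (t s a : R) (z : int) (n : nat).

Lemma coef_ratio_Gamma a n : 0 < a -> a < 1 ->
  Gamma (n%:R + a) / Gamma (n%:R + 1 - a) =
  Gamma a / Gamma (1 - a) * coef_ratio (- a) n.
Proof.
move=> a0 a1; elim: n => [|n IH]; first by rewrite !add0r coef_ratio0 mulr1.
have := ler0n R n => n0.
have h1 : 0 < n%:R + a by lra.
have h2 : 0 < n%:R + 1 - a by lra.
rewrite coef_ratioS mulrA -IH -natr1.
rewrite (addrAC _ 1 a) (addrAC (n%:R + 1) 1) !GammaS //.
rewrite opprK; field.
by rewrite !gt_eqF ?Gamma_gt0.
Qed.

(** Both sides are multiples of the same product; at the origin they agree by the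
    definition of [cA]. *)
Lemma ker_neg a z : 0 < a -> a < 2^-1 -> ker (- a) z = coef (- a) z.
Proof.
move=> a0 a1; rewrite /ker ltNge (ltW (_ : - a < 0)) ?oppr_lt0 //= opprK.
have a2 : 0 < 1 / 2 - a by lra.
have a3 : 0 < 1 - a by lra.
rewrite -mulrA -/(_ / _) coef_ratio_Gamma //; last by lra.
rewrite /coef /center_coef /cA /gammaq ger0_norm ?(ltW (Gamma_gt0 a0)) //; field.
by rewrite !gt_eqF ?Gamma_gt0 ?sqrt_pi_gt0.
Qed.

(** The sign is that of [Gamma (- s)], whose absolute value enters [cA (- s)]. *)
Lemma ker_pos s z : 0 < s -> s < 2^-1 -> z != 0 -> ker s z = - coef s z.
Proof.
move=> s0 s1 z0; rewrite /ker s0 (negPf z0) /= /cA opprK.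
have s2 : s < 1 by lra.
have g1 : 0 < Gamma (1 - s) by rewrite Gamma_gt0 // subr_gt0.
have g2 : 0 < Gamma (1 + s) by rewrite Gamma_gt0 //; lra.
rewrite GammaN // normrN ger0_norm ?divr_ge0 ?ltW //.
have e n : Gamma (n.+1%:R - s) / Gamma (n.+1%:R + 1 + s) =
    - (Gamma (1 - s) / (s * Gamma (1 + s)) * coef_ratio s n.+1).
  elim: n => [|n IH].
    rewrite coef_ratioS coef_ratio0 !mul1r.
    rewrite addrAC GammaS; last by lra.
    by field; rewrite !gt_eqF //; lra.
  have := ler0n R n => n0.
  have h1 : 0 < n.+1%:R - s by rewrite -natr1; lra.
  have h2 : 0 < n.+1%:R + 1 + s by rewrite -natr1; lra.
  rewrite coef_ratioS -mulNr mulrA [X in _ = X * _]mulNr -IH -[n.+2%:R]natr1.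
  rewrite (addrAC _ 1 (- s)) (addrAC (n.+1%:R + 1) 1) !GammaS //.
  by rewrite invfM mulrACA mulrC.
have /prednK zE : (0 < `|z|)%N by rewrite absz_gt0.
rewrite /coef /center_coef /gammaq -zE -mulrA -/(_ / _) e.
by field; rewrite !gt_eqF ?sqrt_pi_gt0.
Qed.

Lemma ker_pos0 s : 0 < s -> ker s 0 = 0.
Proof. by move=> s0; rewrite /ker s0 eqxx. Qed.

End KernelCoefficients.

(** * Convolution of coefficients *)

Section Convolution.
Context {R : realType}.
Implicit Types (f g v : int -> R) (t s k e : R) (x y z : int).

Definition zbounded f : Prop := exists C : R, forall y, `|f y| <= C.

Definition zvanishing f : Prop :=
  forall e, 0 < e -> exists N : nat, forall y, (N <= `|y|)%N -> `|f y| <= e.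

Definition conv f g z : R := zsum (fun y => f y * g (z - y)).

Lemma zsummable_conv f g z : zsummable f -> zbounded g ->
  zsummable (fun y => f y * g (z - y)).
Proof.
move=> sf [C gC]; apply: (zsummable_le _ (zsummableZ C sf)) => y.
rewrite !normrM mulrC ler_wpM2r //.
by apply: le_trans (gC _) _; exact: ler_norm.
Qed.

Lemma zvanishing_bounded f : zvanishing f -> zbounded f.
Proof.
move=> /(_ 1 ltr01) [N hN].
exists (1 + \sum_(0 <= i < N) (`|f (Posz i)| + `|f (- Posz i)|)) => y.
have S0 n : 0 <= \sum_(0 <= i < n) (`|f (Posz i)| + `|f (- Posz i)|).
  by apply: sumr_ge0 => i _; rewrite addr_ge0.
case: (leqP N `|y|) => [/hN h|yN]; first by apply: le_trans h _; rewrite lerDl.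
rewrite (@big_cat_nat _ _ _ `|y|.+1) //= big_nat_recr //=.
have h1 := S0 `|y|%N.
have h2 : 0 <= \sum_(`|y|.+1 <= i < N) (`|f (Posz i)| + `|f (- Posz i)|).
  by apply: sumr_ge0 => i _; rewrite addr_ge0.
have h3 : `|f y| <= `|f (Posz `|y|%N)| + `|f (- Posz `|y|%N)|.
  case: y {yN h1 h2} => n; first by rewrite absz_nat lerDl.
  by rewrite NegzE abszN absz_nat lerDr.
lra.
Qed.

Lemma zvanishing_cvg v : zvanishing v ->
  v (Posz n) @[n --> \oo] --> 0 /\ v (Negz n) @[n --> \oo] --> 0.
Proof.
move=> hv; split; apply/cvgrPdist_le => e e0; have [N hN] := hv e e0;
  exists N => // n /= Nn; rewrite sub0r normrN; apply: hN => //.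
by rewrite NegzE abszN absz_nat (leq_trans Nn).
Qed.

Lemma zvanishing_mul_bounded f g z : zbounded f -> zvanishing g ->
  zvanishing (fun y => f y * g (z - y)).
Proof.
move=> [C fC] hg e e0.
have C0 : 0 <= C by apply: le_trans (fC 0); exact: normr_ge0.
have C1 : 0 < C + 1 by rewrite ltr_wpDl.
have [N hN] := hg (e / (C + 1)) (divr_gt0 e0 C1).
exists (N + `|z|)%N => y hy; rewrite normrM.
apply: (@le_trans _ _ ((C + 1) * (e / (C + 1)))).
  apply: ler_pM => //; first by apply: le_trans (fC _) _; rewrite lerDl.
  by apply: hN; lia.
by rewrite mulrC divfK // gt_eqF.
Qed.

(** On symbols: if [f] and [g] satisfy the first order equations of exponents [t]
    and [s], their product satisfies the one of exponent [t + s]. On sequences the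
    Leibniz rule becomes the telescoping of [(y - t) f y g (z - y)] in [y]. *)
Lemma conv_rec f g t s :
  (forall z, (z%:~R + 1 + t) * f (z + 1) = (z%:~R - t) * f z) ->
  (forall z, (z%:~R + 1 + s) * g (z + 1) = (z%:~R - s) * g z) ->
  zsummable f -> zbounded (fun y => y%:~R * f y) -> zvanishing g ->
  forall z, (z%:~R + 1 + (t + s)) * conv f g (z + 1) =
            (z%:~R - (t + s)) * conv f g z.
Proof.
move=> hf hg sf [C fC] vg z.
have bg := zvanishing_bounded vg.
have s1 := zsummable_conv (z + 1) sf bg.
have s0 := zsummable_conv z sf bg.
pose v y := (y%:~R - t) * f y * g (z - y).
have e y : v y - v (y - 1) = (z%:~R - (t + s)) * (f y * g (z - y)) -
    (z%:~R + 1 + (t + s)) * (f y * g (z + 1 - y)).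
  have := hf (y - 1); have := hg (z - y).
  rewrite /v subrK (_ : z - (y - 1) = z + 1 - y); last by ring.
  rewrite (_ : z - y + 1 = z + 1 - y); last by ring.
  rewrite !rmorphB /= mulr1z => h1 h2.
  have h3 : (y%:~R + t) * f y = (y%:~R - 1 - t) * f (y - 1).
    by rewrite -h2; congr (_ * _); ring.
  by rewrite -h3 mulrBl; move: (congr1 ( *%R (f y)) h1) => h4; nra.
have sv : zsummable (fun y => v y - v (y - 1)).
  rewrite (_ : (fun y => _) = (fun y => (z%:~R - (t + s)) * (f y * g (z - y)) -
    (z%:~R + 1 + (t + s)) * (f y * g (z + 1 - y)))); last exact/funext.
  by apply: zsummableB; apply: zsummableZ.
have [|vp vn] := @zvanishing_cvg v.
  apply: zvanishing_mul_bounded => //.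
  have [D fD] : zbounded f.
    exists (C + `|f 0|) => y; have [->|y0] := eqVneq y 0.
      by rewrite lerDr; apply: le_trans (fC 0); exact: normr_ge0.
    apply: (@le_trans _ _ C); last by rewrite lerDl.
    apply: le_trans (fC y); rewrite normrM ler_peMl //.
    by rewrite -intr_norm -[1]/(1%:~R) ler_int; lia.
  exists (C + `|t| * D) => y; rewrite mulrBl.
  apply: le_trans (ler_normB _ _) _; apply: lerD => //.
  by rewrite normrM ler_wpM2l.
have := zsum_telescope sv vp vn; under eq_fun do rewrite e.
rewrite zsumB ?zsumZ //; try exact: zsummableZ.
by move=> /eqP; rewrite subr_eq0 => /eqP.
Qed.

Lemma zbounded_shift f x : zbounded f -> zbounded (fun y => f (y + x)).
Proof. by move=> [C h]; exists C. Qed.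

Lemma zboundedD f g : zbounded f -> zbounded g -> zbounded (fun y => f y + g y).
Proof.
move=> [C h] [D h']; exists (C + D) => y.
by apply: le_trans (ler_normD _ _) _; exact: lerD.
Qed.

Lemma zboundedZ k f : zbounded f -> zbounded (fun y => k * f y).
Proof. by move=> [C h]; exists (`|k| * C) => y; rewrite normrM ler_wpM2l. Qed.

(** What [conv_rec] asks of its first factor; the class is stable under the second
    difference of [coef_shift]. *)
Definition fast f := zsummable f /\ zbounded (fun y => y%:~R * f y).

Lemma fast_bounded f : fast f -> zbounded f.
Proof.
move=> [_ [C fC]]; exists (C + `|f 0|) => y; have [->|y0] := eqVneq y 0.
  by rewrite lerDr; apply: le_trans (fC 0); exact: normr_ge0.
apply: (@le_trans _ _ C); last by rewrite lerDl.
apply: le_trans (fC y); rewrite normrM ler_peMl //.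
by rewrite -intr_norm -[1]/(1%:~R) ler_int; lia.
Qed.

Lemma zbounded_coef_shift t : - (1 / 2) < t -> zbounded (coef t) ->
  zbounded (coef (t + 1)).
Proof.
move=> ht h; rewrite (funext (fun z => coef_shift z ht)).
rewrite (_ : (fun z => _) = (fun z => 2 * coef t z + (-1 * coef t (z + 1) + -1 * coef t (z + -1)))).
  apply: zboundedD; first exact: zboundedZ.
  apply: zboundedD; apply: zboundedZ; first exact: (zbounded_shift 1 h).
  exact: (zbounded_shift (-1) h).
by apply/funext => z; ring.
Qed.

Lemma fast_coef_shift t : - (1 / 2) < t -> fast (coef t) -> fast (coef (t + 1)).
Proof.
move=> ht ft; have bt := fast_bounded ft; have [st yt] := ft.
rewrite (funext (fun z => coef_shift z ht)); split.
  apply: zsummableB; last exact: (zsummable_reindex (bij_addz (-1)) st).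
  apply: zsummableB; last exact: (zsummable_reindex (bij_addz 1) st).
  exact: zsummableZ.
rewrite (_ : (fun z => _) = (fun z : int => 2 * (z%:~R * coef t z) +
  (-1 * ((z + 1)%:~R * coef t (z + 1)) + (1 * coef t (z + 1) +
  (-1 * ((z + -1)%:~R * coef t (z + -1)) + -1 * coef t (z + -1)))))).
  apply: zboundedD; first exact: zboundedZ.
  apply: zboundedD; first exact: (zboundedZ (-1) (zbounded_shift 1 yt)).
  apply: zboundedD; first exact: (zboundedZ 1 (zbounded_shift 1 bt)).
  apply: zboundedD; first exact: (zboundedZ (-1) (zbounded_shift (-1) yt)).
  exact: (zboundedZ (-1) (zbounded_shift (-1) bt)).
by apply/funext => z; rewrite !rmorphD /= mulrN1z mulr1z; ring.
Qed.

(** The product of the symbols of exponents [t] and [s] is the one of exponent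
    [t + s]; the recurrence determines it only up to a factor, named [k]. *)
Definition conv_coef_law t s k : Prop :=
  forall z, conv (coef t) (coef s) z = k * coef (t + s) z.

(** A second difference in one factor is a second difference of the convolution. *)
Lemma conv_law_shiftl t s k : - (1 / 2) < t -> - (1 / 2) < t + s ->
  fast (coef t) -> zbounded (coef s) ->
  conv_coef_law t s k -> conv_coef_law (t + 1) s k.
Proof.
move=> ht hts [st _] bs law z.
have sc y := zsummable_conv y st bs.
have e : conv (coef (t + 1)) (coef s) z = 2 * conv (coef t) (coef s) z -
    conv (coef t) (coef s) (z + 1) - conv (coef t) (coef s) (z - 1).
  pose F x y := coef t y * coef s (x - y).
  have -> : conv (coef t) (coef s) (z + 1) = zsum (fun y => F (z + 1) (y + 1)).
    by rewrite (zsum_reindex _ (bij_addz 1)).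
  have -> : conv (coef t) (coef s) (z - 1) = zsum (fun y => F (z - 1) (y + -1)).
    by rewrite (zsum_reindex _ (bij_addz (-1))).
  have s1 := zsummable_reindex (bij_addz 1) (sc (z + 1)).
  have s2 := zsummable_reindex (bij_addz (-1)) (sc (z - 1)).
  rewrite /conv -zsumZ // -!zsumB //; last 2 first.
  - by apply: zsummableB => //; exact: zsummableZ.
  - exact: zsummableZ.
  congr zsum; apply/funext => y; rewrite /F coef_shift //.
  rewrite (_ : z + 1 - (y + 1) = z - y); last by ring.
  rewrite (_ : z - 1 - (y + -1) = z - y); last by ring.
  by ring.
by rewrite e !law (addrAC t 1 s) (coef_shift z hts); ring.
Qed.

Lemma conv_law_shiftr t s k : - (1 / 2) < s -> - (1 / 2) < t + s ->
  fast (coef t) -> zbounded (coef s) ->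
  conv_coef_law t s k -> conv_coef_law t (s + 1) k.
Proof.
move=> ht hts [st _] bs law z.
have sc y := zsummable_conv y st bs.
have e : conv (coef t) (coef (s + 1)) z = 2 * conv (coef t) (coef s) z -
    conv (coef t) (coef s) (z + 1) - conv (coef t) (coef s) (z - 1).
  rewrite /conv -zsumZ // -!zsumB //; last 2 first.
  - by apply: zsummableB => //; exact: zsummableZ.
  - exact: zsummableZ.
  congr zsum; apply/funext => y; rewrite coef_shift //.
  rewrite (addrAC z 1) (addrAC z (-1)).
  by ring.
by rewrite e !law (addrA t s 1) (coef_shift z hts); ring.
Qed.

Lemma conv_law_add_nat t s k n : - (1 / 2) < t -> - (1 / 2) < s ->
  - (1 / 2) < t + s -> fast (coef t) -> zbounded (coef s) ->
  conv_coef_law t s k ->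
  [/\ fast (coef (n%:R + t)), zbounded (coef (n%:R + s)) &
      conv_coef_law (n%:R + t) (n%:R + s) k].
Proof.
move=> ht hs hts ft bs law; elim: n => [|n [IHf IHb IHl]]; first by rewrite !add0r.
rewrite -natr1 !(addrAC _ 1); have := ler0n R n => n0.
have h1 : - (1 / 2) < n%:R + t by lra.
have h2 : - (1 / 2) < n%:R + s by lra.
have f1 := fast_coef_shift h1 IHf; have b1 := zbounded_coef_shift h2 IHb.
split => //; apply: conv_law_shiftl => //; first by lra.
by apply: conv_law_shiftr => //; lra.
Qed.

Lemma fast_coef_1 : fast (coef 1).
Proof.
have c0 y : (2 <= `|y|)%N -> coef (1 : R) y = 0.
  rewrite /coef /coef_ratio; case: `|y|%N => [//|[//|n]] _.
  by rewrite big_ord_recl big_ord_recl /= subrr mul0r mul0r !mulr0.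
split.
  apply: (@zsummable_bounded _ _ (fun y => `|coef 1 y|)
    (\sum_(0 <= i < 2) (`|coef 1 (Posz i)| + `|coef 1 (Negz i)|))) => //.
  move=> n; rewrite /zpartial; case: (leqP n 2) => hn.
    rewrite [leRHS](@big_cat_nat _ _ _ n) //= lerDl.
    by apply: sumr_ge0 => i _; rewrite addr_ge0.
  rewrite [leLHS](@big_cat_nat _ _ _ 2) ?(ltnW hn) //= gerDl.
  rewrite big_nat_cond big1 // => i /andP[/andP[i2 _] _].
  by rewrite !c0 ?normr0 ?addr0 // NegzE abszN absz_nat; lia.
apply: zvanishing_bounded => e e0; exists 2%N => y /c0 ->.
by rewrite mulr0 normr0 ltW.
Qed.

Lemma zbounded_coef_0 : zbounded (coef 0).
Proof. by exists 1 => y; rewrite coef_0; case: eqP; rewrite ?normr1 ?normr0. Qed.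

Lemma zsum_single f z : (forall y, y != z -> f y = 0) -> zsum f = f z.
Proof.
move=> fz; rewrite -(zsum_sub z); set g := fun y => f (z - y).
have g0 y : y != 0 -> g y = 0.
  by move=> y0; apply: fz; rewrite -subr_eq0 addrAC subrr sub0r oppr_eq0.
have gp (h : int -> R) n : (forall y, y != 0 -> h y = 0) -> zpartial h n.+1 = h 0.
  move=> h0; rewrite /zpartial big_nat_recl // big1 ?addr0.
    by rewrite (h0 (Negz 0)) // addr0.
  by move=> i _; rewrite !h0 ?addr0.
have sg : zsummable g.
  apply: (@zsummable_bounded _ _ (fun y => `|g y|) `|g 0|) => // -[|n].
    by rewrite /zpartial big_nil.
  by rewrite (gp (fun y => `|g y|)) // => y /g0 ->; rewrite normr0.
apply: zsum_unique => //; rewrite -(cvg_shiftn 1) /=.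
rewrite (_ : (fun n => _) = (fun=> f z)); first exact: cvg_cst.
by apply/funext => n; rewrite addn1 gp // /g subr0.
Qed.

(** The only instance which is computed: [coef 0] is the unit mass at the origin. *)
Lemma conv_law_1_0 : conv_coef_law 1 0 1.
Proof.
move=> z; rewrite mul1r addr0 /conv (@zsum_single _ z).
  by rewrite subrr coef_0 eqxx mulr1.
by move=> y yz; rewrite coef_0 subr_eq0 eq_sym (negPf yz) mulr0.
Qed.

End Convolution.

(** * Decaying sequences *)

Section Decay.
Context {R : realType}.
Implicit Types (f g : int -> R) (s t : R) (z x : int).

(** The shift of the exponent by [1] makes [0 < s] the condition for summability. *)
Definition decays s f : Prop :=
  exists2 C : R, 0 <= C & forall z, `|f z| <= C * wt z `^ (- s - 1).

Lemma decays_tail s A f : 0 < s -> 0 <= A ->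
  (forall z, z != 0 -> `|f z| <= A * `|z|%N%:R `^ (- s - 1)) -> decays s f.
Proof.
move=> s0 A0 h; exists (A * 2 `^ (s + 1) + `|f 0|) => [|z].
  by rewrite addr_ge0 // mulr_ge0 // powR_ge0.
have [->|z0] := eqVneq z 0.
  by rewrite wt_nat powR1 mulr1 lerDr mulr_ge0 // powR_ge0.
apply: le_trans (h z z0) _.
apply: (@le_trans _ _ (A * 2 `^ (s + 1) * wt z `^ (- s - 1))); last first.
  by rewrite ler_wpM2r ?powR_ge0 // lerDl.
rewrite -mulrA ler_wpM2l // -!opprD; apply: powRN_abs_wt => //.
by rewrite addr_ge0 // ltW.
Qed.

Lemma decays_summable s f : 0 < s -> decays s f -> zsummable f.
Proof.
move=> s0 [C C0 h]; apply: (zsummable_le _ (zsummableZ C (zsummable_wt s0))) => z.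
by rewrite [leRHS]ger0_norm // mulr_ge0 // powR_ge0.
Qed.

Lemma decays_bounded s f : 0 < s -> decays s f -> zbounded f.
Proof.
move=> s0 [C C0 h]; exists C => z; apply: le_trans (h z) _.
by rewrite ler_piMr // -[leRHS](powRr0 (wt z)) ler_powR ?wt_ge1 //; lra.
Qed.

Let wt_half s x y : 0 < s -> wt x <= 2 * wt y :> R ->
  wt y `^ (- s - 1) <= 2 `^ (s + 1) * wt x `^ (- s - 1).
Proof.
move=> s0 xy; rewrite -!opprD !powRN ler_pdivlMr ?powR_gt0 ?wt_gt0 // mulrC.
rewrite ler_pdivrMr ?powR_gt0 ?wt_gt0 // -powRM ?(ltW (wt_gt0 _)) //.
by apply: ge0_ler_powR; rewrite ?nnegrE ?mulr_ge0 ?(ltW (wt_gt0 _)) //; lra.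
Qed.

(** In [x = y + (x - y)] one of the two terms has at least half the size of [x];
    the factor at this term is bounded by its decay there, and the other one is
    summed. *)
Lemma conv_decay s t f g : 0 < s -> 0 < t -> decays s f -> decays t g ->
  exists2 C : R, 0 <= C &
    forall x, `|conv f g x| <= C * (wt x `^ (- s - 1) + wt x `^ (- t - 1)).
Proof.
move=> s0 t0 df dg; have sf := decays_summable s0 df.
have bg := decays_bounded t0 dg; have sg := decays_summable t0 dg.
move: (df) (dg) => [A A0 hf] [B B0 hg].
have sfg x := zsummable_conv x sf bg.
pose F := zsum (fun y => `|f y|); pose G := zsum (fun y => `|g y|).
have F0 : 0 <= F by exact: zsum_ge0.
have G0 : 0 <= G by exact: zsum_ge0.
pose P : R := 2 `^ (s + 1) * A * G; pose Q : R := 2 `^ (t + 1) * B * F.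
have P0 : 0 <= P by rewrite /P !mulr_ge0 ?powR_ge0.
have Q0 : 0 <= Q by rewrite /Q !mulr_ge0 ?powR_ge0.
exists (P + Q) => [|x]; first exact: addr_ge0.
have W0 : 0 <= wt x `^ (- s - 1) by exact: powR_ge0.
have V0 : 0 <= wt x `^ (- t - 1) by exact: powR_ge0.
apply: le_trans (_ : P * wt x `^ (- s - 1) + Q * wt x `^ (- t - 1) <= _); last by nra.
apply: le_trans (normr_zsum (sfg x)) _.
pose p y := A * (2 `^ (s + 1) * wt x `^ (- s - 1)) * `|g (x - y)| +
  B * (2 `^ (t + 1) * wt x `^ (- t - 1)) * `|f y|.
have sg' : zsummable (fun y => `|g (x - y)|).
  exact: zsummable_sub (zsummable_abs sg).
have sf' := zsummable_abs sf.
have -> : P * wt x `^ (- s - 1) + Q * wt x `^ (- t - 1) = zsum p.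
  rewrite zsumD ?zsumZ //; [|exact: zsummableZ|exact: zsummableZ].
  by rewrite (zsum_sub x (fun y => `|g y|)) -/F -/G /P /Q; ring.
apply: ler_zsum => [||y].
- exact: zsummable_abs (sfg x).
- by apply: zsummableD; exact: zsummableZ.
rewrite normrM /p.
have g0 := normr_ge0 (g (x - y)); have f0 := normr_ge0 (f y).
have xyz : wt x <= wt y + wt (x - y) :> R.
  by rewrite !wt_nat -natrD ler_nat; clear; lia.
have [h|h] := lerP (wt (x - y)) (wt y : R).
  have xy : wt x <= 2 * wt y :> R by lra.
  apply: le_trans (_ : A * (2 `^ (s + 1) * wt x `^ (- s - 1)) * `|g (x - y)| <= _).
    rewrite ler_wpM2r //; apply: le_trans (hf y) _.
    by rewrite ler_wpM2l // wt_half.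
  by rewrite lerDl mulr_ge0 // mulr_ge0 // mulr_ge0 // powR_ge0.
have xy : wt x <= 2 * wt (x - y) :> R by lra.
rewrite mulrC.
apply: le_trans (_ : B * (2 `^ (t + 1) * wt x `^ (- t - 1)) * `|f y| <= _).
  rewrite ler_wpM2r //; apply: le_trans (hg _) _.
  by rewrite ler_wpM2l // wt_half.
by rewrite lerDr mulr_ge0 // mulr_ge0 // mulr_ge0 // powR_ge0.
Qed.

End Decay.

(** * Size of the kernels *)

Section KernelDecay.
Context {R : realType}.
Implicit Types (s a e : R) (z : int) (n : nat).

Lemma powRN_vanishing s e : 0 < s -> 0 < e ->
  exists N : nat, forall n, (N <= n)%N -> (0 < n)%N /\ n%:R `^ (- s) <= e.
Proof.
move=> s0 e0; exists (Num.bound (e^-1 `^ s^-1)).+1 => n hn.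
have n0 : (0 < n)%N by exact: leq_trans hn.
have n0R : 0 < n%:R :> R by rewrite ltr0n.
split => //; rewrite powRN -[e]invrK lef_pV2 ?posrE ?invr_gt0 ?powR_gt0 //.
have h : e^-1 `^ s^-1 <= n%:R.
  apply: le_trans (ltW (archi_boundP (powR_ge0 _ _))) _.
  by rewrite ler_nat (leq_trans _ hn).
have ei0 : 0 <= e^-1 by rewrite invr_ge0 ltW.
have -> : e^-1 = (e^-1 `^ s^-1) `^ s.
  by rewrite -powRrM mulVf ?gt_eqF // powRr1.
by apply: ge0_ler_powR; rewrite ?nnegrE ?powR_ge0 // ltW.
Qed.

Lemma ker_pos_bound s : 0 < s -> s < 2^-1 -> exists2 A : R, 0 <= A &
  forall z, z != 0 -> `|ker s z| <= A * `|z|%N%:R `^ (- (2 * s) - 1).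
Proof.
move=> s0 s1; exists (`|cA (- s)| * 3) => [|z z0]; first by rewrite mulr_ge0.
rewrite /ker s0 (negPf z0) /= -mulrA normrM -mulrA ler_wpM2l //.
have z1 : (0 < `|z|)%N by rewrite absz_gt0.
have z1R : 1 <= `|z|%N%:R :> R by rewrite ler1n.
rewrite ger0_norm; first exact: Gamma_kernel_le.
by rewrite divr_ge0 // ltW // Gamma_gt0 //; lra.
Qed.

Lemma coef_pos_bound s : 0 < s -> s < 2^-1 -> exists2 A : R, 0 <= A &
  forall z, z != 0 -> `|coef s z| <= A * `|z|%N%:R `^ (- (2 * s) - 1).
Proof.
move=> s0 s1; have [A A0 h] := ker_pos_bound s0 s1; exists A => // z z0.
by rewrite -normrN -ker_pos //; exact: h.
Qed.

Lemma coef_pos_decays s : 0 < s -> s < 2^-1 -> decays (2 * s) (coef s).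
Proof.
move=> s0 s1; have [A A0 hA] := coef_pos_bound s0 s1.
by apply: decays_tail A0 hA; rewrite mulr_gt0.
Qed.

(** A decay of order [2 * s + 1] is more than enough, since [2 * s > 0]. *)
Lemma fast_coef_pos s : 0 < s -> s < 2^-1 -> fast (coef s).
Proof.
move=> s0 s1; have s20 : 0 < 2 * s by rewrite mulr_gt0.
split; first exact: decays_summable s20 (coef_pos_decays s0 s1).
have [A A0 h] := coef_pos_bound s0 s1.
exists A => z; have [->|z0] := eqVneq z 0; first by rewrite mul0r normr0.
rewrite normrM; apply: le_trans (ler_wpM2l (normr_ge0 _) (h z z0)) _.
rewrite mulrCA -[leRHS]mulr1 ler_wpM2l //.
have z1 : 1 <= `|z|%N%:R :> R by rewrite ler1n absz_gt0.
have z1' : 0 < `|z|%N%:R :> R by exact: lt_le_trans z1.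
rewrite -intr_norm -abszE -pmulrn mulr_powRB1_gt0 //.
by rewrite -[leRHS](powRr0 `|z|%N%:R) ler_powR // oppr_le0 ltW.
Qed.

Lemma coef_neg_gt0 a z : 0 < a -> a < 2^-1 -> 0 < coef (- a) z.
Proof.
move=> a0 a1; rewrite /coef mulr_gt0 ?center_coef_gt0 //; first by lra.
apply: prodr_gt0 => i _; have := ler0n R i => i0.
by rewrite divr_gt0 //; lra.
Qed.

Lemma coef_neg_decreasing a x z : 0 < a -> a < 2^-1 -> (`|x| <= `|z|)%N ->
  coef (- a) z <= coef (- a) x.
Proof.
move=> a0 a1; rewrite /coef ler_pM2l ?center_coef_gt0 //; last by lra.
move: `|x|%N `|z|%N => m n mn.
rewrite -(subnKC mn); elim: (n - m)%N => [|k IH]; first by rewrite addn0.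
rewrite addnS coef_ratioS; apply: le_trans IH.
have pos j : 0 <= coef_ratio (- a) j.
  by apply: prodr_ge0 => i _; have := ler0n R i => i0; rewrite divr_ge0 //; lra.
rewrite ler_piMr // ler_pdivrMr ?mul1r; have := ler0n R (m + k) => i0; lra.
Qed.

Lemma ker_neg_gt0 a z : 0 < a -> a < 2^-1 -> 0 < ker (- a) z.
Proof. by move=> a0 a1; rewrite ker_neg //; exact: coef_neg_gt0. Qed.

Lemma ker_neg_decreasing a x z : 0 < a -> a < 2^-1 -> (`|x| <= `|z|)%N ->
  ker (- a) z <= ker (- a) x.
Proof. by move=> a0 a1 xz; rewrite !ker_neg //; exact: coef_neg_decreasing. Qed.

Lemma cA_gt0 a : 0 < a -> a < 2^-1 -> 0 < cA a :> R.
Proof.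
move=> a0 a1; have a2 : 0 < 1 / 2 - a by lra.
rewrite /cA divr_gt0 ?mulr_gt0 ?powR_gt0 ?Gamma_gt0 ?sqrt_pi_gt0 //.
by rewrite normr_gt0 gt_eqF // Gamma_gt0.
Qed.

(** The constant [cA a] is the limit of [ker (- a) z * |z| ^ (1 - 2 a)], and the error has
    the relative size [1 / |z|]. *)
Lemma ker_neg_asymp a z : 0 < a -> a < 2^-1 -> z != 0 ->
  `|ker (- a) z - cA a * `|z|%N%:R `^ (- (1 - 2 * a))| <=
  cA a * `|z|%N%:R `^ (- (1 - 2 * a)) / `|z|%N%:R.
Proof.
move=> a0 a1 z0; have zN : (0 < `|z|)%N by rewrite absz_gt0.
have a2 : a <= 1 by lra.
have := Gamma_ratio_asymp (ltW a0) a2 zN.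
rewrite (_ : 2 * a - 1 = - (1 - 2 * a)); last by ring.
rewrite /ker ltNge (ltW (_ : - a < 0)) ?oppr_lt0 //= opprK -[cA a * _ / _]mulrA.
rewrite -mulrBr normrM (ger0_norm (ltW (cA_gt0 a0 a1))) -[cA a * _ / _]mulrA.
by move=> g; rewrite ler_wpM2l // ltW // cA_gt0.
Qed.

Lemma ker_neg_le_tail a z : 0 < a -> a < 2^-1 -> z != 0 ->
  ker (- a) z <= 2 * cA a * `|z|%N%:R `^ (- (1 - 2 * a)).
Proof.
move=> a0 a1 z0; have c0 := cA_gt0 a0 a1.
have z1 : 1 <= `|z|%N%:R :> R by rewrite ler1n absz_gt0.
have := ler_normlW (ker_neg_asymp a0 a1 z0); rewrite lerBlDr => h.
apply: le_trans h _; rewrite -[2 * _ * _]mulrA [leRHS]mulr_natl [leRHS]mulr2n lerD2r.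
rewrite ler_pdivrMr ?(lt_le_trans _ z1) // ler_peMr // mulr_ge0 ?powR_ge0 //.
exact: ltW.
Qed.

Lemma ker_neg_decay a : 0 < a -> a < 2^-1 ->
  exists2 C : R, 0 <= C & forall z, ker (- a) z <= C * wt z `^ (- (1 - 2 * a)).
Proof.
move=> a0 a1; have b0 : 0 <= 1 - 2 * a by lra.
have c0 := cA_gt0 a0 a1.
have h0 := ker_neg_gt0 0 a0 a1.
exists (ker (- a) 0 + 2 * cA a * 2 `^ (1 - 2 * a)) => [|z].
  by rewrite addr_ge0 ?(ltW h0) // mulr_ge0 ?powR_ge0 // mulr_ge0 // ltW.
rewrite mulrDl; have [->|z0] := eqVneq z 0.
  have -> : wt 0 = 1 :> R by rewrite /wt addr0.
  rewrite powR1 !mulr1 lerDl.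
  by rewrite mulr_ge0 ?powR_ge0 // mulr_ge0 // ltW.
rewrite ler_wpDl ?mulr_ge0 ?powR_ge0 ?(ltW h0) //.
apply: le_trans (ker_neg_le_tail a0 a1 z0) _; rewrite -[leRHS]mulrA ler_wpM2l //.
  by rewrite mulr_ge0 // ltW.
exact: powRN_abs_wt.
Qed.

Lemma coef_neg_vanishing a : 0 < a -> a < 2^-1 -> zvanishing (coef (- a)).
Proof.
move=> a0 a1 e e0; have b0 : 0 < 1 - 2 * a by lra.
have c2 : 0 < 2 * cA a by rewrite mulr_gt0 ?cA_gt0.
have [N hN] := powRN_vanishing b0 (divr_gt0 e0 c2).
exists N => y /hN[y0 h]; rewrite -ker_neg // ger0_norm ?(ltW (ker_neg_gt0 _ _ _)) //.
have yn0 : y != 0 by rewrite -absz_gt0.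
apply: le_trans (ker_neg_le_tail a0 a1 yn0) _.
by rewrite mulrC -ler_pdivlMr.
Qed.

End KernelDecay.

(** * The constant of the convolution law *)

Section SemigroupConstant.
Context {R : realType}.
Implicit Types (t s k e : R) (z : int) (n N : nat).

Let q N t s (i : nat) : R :=
  ((i%:R - (N%:R + t)) / (i%:R + 1 + (N%:R + t))) *
  ((i%:R - (N%:R + s)) / (i%:R + 1 + (N%:R + s))).

(** Up to the central coefficients, the [n]-th term of the convolution of exponents
    [N + t] and [N + s] at the origin. Its factors increase in absolute value with
    [t] and [s] as long as [n <= N + 1], so that [P N t s] lies between [P N 0 0] and
    [P N 1 1 = P (N + 1) 0 0]; what happens beyond is negligible. *)
Let P N t s n : R := coef_ratio (N%:R + t) n * coef_ratio (N%:R + s) n.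

Let PE N t s n : P N t s n = \prod_(i < n) q N t s i.
Proof. by rewrite /P /coef_ratio -big_split. Qed.

Let PS N t s n : P N t s n.+1 = P N t s n * q N t s n.
Proof. by rewrite !PE big_ord_recr. Qed.

Let factor_le N t s i : 0 <= t -> t <= s -> s <= 1 -> (i <= N)%N ->
  0 <= (N%:R + t - i%:R) / (i%:R + 1 + (N%:R + t)) <=
       (N%:R + s - i%:R) / (i%:R + 1 + (N%:R + s)).
Proof.
move=> t0 ts s1 iN; have i0 := ler0n R i; have iNR : i%:R <= N%:R :> R by rewrite ler_nat.
have d1 : 0 < i%:R + 1 + (N%:R + t) by lra.
have d2 : 0 < i%:R + 1 + (N%:R + s) by lra.
apply/andP; split; first by rewrite divr_ge0 ?(ltW d1) //; lra.
by rewrite ler_pdivrMr // mulrAC ler_pdivlMr //; nra.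
Qed.

Let qN N t s i : q N t s i =
  ((N%:R + t - i%:R) / (i%:R + 1 + (N%:R + t))) *
  ((N%:R + s - i%:R) / (i%:R + 1 + (N%:R + s))).
Proof.
rewrite /q -[i%:R - (N%:R + t)]opprB -[i%:R - (N%:R + s)]opprB.
by rewrite ![- _ / _]mulNr mulrNN.
Qed.

Let q_ge0 N t s i : 0 <= t -> t <= 1 -> 0 <= s -> s <= 1 -> 0 <= q N t s i.
Proof.
move=> t0 t1 s0 s1; case: (leqP i N) => iN.
  rewrite qN; have /andP[h1 _] := factor_le t0 t1 (lexx _) iN.
  by have /andP[h2 _] := factor_le s0 s1 (lexx _) iN; rewrite mulr_ge0.
have iNR : N%:R + 1 <= i%:R :> R by rewrite natr1 ler_nat.
have N0 := ler0n R N.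
by rewrite /q mulr_ge0 // divr_ge0 //; lra.
Qed.

Let P_ge0 N t s n : 0 <= t -> t <= 1 -> 0 <= s -> s <= 1 -> 0 <= P N t s n.
Proof. by move=> *; rewrite PE; apply: prodr_ge0 => i _; exact: q_ge0. Qed.

Let P_lower N t s n : 0 <= t -> t <= 1 -> 0 <= s -> s <= 1 ->
  P N 0 0 n <= P N t s n.
Proof.
move=> t0 t1 s0 s1; case: (leqP n N) => nN.
  rewrite !PE; apply: ler_prod => i _.
  have iN : (i <= N)%N by apply: leq_trans nN; exact: ltnW.
  rewrite q_ge0 ?ler01 //= !qN.
  have /andP[a1 a2] := factor_le (lexx 0) t0 t1 iN.
  have /andP[b1 b2] := factor_le (lexx 0) s0 s1 iN.
  exact: ler_pM.
rewrite [leLHS]PE (bigD1 (Ordinal nN)) //= /q addr0 subrr !mul0r.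
exact: P_ge0.
Qed.

Let P_upper N t s n : 0 <= t -> t <= 1 -> 0 <= s -> s <= 1 -> (n <= N.+1)%N ->
  P N t s n <= P N.+1 0 0 n.
Proof.
move=> t0 t1 s0 s1 nN.
have -> : P N.+1 0 0 n = P N 1 1 n by rewrite /P !addr0 natr1.
rewrite !PE; apply: ler_prod => i _.
have iN : (i <= N)%N by rewrite -ltnS (leq_trans (ltn_ord i)).
rewrite q_ge0 //= !qN.
have /andP[a1 a2] := factor_le t0 t1 (lexx _) iN.
have /andP[b1 b2] := factor_le s0 s1 (lexx _) iN.
exact: ler_pM.
Qed.

Let factor_le1 N t i : 0 <= t -> t <= 1 -> (0 < N)%N -> (N < i)%N ->
  0 <= (i%:R - (N%:R + t)) / (i%:R + 1 + (N%:R + t)) <= i%:R / (i%:R + 2).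
Proof.
move=> t0 t1 N0 iN; have iNR : N%:R + 1 <= i%:R :> R by rewrite natr1 ler_nat.
have N1 : 1 <= N%:R :> R by rewrite ler1n.
have d1 : 0 < i%:R + 1 + (N%:R + t) by lra.
have d2 : 0 < (i%:R : R) + 2 by lra.
apply/andP; split; first by rewrite divr_ge0 ?(ltW d1) //; lra.
by rewrite ler_pdivrMr // mulrAC ler_pdivlMr //; nra.
Qed.

(** For integer exponents the product vanishes beyond [N]. In general a first factor of
    order [N ^ -2] appears there, and the later ones decrease at least like a telescoping
    sequence. *)
Let P_tail N t s j : 0 <= t -> t <= 1 -> 0 <= s -> s <= 1 -> (0 < N)%N ->
  P N t s (N.+1 + j) <= 2^-1 * ((N.+1 + j)%:R^-1 - (N.+1 + j).+1%:R^-1).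
Proof.
move=> t0 t1 s0 s1 N0; have N1 : 1 <= N%:R :> R by rewrite ler1n.
elim: j => [|j IH].
  rewrite addn0 PS.
  have PN : P N t s N <= 1.
    rewrite PE; apply: prodr_ile1 => i _.
    rewrite q_ge0 //= qN; have iN := ltnW (ltn_ord i).
    have /andP[a1 a2] := factor_le t0 t1 (lexx _) iN.
    have /andP[b1 b2] := factor_le s0 s1 (lexx _) iN.
    have c : (N%:R + 1 - i%:R) / (i%:R + 1 + (N%:R + 1)) <= 1 :> R.
      by have i0 := ler0n R i; rewrite ler_pdivrMr ?mul1r; lra.
    by rewrite mulr_ile1 // ?(le_trans a2) // (le_trans b2).
  have h1 : q N t s N <= ((2 * N%:R + 2)^-1) ^+ 2.
    rewrite qN expr2.
    have /andP[a1 a2] := factor_le t0 t1 (lexx _) (leqnn N).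
    have /andP[b1 b2] := factor_le s0 s1 (lexx _) (leqnn N).
    have c : (N%:R + 1 - N%:R) / (N%:R + 1 + (N%:R + 1)) = (2 * N%:R + 2)^-1 :> R.
      by rewrite (_ : N%:R + 1 - N%:R = 1) ?div1r; [congr (_^-1); ring|ring].
    rewrite c in a2; rewrite c in b2.
    by apply: ler_pM => //.
  apply: (@le_trans _ _ (1 * ((2 * N%:R + 2)^-1) ^+ 2)).
    by apply: ler_pM => //; [exact: P_ge0|exact: q_ge0].
  rewrite mul1r -[N.+2%:R]natr1 -[N.+1%:R]natr1.
  rewrite -subr_ge0.
  rewrite [X in 0 <= X](_ : _ = N%:R / (4 * (N%:R + 1) ^+ 2 * (N%:R + 2))); last first.
    by field; rewrite !gt_eqF //; lra.
  by rewrite divr_ge0 // mulr_ge0 ?mulr_ge0 ?exprn_ge0 //; lra.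
rewrite addnS PS.
set i := (N.+1 + j)%N in IH *.
have iN : (N < i)%N by rewrite /i; lia.
have iNR : N%:R + 1 <= i%:R :> R by rewrite natr1 ler_nat.
have h : q N t s i <= i%:R / (i%:R + 2).
  have /andP[a1 a2] := factor_le1 t0 t1 N0 iN.
  have /andP[b1 b2] := factor_le1 s0 s1 N0 iN.
  apply: (@le_trans _ _ (i%:R / (i%:R + 2) * 1)); last by rewrite mulr1.
  apply: ler_pM => //; apply: le_trans b2 _.
  by rewrite ler_pdivrMr ?mul1r; lra.
apply: (@le_trans _ _ (2^-1 * (i%:R^-1 - i.+1%:R^-1) * (i%:R / (i%:R + 2)))).
  by apply: ler_pM => //; [exact: P_ge0|exact: q_ge0].
rewrite -[i.+2%:R]natr1 -[i.+1%:R]natr1 le_eqVlt; apply/orP; left; apply/eqP.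
by field; rewrite !gt_eqF //; lra.
Qed.

Let S N t s : R := zsum (fun y : int => P N t s `|y|%N).

(** At the origin the convolution law expresses [k] through Gamma values and the
    sum [S N t s]; the powers of [4] and all but one factor [sqrt pi] cancel. *)
Let S_law N t s k : 0 <= N%:R + t -> 0 <= N%:R + s ->
  fast (coef (N%:R + t)) -> zbounded (coef (N%:R + s)) ->
  conv_coef_law (N%:R + t) (N%:R + s) k ->
  zsummable (fun y : int => P N t s `|y|%N) /\
  k * (Num.sqrt pi * gammaq (N%:R + t + (N%:R + s))) =
  gammaq (N%:R + t) * gammaq (N%:R + s) * S N t s.
Proof.
move=> t0 s0 [ft _] bs law.
have ht : - (1 / 2) < N%:R + t by lra.
have hs : - (1 / 2) < N%:R + s by lra.
have hts : - (1 / 2) < N%:R + t + (N%:R + s) by lra.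
have ct := center_coef_gt0 ht; have cs := center_coef_gt0 hs.
have e y : coef (N%:R + t) y * coef (N%:R + s) (0 - y) =
    center_coef (N%:R + t) * center_coef (N%:R + s) * P N t s `|y|%N.
  by rewrite sub0r /coef abszN /P; ring.
have sP : zsummable (fun y : int => P N t s `|y|%N).
  have := zsummableZ (center_coef (N%:R + t) * center_coef (N%:R + s))^-1 (zsummable_conv 0 ft bs).
  apply: zsummable_le => y; rewrite e mulKf // mulf_neq0 ?gt_eqF //.
split => //; have := law 0; rewrite coef_at0 /conv.
under eq_fun do rewrite e.
rewrite zsumZ // /center_coef [4 `^ (_ + (_ + _))]powRD; last by rewrite pnatr_eq0 implybT.
have p1 : 0 < 4 `^ (N%:R + t) :> R by rewrite powR_gt0.
have p2 : 0 < 4 `^ (N%:R + s) :> R by rewrite powR_gt0.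
have pp := @sqrt_pi_gt0 R.
rewrite -/(S N t s) => h.
apply: (@mulfI _ (4 `^ (N%:R + t) * 4 `^ (N%:R + s) / (Num.sqrt pi * Num.sqrt pi))).
  by rewrite gt_eqF // divr_gt0 ?mulr_gt0.
rewrite [LHS](_ : _ = k * (4 `^ (N%:R + t) * 4 `^ (N%:R + s) / Num.sqrt pi *
    gammaq (N%:R + t + (N%:R + s)))); last by field; rewrite gt_eqF.
by rewrite -h; field; rewrite gt_eqF.
Qed.

(** The bound of [P_tail], extended by [0]. *)
Let tail N (n : nat) : R :=
  if (n <= N.+1)%N then 0 else 2^-1 * (n%:R^-1 - n.+1%:R^-1).

Let tail_ge0 N n : 0 <= tail N n.
Proof.
rewrite /tail; case: leqP => // nN.
by rewrite mulr_ge0 // subr_ge0 lef_pV2 ?posrE ?ler_nat ?ltr0n //; lia.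
Qed.

Let tail_sum N n : \sum_(0 <= i < n) tail N i.+1 <= 2^-1 * N.+2%:R^-1.
Proof.
suff h : \sum_(0 <= i < n) tail N i.+1 <=
    2^-1 * (N.+2%:R^-1 - (maxn N.+1 n).+1%:R^-1).
  by apply: le_trans h _; rewrite ler_pM2l // gerBl invr_ge0.
elim: n => [|n IH]; first by rewrite big_nil maxn0 subrr mulr0.
rewrite big_nat_recr //= {2}/tail; case: leqP => nN; last first.
  rewrite addr0; apply: le_trans IH _.
  by rewrite (maxn_idPl (ltnW nN)) (@maxn_idPl N.+1 n.+1 nN).
apply: le_trans (lerD IH (lexx _)) _.
rewrite (maxn_idPr nN) (@maxn_idPr N.+1 n.+1 (ltnW nN)) -mulrDr ler_pM2l //.
by rewrite addrA subrK.
Qed.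

Let squeeze_low (g g1 w U V A B S0 S1 k : R) : 0 < g -> 0 < g1 -> 0 < w ->
  0 < U -> U <= V -> g1 <= A -> g1 <= B -> 0 <= S0 -> S0 <= S1 ->
  w * V = g * g * S0 -> k * (w * U) = A * B * S1 -> (g1 / g) ^+ 2 <= k.
Proof.
move=> g0 g10 w0 U0 UV gA gB S00 S01 e0 e.
rewrite -(@ler_pM2r _ (w * U)) ?mulr_gt0 // e.
apply: (@le_trans _ _ ((g1 / g) ^+ 2 * (w * V))).
  by rewrite ler_wpM2l ?sqr_ge0 // ler_pM2l.
rewrite e0 (_ : _ * _ = g1 * g1 * S0); last by field; rewrite gt_eqF.
apply: ler_pM => //; first by rewrite mulr_ge0 // ltW.
by apply: ler_pM => //; exact: ltW.
Qed.

Let squeeze_up (g g1 w U V A B S0 S1 k c : R) : 0 < g -> 0 < g1 -> 0 < w ->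
  0 <= k -> 0 < V -> V <= U -> 0 <= A -> A <= g -> 0 <= B -> B <= g -> 0 <= S1 ->
  S1 <= c * S0 ->
  w * V = g1 * g1 * S0 -> k * (w * U) = A * B * S1 -> k <= (g / g1) ^+ 2 * c.
Proof.
move=> g0 g10 w0 k0 V0 VU A0 Ag B0 Bg S10 S01 e0 e.
rewrite -(@ler_pM2r _ (w * V)) ?mulr_gt0 //.
apply: (@le_trans _ _ (k * (w * U))).
  by rewrite ler_wpM2l // ler_pM2l.
rewrite e e0 [leRHS](_ : _ = g * g * (c * S0)); last by field; rewrite gt_eqF.
apply: ler_pM => //; first by rewrite mulr_ge0.
exact: ler_pM.
Qed.

Let squeeze_one (k : R) : (forall N, (0 < N)%N ->
  (1 - 2^-1 / (N%:R + 1)) ^+ 2 <= k <=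
  (1 + 2^-1 / (N%:R + 2^-1)) ^+ 2 * (1 + N.+2%:R^-1)) -> k = 1.
Proof.
move=> bound.
apply/eqP; rewrite eq_le; apply/andP; split; apply/ler_addgt0Pr => e e0.
  pose N := (Num.bound (4 / e)).+1; have N0 : (0 < N)%N by [].
  have NR : 4 / e <= N%:R.
    apply: le_trans (ltW (archi_boundP _)) _; first by rewrite divr_ge0 // ltW.
    by rewrite ler_nat.
  have /andP[_ h] := bound N N0; apply: le_trans h _.
  have N1 : 1 <= N%:R :> R by rewrite ler1n.
  have N0R : 0 < N%:R :> R by rewrite ltr0n.
  pose v : R := N%:R^-1.
  have v1 : v <= 1 by rewrite /v invf_le1.
  have v0 : 0 < v by rewrite /v invr_gt0.
  have ve : 4 * v <= e by rewrite /v ler_pdivrMr // mulrC -ler_pdivrMr.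
  have a1 : 2^-1 / (N%:R + 2^-1) <= 2^-1 * v.
    by rewrite ler_pM2l // lef_pV2 ?posrE //; lra.
  have a0 : 0 <= 2^-1 / (N%:R + 2^-1) :> R by rewrite divr_ge0 //; lra.
  have a2 : N.+2%:R^-1 <= v by rewrite lef_pV2 ?posrE // ler_nat (leqW (leqnSn N)).
  have a3 : 0 <= N.+2%:R^-1 :> R by rewrite invr_ge0.
  move: a0 a1 a2 a3; move: (2^-1 / _) (N.+2%:R^-1) => a b a0 a1 a2 a3.
  apply: (@le_trans _ _ ((1 + 2^-1 * v) ^+ 2 * (1 + v))).
    apply: ler_pM; rewrite ?sqr_ge0 ?lerD2l //; first by lra.
    by apply: lerXn2r; rewrite ?nnegrE ?lerD2l //; lra.
  apply: (@le_trans _ _ (1 + 4 * v)); last by rewrite lerD2l.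
  by nra.
pose N := (Num.bound (e^-1)).+1; have N0 : (0 < N)%N by [].
have NR : e^-1 <= N%:R.
  apply: le_trans (ltW (archi_boundP _)) _; first by rewrite invr_ge0 ltW.
  by rewrite ler_nat.
have /andP[h _] := bound N N0; rewrite -lerBlDr; apply: le_trans h.
have N0R : 0 < N%:R :> R by rewrite ltr0n.
have v0 : 0 < (N%:R + 1)^-1 :> R by rewrite invr_gt0; lra.
have ve : (N%:R + 1)^-1 <= e.
  rewrite -[e]invrK lef_pV2 ?posrE ?invr_gt0 //; lra.
by move: v0 ve; move: (_^-1) => v v0 ve; nra.
Qed.

(** The constant for [(t, s)] is the one for [(N + t, N + s)]. At the origin the law
    compares Gamma values and sums which, for these exponents, lie between those for
    the pairs [(N, N)] and [(N + 1, N + 1)], up to factors tending to [1]; for integer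
    pairs the constant is [1]. *)
Lemma conv_law_constant t s k : 0 < t -> t <= 1 -> 0 <= s -> s <= 1 ->
  fast (coef t) -> zbounded (coef s) -> conv_coef_law t s k -> k = 1.
Proof.
move=> t0 t1 s0 s1 ft bs law.
have N12 : - (1 / 2) < (1 : R) by lra.
have Z12 : - (1 / 2) < (0 : R) by lra.
have law11 : conv_coef_law (1 : R) 1 1.
  have := conv_law_shiftr Z12 _ fast_coef_1 zbounded_coef_0 conv_law_1_0.
  by rewrite addr0 add0r; apply.
have f1 := @fast_coef_1 R; have b1 := fast_bounded f1.
pose g N : R := gammaq N%:R.
have g0 N : 0 < g N by apply: gammaq_gt0; have := ler0n R N; lra.
have pp := @sqrt_pi_gt0 R.
have integer N : (0 < N)%N -> zsummable (fun y : int => P N 0 0 `|y|%N) /\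
    Num.sqrt pi * g (N + N)%N = g N * g N * S N 0 0.
  case: N => // N _; have NR := ler0n R N.
  have [f' b' l'] : [/\ fast (coef (N%:R + 1 : R)), zbounded (coef (N%:R + 1 : R)) &
      conv_coef_law (N%:R + 1 : R) (N%:R + 1) 1].
    by apply: conv_law_add_nat => //; lra.
  rewrite natr1 in f' b' l'.
  have [|||||sP e] := @S_law N.+1 0 0 1; rewrite ?addr0 //.
  by split => //; move: e; rewrite mul1r !addr0 /g natrD.
have bound N : (0 < N)%N ->
    (g N.+1 / g N) ^+ 2 <= k <= (g N / g N.+1) ^+ 2 * (1 + N.+2%:R^-1).
  move=> N0; have NR := ler0n R N.
  have [f' b' l'] : [/\ fast (coef (N%:R + t)), zbounded (coef (N%:R + s)) &
      conv_coef_law (N%:R + t) (N%:R + s) k].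
    by apply: conv_law_add_nat => //; lra.
  have [sP e] := S_law (addr_ge0 NR (ltW t0)) (addr_ge0 NR s0) f' b' l'.
  have [sN eN] := integer N N0.
  have [sN1 eN1] := integer N.+1 isT.
  have gt1 : gammaq (N%:R + t) <= g N by apply: gammaq_decreasing; lra.
  have gt2 : g N.+1 <= gammaq (N%:R + t).
    by rewrite /g -natr1; apply: gammaq_decreasing; lra.
  have gs1 : gammaq (N%:R + s) <= g N by apply: gammaq_decreasing; lra.
  have gs2 : g N.+1 <= gammaq (N%:R + s).
    by rewrite /g -natr1; apply: gammaq_decreasing; lra.
  have gu1 : gammaq (N%:R + t + (N%:R + s)) <= g (N + N)%N.
    by rewrite /g natrD; apply: gammaq_decreasing; lra.
  have gu2 : g (N.+1 + N.+1)%N <= gammaq (N%:R + t + (N%:R + s)).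
    by rewrite /g natrD -natr1; apply: gammaq_decreasing; lra.
  have u0 : 0 < gammaq (N%:R + t + (N%:R + s)) by exact: lt_le_trans gu2.
  move: e; set U := gammaq (N%:R + t + (N%:R + s)) in gu1 gu2 u0 *.
  set A := gammaq (N%:R + t) in gt1 gt2 *; set B := gammaq (N%:R + s) in gs1 gs2 * => e.
  have A0 : 0 < A by exact: lt_le_trans gt2.
  have B0 : 0 < B by exact: lt_le_trans gs2.
  have SP0 : S N 0 0 <= S N t s.
    by apply: ler_zsum => // y; apply: P_lower => //; exact: ltW.
  have S0 : 0 <= S N 0 0 by apply: zsum_ge0 => y; exact: P_ge0.
  have k_low := squeeze_low (g0 N) (g0 N.+1) pp u0 gu1 gt2 gs2 S0 SP0 eN e.
  rewrite k_low /=.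
  have k0 : 0 <= k by apply: le_trans k_low; exact: sqr_ge0.
  have tail_le n : zpartial (fun y : int => tail N `|y|%N) n <= N.+2%:R^-1.
    apply: le_trans (@zpartial_le_even _ _ (fun i => tail N i.+1) 0 n _ _ _ _ _) _ => //.
    by rewrite add0r -ler_pdivlMl //; exact: tail_sum.
  have stail : zsummable (fun y : int => tail N `|y|%N).
    by apply: zsummable_bounded tail_le => y; rewrite ger0_norm.
  have S1 : 1 <= S N.+1 0 0.
    apply: le_trans (zpartial_le_zsum 1 _ sN1); last by move=> y; exact: P_ge0.
    rewrite /zpartial big_nat1 /= {1}/P !coef_ratio0 mulr1 lerDl.
    exact: P_ge0.
  apply: (squeeze_up (g0 N) (g0 N.+1) pp k0 (g0 _) gu2 _ gt1 _ gs1 _ _ eN1 e) => //.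
  - exact: ltW.
  - exact: ltW.
  - by apply: zsum_ge0 => y; apply: P_ge0 => //; exact: ltW.
  apply: (@le_trans _ _ (S N.+1 0 0 + N.+2%:R^-1)); last first.
    by rewrite mulrDl mul1r lerD2l ler_peMr ?invr_ge0.
  apply: (@le_trans _ _ (S N.+1 0 0 + zsum (fun y : int => tail N `|y|%N))); last first.
    by rewrite lerD2l; exact: zsum_le.
  rewrite -zsumD //; apply: ler_zsum => //; first exact: zsummableD.
  move=> y; case: (leqP `|y|%N N.+1) => yN.
    by rewrite /tail yN addr0; apply: P_upper => //; exact: ltW.
  rewrite /tail leqNgt yN /= -[leLHS]add0r lerD ?P_ge0 //.
  by rewrite -(subnKC (ltnW yN)); apply: P_tail => //; exact: ltW.
(* consecutive values of [g] are asymptotically equal, so both bounds tend to [1] *)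
have gE N : (0 < N)%N -> g N.+1 / g N = 1 - 2^-1 / (N%:R + 1).
  move=> N0; have NR := ler0n R N.
  rewrite /g -natr1 gammaqS; last by lra.
  have := g0 N; rewrite /g; move: (gammaq N%:R) => G G0.
  by field; rewrite !gt_eqF //; lra.
have gE' N : (0 < N)%N -> g N / g N.+1 = 1 + 2^-1 / (N%:R + 2^-1).
  move=> N0; have NR := ler0n R N.
  rewrite /g -natr1 gammaqS; last by lra.
  have := g0 N; rewrite /g; move: (gammaq N%:R) => G G0.
  by field; rewrite !gt_eqF //; lra.
apply: squeeze_one => N N0; have := bound N N0; rewrite gE // gE' //.
Qed.

End SemigroupConstant.

(** * The fractional Laplacian on the integers *)

Section FractionalLaplacian.
Context {R : realType}.
Implicit Types (s a : R) (x y z : int) (u v : int -> R).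

(** The exponent [- a] is raised to [1 - a] before the constant is identified, since the
    squeezing needs two nonnegative exponents. *)
Lemma semigroup_law s a : 0 < s -> s < a -> a < 2^-1 ->
  conv_coef_law s (- a) 1.
Proof.
move=> s0 sa a1; have a0 : 0 < a by exact: lt_trans sa.
have s1 : s < 2^-1 by exact: lt_trans a1.
have hs : - (1 / 2) < s by lra.
have ha : - (1 / 2) < - a by lra.
have hsa : - (1 / 2) < s + - a by lra.
have fs := fast_coef_pos s0 s1; have va := coef_neg_vanishing a0 a1.
have ba := zvanishing_bounded va.
have r := conv_rec (fun z => coef_rec z hs) (fun z => coef_rec z ha) (proj1 fs) (proj2 fs) va.
have law := rec_unique hsa r.
have law1 := conv_law_shiftr ha hsa fs ba law.
have k1 : conv (coef s) (coef (- a)) 0 / center_coef (s + - a) = 1.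
  apply: (conv_law_constant s0 _ _ _ fs (zbounded_coef_shift ha ba) law1); lra.
by move=> z; rewrite law k1.
Qed.

(** The symbol vanishes at the frequency [0]. In terms of the coefficients, the
    recurrence writes [- s * (coef s y + coef s (y - 1))] as the difference
    [v y - v (y - 1)] for [v y = y * coef s y], which vanishes at infinity. *)
Lemma zsum_coef_pos s : 0 < s -> s < 2^-1 -> zsum (coef s) = 0.
Proof.
move=> s0 s1; have hs : - (1 / 2) < s by lra.
have [sf _] := fast_coef_pos s0 s1.
have sf1 := zsummable_reindex (bij_addz (-1)) sf.
pose v (y : int) : R := y%:~R * coef s y.
have e y : v y - v (y - 1) = - s * (coef s y + coef s (y - 1)).
  have := coef_rec (y - 1) hs; rewrite subrK /v rmorphB /= mulr1z => h.
  have -> : y%:~R * coef s y = (y%:~R - 1 + 1 + s) * coef s y - s * coef s y by ring.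
  by rewrite h; ring.
have vv : zvanishing v.
  move=> eps e0; have [A A0 hA] := coef_pos_bound s0 s1.
  have A1 : 0 < A + 1 by rewrite ltr_wpDl.
  have s20 : 0 < 2 * s by rewrite mulr_gt0.
  have [N hN] := powRN_vanishing s20 (divr_gt0 e0 A1).
  exists N => y /hN[y0 h]; have yn0 : y != 0 by rewrite -absz_gt0.
  rewrite /v normrM; apply: le_trans (ler_wpM2l (normr_ge0 _) (hA y yn0)) _.
  rewrite mulrCA -intr_norm -abszE -pmulrn mulr_powRB1_gt0 ?ltr0n //.
  apply: (@le_trans _ _ ((A + 1) * (eps / (A + 1)))).
    by apply: ler_pM => //; rewrite ?powR_ge0 ?lerDl.
  by rewrite mulrC divfK // gt_eqF.
have [vp vn] := zvanishing_cvg vv.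
have sv : zsummable (fun y => v y - v (y - 1)).
  by rewrite (funext e); apply: zsummableZ; exact: zsummableD.
have := zsum_telescope sv vp vn; rewrite (funext e) zsumZ; last exact: zsummableD.
rewrite zsumD // (zsum_reindex _ (bij_addz (-1))) => /eqP.
rewrite mulf_eq0 oppr_eq0 gt_eqF //= => /eqP h; lra.
Qed.

Lemma ker_pos_gt0 s z : 0 < s -> s < 2^-1 -> z != 0 -> 0 < ker s z.
Proof.
move=> s0 s1 z0; rewrite /ker s0 (negPf z0) /=.
have z1R : 1 <= `|z|%N%:R :> R by rewrite ler1n absz_gt0.
have cA0 : 0 < cA (- s).
  rewrite /cA divr_gt0 ?mulr_gt0 ?powR_gt0 ?Gamma_gt0 ?sqrt_pi_gt0 //; first by lra.
  rewrite GammaN //; last by lra.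
  by rewrite normrN normr_gt0 gt_eqF // divr_gt0 // Gamma_gt0 //; lra.
by rewrite -mulrA mulr_gt0 // divr_gt0 // Gamma_gt0 //; lra.
Qed.

Lemma ker_pos_ge0 s z : 0 < s -> s < 2^-1 -> 0 <= ker s z.
Proof.
move=> s0 s1; have [->|z0] := eqVneq z 0; first by rewrite ker_pos0.
by rewrite ltW // ker_pos_gt0.
Qed.

Lemma zsummable_ker s : 0 < s -> s < 2^-1 -> zsummable (ker s).
Proof.
move=> s0 s1; have [sf _] := fast_coef_pos s0 s1.
apply: zsummable_le sf => z; have [->|z0] := eqVneq z 0.
  by rewrite ker_pos0 // normr0.
by rewrite ker_pos // normrN.
Qed.

Lemma ker_sym s x y : ker s (x - y) = ker s (y - x).
Proof. by rewrite -opprB /ker abszN oppr_eq0. Qed.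

Lemma zsummable_ker_bounded s x u : 0 < s -> s < 2^-1 -> zbounded u ->
  zsummable (fun y => u y * ker s (x - y)).
Proof.
move=> s0 s1 [C uC].
apply: (zsummable_le _ (zsummableZ C (zsummable_sub x (zsummable_ker s0 s1)))) => y.
rewrite !normrM ler_wpM2r //.
by apply: le_trans (uC y) _; exact: ler_norm.
Qed.

Lemma zsummable_fracLap s x u : 0 < s -> s < 2^-1 -> zbounded u ->
  zsummable (fun y => (u x - u y) * ker s (x - y)).
Proof.
move=> s0 s1 bu; apply: zsummable_ker_bounded => //.
case: bu => C uC; exists (C + C) => y.
by apply: le_trans (ler_normB _ _) _; exact: lerD.
Qed.

(** The coefficients [coef s] have total sum [0], and differ from [- ker s] only at the
    origin, where the difference [u x - u y] vanishes. *)
Lemma fracLap_conv s u x : 0 < s -> s < 2^-1 -> zbounded u ->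
  fracLap s u x = conv (coef s) u x.
Proof.
move=> s0 s1 bu; have [sf _] := fast_coef_pos s0 s1.
rewrite /fracLap -(zsum_sub x) /conv.
rewrite (_ : (fun y => _) = (fun y => coef s y * u (x - y) - u x * coef s y)).
  rewrite zsumB; last 2 first.
  - exact: zsummable_conv.
  - exact: zsummableZ.
  by rewrite (zsumZ (u x) sf) zsum_coef_pos // mulr0 subr0.
apply/funext => y; rewrite subKr; have [->|y0] := eqVneq y 0.
  by rewrite subr0 subrr mul0r mulrC subrr.
by rewrite ker_pos //; ring.
Qed.

Lemma ker_neg_bounded a : 0 < a -> a < 2^-1 -> zbounded (ker (- a)).
Proof.
move=> a0 a1; rewrite (funext (fun z => ker_neg z a0 a1)).
exact: zvanishing_bounded (coef_neg_vanishing a0 a1).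
Qed.

Lemma kpow_bounded a b : 0 < a -> a < 2^-1 -> 0 <= b -> zbounded (kpow a b).
Proof.
move=> a0 a1 b0; exists (ker (- a) 0 `^ b) => y; rewrite /kpow ger0_norm ?powR_ge0 //.
apply: ge0_ler_powR; rewrite ?nnegrE ?(ltW (ker_neg_gt0 _ _ _)) //.
exact: ker_neg_decreasing.
Qed.

Lemma fracLap_ker s a x : 0 < s -> s < a -> a < 2^-1 ->
  fracLap s (ker (- a)) x = ker (- (a - s)) x.
Proof.
move=> s0 sa a1; have a0 : 0 < a by exact: lt_trans sa.
rewrite fracLap_conv //; [|exact: lt_trans a1|exact: ker_neg_bounded].
rewrite (funext (fun z => ker_neg z a0 a1)) semigroup_law // mul1r.
by rewrite ker_neg ?opprB //; lra.
Qed.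

Lemma fracLap_lin s (k : R) u v x : 0 < s -> s < 2^-1 -> zbounded u -> zbounded v ->
  fracLap s (fun y => u y + k * v y) x = fracLap s u x + k * fracLap s v x.
Proof.
move=> s0 s1 bu bv; rewrite /fracLap -zsumZ; last exact: zsummable_fracLap.
rewrite -zsumD; last 2 first.
- exact: zsummable_fracLap.
- by apply: zsummableZ; exact: zsummable_fracLap.
by congr zsum; apply/funext => y; ring.
Qed.

Lemma fracLap_dom_bounded s u : 0 < s -> s < 2^-1 -> zbounded u -> fracLap_dom s u.
Proof.
move=> s0 s1 bu x; have := zsummable_ker_bounded x s0 s1 bu.
rewrite /zsummable; under eq_esum do rewrite normrM mulrC ger0_norm ?ker_pos_ge0 //.
by [].
Qed.

End FractionalLaplacian.

(** * Pointwise inequalities *)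

Section PointwiseInequalities.
Context {R : realType}.
Implicit Types (p a l u v : R).

Lemma a_cases p : 1 < p ->
  (a_ p = p - 1 /\ p <= 2) \/ (a_ p = (p - 1)^-1 /\ 2 <= p).
Proof.
move=> p1; have p10 : 0 < p - 1 by rewrite subr_gt0.
have e : conj_exp p - 1 = (p - 1)^-1.
  by rewrite /conj_exp; field; rewrite gt_eqF.
rewrite /a_ e; case: (lerP p 2) => p2; [left|right; split; last exact: ltW].
  split => //; apply/min_idPl.
  by rewrite -[leRHS]mul1r ler_pdivlMr // -expr2 expr_le1 ?(ltW p10) //; lra.
apply/min_idPr; rewrite -[leLHS]mul1r ler_pdivrMr // -expr2 expr_ge1 ?(ltW p10) //; lra.
Qed.

Lemma a_gt0 p : 1 < p -> 0 < a_ p.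
Proof.
by move=> p1; case: (a_cases p1) => -[-> _]; rewrite ?invr_gt0 subr_gt0.
Qed.

Lemma a_le1 p : 1 < p -> a_ p <= 1.
Proof.
move=> p1; case: (a_cases p1) => -[-> p2]; first by lra.
by rewrite invf_le1; lra.
Qed.

(** [(a_ p + 1)^-1] is the larger of [1 / p] and [1 - 1 / p], so that Young's inequality
    can be used with exponents which do not distinguish [p <= 2] from [p >= 2]. *)
Lemma young_exponents p : 1 < p ->
  (a_ p + 1)^-1 = p^-1 \/ (a_ p + 1)^-1 = 1 - p^-1.
Proof.
move=> p1; case: (a_cases p1) => -[-> _]; [left|right]; first by rewrite subrK.
by field; rewrite !gt_eqF //; lra.
Qed.

Lemma mul_spow p u : 1 < p -> u * spow u (p - 1) = `|u| `^ p.
Proof.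
move=> p1; rewrite /spow mulrCA -[u * _]mulrC -normrEsg mulrC mulr_powRB1 //.
by lra.
Qed.

Lemma mul_spow_le p u v : u * spow v (p - 1) <= `|u| * `|v| `^ (p - 1).
Proof.
apply: le_trans (ler_norm _) _; rewrite normrM ler_wpM2l // /spow normrM.
rewrite (ger0_norm (powR_ge0 _ _)) ler_piMr ?powR_ge0 //.
by rewrite normr_sg; case: (v != 0).
Qed.

Lemma spow_ge0 p v : 1 < p -> 0 <= v -> spow v (p - 1) = v `^ (p - 1).
Proof.
move=> p1; rewrite le_eqVlt => /predU1P[<-|v0].
  by rewrite /spow sgr0 mulr0 powR0 // subr_eq0 gt_eqF.
by rewrite /spow gtr0_sg // mulr1 gtr0_norm.
Qed.

Lemma cross_powR p u v : 1 < p ->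
  `|u| * `|v| `^ (p - 1) = (`|u| `^ p) `^ p^-1 * (`|v| `^ p) `^ (1 - p^-1).
Proof.
move=> p1; have p0 : p != 0 by rewrite gt_eqF //; lra.
by rewrite -!powRrM mulfV // powRr1 // mulrBr mulr1 mulfV.
Qed.

Definition sb_integrand p u v : R :=
  (u - v) * (spow u (p - 1) - spow v (p - 1)).

(** For [l = 1 / p], [S = |u| ^ p] and [T = |v| ^ p] these are the two mixed terms of the
    integrand, with absolute values. *)
Definition young_sum l (S T : R) : R := S `^ l * T `^ (1 - l) + T `^ l * S `^ (1 - l).

Lemma young_sumE p (S T : R) : 1 < p ->
  young_sum (a_ p + 1)^-1 S T =
  S `^ p^-1 * T `^ (1 - p^-1) + T `^ p^-1 * S `^ (1 - p^-1).
Proof.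
move=> p1; rewrite /young_sum; case: (young_exponents p1) => -> //.
by rewrite subKr addrC mulrC [X in _ + X]mulrC.
Qed.

Lemma sb_integrandE p u v : 1 < p -> sb_integrand p u v =
  `|u| `^ p + `|v| `^ p - (u * spow v (p - 1) + v * spow u (p - 1)).
Proof. by move=> p1; rewrite -!mul_spow // /sb_integrand; ring. Qed.

Lemma sb_integrand_ge p u v : 1 < p ->
  `|u| `^ p + `|v| `^ p - young_sum (a_ p + 1)^-1 (`|u| `^ p) (`|v| `^ p) <=
  sb_integrand p u v.
Proof.
move=> p1; rewrite sb_integrandE // young_sumE // lerD2l lerN2.
have key x y : x * spow y (p - 1) <= (`|x| `^ p) `^ p^-1 * (`|y| `^ p) `^ (1 - p^-1).
  by apply: le_trans (mul_spow_le p x y) _; rewrite (cross_powR x y p1).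
exact: lerD (key u v) (key v u).
Qed.

(** Only the signs are lost in [sb_integrand_ge]. *)
Lemma sb_integrand_nonneg p u v : 1 < p -> 0 <= u -> 0 <= v ->
  sb_integrand p u v =
  u `^ p + v `^ p - young_sum (a_ p + 1)^-1 (u `^ p) (v `^ p).
Proof.
move=> p1 u0 v0; rewrite sb_integrandE // young_sumE //.
have := @cross_powR p u v p1; have := @cross_powR p v u p1.
by rewrite !ger0_norm // !spow_ge0 // => -> ->.
Qed.

(** The part of the weight at [x] produced by the neighbour [y], where [A] and
    [B] are the values at [x] and [y] of the function to which the fractional
    Laplacian is applied. *)
Definition hardy_density a (A B : R) : R :=
  1 - (a + 1)^-1 * (B / A) `^ a - (1 - (a + 1)^-1) * (B / A).

Let lam_bounds a : 0 < a -> 0 <= (a + 1)^-1 <= 1.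
Proof.
by move=> a0; rewrite invr_ge0 invf_le1; lra.
Qed.

Let young1 a (A B S T : R) : 0 < a -> 0 < A -> 0 < B -> 0 <= S -> 0 <= T ->
  S `^ (a + 1)^-1 * T `^ (1 - (a + 1)^-1) <=
  (a + 1)^-1 * ((B / A) `^ a * S) + (1 - (a + 1)^-1) * (A / B * T).
Proof.
move=> a0 A0 B0 S0 T0; have /andP[l0 l1] := lam_bounds a0.
have r0 : 0 < B / A by rewrite divr_gt0.
have rS : 0 <= (B / A) `^ a * S by rewrite mulr_ge0 ?powR_ge0.
have rT : 0 <= A / B * T by rewrite mulr_ge0 // ltW // divr_gt0.
apply: le_trans (weighted_AMGM l0 l1 rS rT).
rewrite powRM ?powR_ge0 // -powRrM [(_ / _ * T) `^ _]powRM //; last by rewrite ltW // divr_gt0.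
rewrite mulrACA [X in _ <= X * _](_ : _ = 1) ?mul1r //.
have -> : A / B = (B / A) `^ (-1) by rewrite powR_inv1 ?invf_div // ltW.
rewrite -powRrM -powRD ?(gt_eqF r0) ?implybT //.
rewrite (_ : _ + _ = 0) ?powRr0 //.
by field; rewrite gt_eqF //; lra.
Qed.

(** Young's inequality for [(B / A) ^ a * S] and [A / B * T]: the geometric mean is
    unchanged because [a * l = 1 - l] for [l = (a + 1)^-1], and the coefficients of [S] and
    [T] are the two densities. *)
Lemma young_density a (A B S T : R) : 0 < a -> 0 < A -> 0 < B -> 0 <= S -> 0 <= T ->
  S * hardy_density a A B + T * hardy_density a B A <=
  S + T - young_sum (a + 1)^-1 S T.
Proof.
move=> a0 A0 B0 S0 T0.
have h1 := young1 a0 A0 B0 S0 T0; have h2 := young1 a0 B0 A0 T0 S0.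
rewrite /young_sum /hardy_density.
have -> : S * (1 - (a + 1)^-1 * (B / A) `^ a - (1 - (a + 1)^-1) * (B / A)) +
  T * (1 - (a + 1)^-1 * (A / B) `^ a - (1 - (a + 1)^-1) * (A / B)) =
  S + T - (((a + 1)^-1 * ((B / A) `^ a * S) + (1 - (a + 1)^-1) * (A / B * T)) +
  ((a + 1)^-1 * ((A / B) `^ a * T) + (1 - (a + 1)^-1) * (B / A * S))) by ring.
by rewrite lerD2l lerN2; exact: lerD.
Qed.

(** The AM-GM inequality with the exponent [1 / (2 l)], applied to the geometric mean
    of the statement and to [Y ^ 2], bounds [X * Y] from above by this mean, which is
    thereby bounded from below. *)
Lemma AMGM_defect_sqr l (X Y : R) : 2^-1 <= l -> l <= 1 -> 0 <= X -> 0 <= Y ->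
  l * X ^+ 2 + (1 - l) * Y ^+ 2 - (X ^+ 2) `^ l * (Y ^+ 2) `^ (1 - l) <=
  (X - Y) ^+ 2.
Proof.
move=> l2 l1 X0 Y0.
have l0 : 0 < l by lra.
set G := _ `^ l * _.
suff h : 2 * l * (X * Y) <= G + (2 * l - 1) * Y ^+ 2.
  have : 0 <= (1 - l) * (X - Y) ^+ 2 by rewrite mulr_ge0 ?sqr_ge0 //; lra.
  move: h; rewrite -subr_ge0 => h h'; rewrite -subr_ge0.
  rewrite (_ : (X - Y) ^+ 2 - _ = (G + (2 * l - 1) * Y ^+ 2 - 2 * l * (X * Y)) +
    (1 - l) * (X - Y) ^+ 2); last by ring.
  exact: addr_ge0.
have G0 : 0 <= G by rewrite mulr_ge0 ?powR_ge0.
have [->|Yn0] := eqVneq Y 0.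
  by rewrite !mulr0 expr0n /= mulr0 addr0.
have {Yn0}Y0 : 0 < Y by rewrite lt_neqAle eq_sym Yn0.
have [->|Xn0] := eqVneq X 0.
  by rewrite mul0r mulr0 addr_ge0 // mulr_ge0 ?sqr_ge0 //; lra.
have {Xn0}X0 : 0 < X by rewrite lt_neqAle eq_sym Xn0.
have m0 : 0 <= (2 * l)^-1 by rewrite invr_ge0; lra.
have m1 : (2 * l)^-1 <= 1 by rewrite invf_le1; lra.
have := weighted_AMGM m0 m1 G0 (sqr_ge0 Y).
have -> : G `^ (2 * l)^-1 * (Y ^+ 2) `^ (1 - (2 * l)^-1) = X * Y.
  rewrite /G powRM ?powR_ge0 // -!powRrM -mulrA -powRD; last first.
    by rewrite expf_neq0 ?implybT // gt_eqF.
  rewrite -!powR_mulrn ?(ltW X0) ?(ltW Y0) // -!powRrM.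
  rewrite (_ : 2 * (l * _) = 1); last by field; rewrite gt_eqF.
  rewrite (_ : 2 * (_ + _) = 1); last by field; rewrite gt_eqF.
  by rewrite !powRr1 ?ltW.
move=> h; have l20 : 0 <= 2 * l by lra.
have := ler_wpM2l l20 h.
rewrite (_ : 2 * l * ((2 * l)^-1 * G + _) = G + (2 * l - 1) * Y ^+ 2) //.
by field; rewrite gt_eqF.
Qed.

(** For these [S] and [T] the two arguments of Young's inequality are [A * B ^ a * X ^ 2]
    and [A * B ^ a * Y ^ 2], so that its defect is the one of [AMGM_defect_sqr]. *)
Lemma young_density_upper a (A B X Y S T : R) : 0 < a -> a <= 1 -> 0 < A -> 0 < B ->
  0 <= X -> 0 <= Y -> S = A `^ (a + 1) * X ^+ 2 -> T = B `^ (a + 1) * Y ^+ 2 ->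
  S + T - young_sum (a + 1)^-1 S T -
    (S * hardy_density a A B + T * hardy_density a B A) <=
  (A * B `^ a + A `^ a * B) * (X - Y) ^+ 2.
Proof.
move=> a0 a1 A0 B0 X0 Y0 SE TE.
have aux C D U V : 0 < C -> 0 < D -> 0 <= U -> 0 <= V ->
    (a + 1)^-1 * ((D / C) `^ a * (C `^ (a + 1) * U ^+ 2)) +
    (1 - (a + 1)^-1) * (C / D * (D `^ (a + 1) * V ^+ 2)) -
    (C `^ (a + 1) * U ^+ 2) `^ (a + 1)^-1 * (D `^ (a + 1) * V ^+ 2) `^ (1 - (a + 1)^-1)
    <= C * D `^ a * (U - V) ^+ 2.
  move=> C0 D0 U0 V0.
  have /andP[l0 l1] := lam_bounds a0.
  have l2 : 2^-1 <= (a + 1)^-1 by rewrite lef_pV2 ?posrE; lra.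
  have h := AMGM_defect_sqr l2 l1 U0 V0.
  have CD0 : 0 <= C * D `^ a by rewrite mulr_ge0 ?powR_ge0 // ltW.
  apply: le_trans (ler_wpM2l CD0 h); rewrite le_eqVlt; apply/orP; left; apply/eqP.
  rewrite !powRM ?powR_ge0 ?sqr_ge0 ?invr_ge0 ?(ltW C0) ?(ltW D0) // -!powRrM.
  rewrite mulfV ?gt_eqF //; last by lra.
  rewrite (_ : (a + 1) * (1 - _) = a); last by field; rewrite gt_eqF //; lra.
  rewrite powRr1 ?(ltW C0) //.
  rewrite -[C^-1]powR_inv1 ?(ltW C0) // -powRrM mulN1r.
  have eC : C `^ (- a) * C `^ (a + 1) = C.
    rewrite -powRD ?(gt_eqF C0) ?implybT // addrA addNr add0r powRr1 //.
    exact: ltW.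
  have eD : D `^ (a + 1) / D = D `^ a.
    rewrite -[D^-1]powR_inv1 ?(ltW D0) // -powRD ?(gt_eqF D0) ?implybT //.
    by rewrite addrK.
  have -> : D `^ a * C `^ (- a) * (C `^ (a + 1) * U ^+ 2) = C * D `^ a * U ^+ 2.
    by rewrite -[in RHS]eC; ring.
  have -> : C / D * (D `^ (a + 1) * V ^+ 2) = C * D `^ a * V ^+ 2.
    by rewrite -[in RHS]eD; ring.
  by ring.
have h1 := aux A B X Y A0 B0 X0 Y0; have h2 := aux B A Y X B0 A0 Y0 X0.
rewrite -SE -TE in h1 h2.
rewrite /young_sum /hardy_density.
have -> : (A * B `^ a + A `^ a * B) * (X - Y) ^+ 2 =
  A * B `^ a * (X - Y) ^+ 2 + B * A `^ a * (Y - X) ^+ 2 by ring.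
apply: le_trans (lerD h1 h2); rewrite le_eqVlt; apply/orP; left; apply/eqP.
ring.
Qed.

Lemma sb_integrand_ge0 p u v : 1 < p -> 0 <= sb_integrand p u v.
Proof.
move=> p1; apply: le_trans (sb_integrand_ge u v p1).
apply: le_trans (young_density (a_gt0 p1) ltr01 ltr01 (powR_ge0 `|u| p) (powR_ge0 `|v| p)).
rewrite /hardy_density divr1 powR1 !mulr1.
by rewrite (_ : 1 - _ - _ = 0) ?mulr0 ?addr0 //; ring.
Qed.

End PointwiseInequalities.

(** * The Hardy identity *)

Section Modulus.
Context {R : realType}.
Implicit Types (x y : int) (s c : R).

(** In terms of [z = |x - y| / wt x], the bound [z] is good for small [z], but against the
    kernel, of order [1 + 2 * s], only powers below [2 * s] can be summed far from [x]:
    there [z] is replaced by [z ^ s]. *)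
Definition modulus s x y : R :=
  Num.min ((absz (x - y))%:R / wt x) (((absz (x - y))%:R / wt x) `^ s).

Lemma modulus_ge0 s x y : 0 <= modulus s x y.
Proof. by rewrite le_min powR_ge0 divr_ge0 // ltW // wt_gt0. Qed.

Lemma modulus_ge s x y c : 0 <= s -> s <= 1 ->
  c <= 1 -> c <= (absz (x - y))%:R / wt x -> c <= modulus s x y.
Proof.
move=> s0 s1 c1; rewrite /modulus; set z := _ / _ => cz; rewrite le_min cz /=.
have z0 : 0 <= z by rewrite divr_ge0 // ltW // wt_gt0.
have [z1|z1] := lerP 1 z.
  by apply: le_trans c1 _; rewrite -(powRr0 z) ler_powR.
move: z0; rewrite le_eqVlt => /predU1P[z0|z0].
  by rewrite -z0 in cz; apply: le_trans cz _; rewrite powR_ge0.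
by apply: le_trans cz _; apply: ger1_powR => //; rewrite z0 ltW.
Qed.

(** The order of the weight at [x]. With [f] the positive part of the density against
    the kernel, this justifies the rearrangement of the form; with [f] a squared
    difference of cutoffs, it estimates the remainder. *)
Lemma kernel_modulus_bound s : 0 < s -> s < 2^-1 ->
  exists2 C : R, 0 <= C & forall (f : int -> R) x c,
  0 <= c -> (forall y, 0 <= f y <= c * modulus s x y * ker s (x - y)) ->
  zsummable f /\ zsum f <= c * C * wt x `^ (- (2 * s)).
Proof.
move=> s0 s12; have [A A0 hA] := ker_pos_bound s0 s12.
pose C := A * (2 * ((1 - 2 * s)^-1 + s^-1)).
have C0 : 0 <= C.
  by rewrite mulr_ge0 ?mulr_ge0 ?addr_ge0 ?invr_ge0 //; lra.
exists C => // f x c c0 hf.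
have wE : wt x = (`|x|%N.+1)%:R :> R by rewrite wt_nat.
have le n : zpartial (fun z => f (x - z)) n <= c * C * wt x `^ (- (2 * s)).
  rewrite wE /C mulrA; apply: zpartial_kernel_modulus => //.
  - by rewrite mulr_ge0.
  - by have /andP[_] := hf (x - 0); rewrite subKr ker_pos0 // mulr0.
  move=> z z0; have /andP[_ h2] := hf (x - z); apply: le_trans h2 _.
  have kz : ker s (x - (x - z)) <= A * `|z|%N%:R `^ (- (2 * s) - 1).
    by rewrite subKr; exact: le_trans (ler_norm _) (hA z z0).
  apply: le_trans (ler_wpM2l _ kz) _; first by rewrite mulr_ge0 ?modulus_ge0.
  rewrite /modulus subKr wE le_eqVlt; apply/orP; left; apply/eqP; ring.
have f0 y : 0 <= f y by have /andP[] := hf y.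
have sf : zsummable (fun z => f (x - z)).
  apply: zsummable_bounded le => y; rewrite ger0_norm //.
have sf' := zsummable_sub x sf.
have -> : f = (fun y => f (x - (x - y))) by apply/funext => y; rewrite subKr.
split=> //.
rewrite (zsum_sub x (fun z => f (x - z))).
exact: zsum_le sf le.
Qed.

End Modulus.

Section DoubleSums.
Context {R : realType}.

Local Notation dsum f :=
  (\esum_(x in [set: int]) \esum_(y in [set: int]) (f x y)%:E)%E.

Lemma dsumD (f g : int -> int -> R) : (forall x y, 0 <= f x y) ->
  (forall x y, 0 <= g x y) ->
  dsum (fun x y => f x y + g x y) = (dsum f + dsum g)%E.
Proof.
move=> f0 g0; rewrite -esumD; last 2 first.
- by move=> x _; apply: esum_ge0 => y _; rewrite lee_fin.
- by move=> x _; apply: esum_ge0 => y _; rewrite lee_fin.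
apply: eq_esum => x _; rewrite -esumD; last 2 first.
- by move=> y _; rewrite lee_fin.
- by move=> y _; rewrite lee_fin.
by apply: eq_esum => y _.
Qed.

Lemma dsum_swap (f : int -> int -> R) : (forall x y, 0 <= f x y) ->
  dsum (fun x y => f y x) = dsum f.
Proof.
move=> f0.
rewrite (@esum_esum _ _ _ _ (fun _ => setT) (fun x y => (f y x)%:E)); last first.
  by move=> x y _ _; rewrite lee_fin.
rewrite (@esum_esum _ _ _ _ (fun _ => setT) (fun x y => (f x y)%:E)); last first.
  by move=> x y _ _; rewrite lee_fin.
rewrite (@reindex_esum _ _ _ ([set: int] `*`` (fun _ => [set: int]))
  ([set: int] `*`` (fun _ => [set: int])) (fun t => (t.2, t.1))) //.
split=> //; first by move=> [? ?] [? ?] _ _ /= [-> ->].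
by move=> [x y] _; exists (y, x).
Qed.

Lemma dsum_weighted (c : int -> R) (f : int -> int -> R) :
  (forall x, 0 <= c x) -> (forall x y, 0 <= f x y) -> (forall x, zsummable (f x)) ->
  dsum (fun x y => c x * f x y) = (\esum_(x in [set: int]) (c x * zsum (f x))%:E)%E.
Proof.
move=> c0 f0 sf; apply: eq_esum => x _.
rewrite -(zsumZ (c x) (sf x)) zsum_ge0_esum //; last exact: zsummableZ.
by move=> y; rewrite mulr_ge0.
Qed.

End DoubleSums.

Section HardyIdentity.
Context {R : realType} (p sigma alpha : R).
Hypotheses (p1 : 1 < p) (s0 : 0 < sigma) (sa : sigma < alpha) (a12 : alpha < 2^-1).
Implicit Types (x y z : int) (u v : int -> R).

Let alpha0 : 0 < alpha. Proof. exact: lt_trans sa. Qed.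
Let s12 : sigma < 2^-1. Proof. exact: lt_trans a12. Qed.
Let a0 : 0 < a_ p. Proof. exact: a_gt0. Qed.
Let a1 : a_ p <= 1. Proof. exact: a_le1. Qed.

Local Ltac lra_param := move: (s0) (sa) (a12) (a0) (a1) => ? ? ? ? ?; lra.
Local Ltac nra_param := move: (s0) (sa) (a12) (a0) (a1) => ? ? ? ? ?; nra.

Local Notation h := (ker (- alpha)).
Local Notation k := (ker sigma).
Local Notation a := (a_ p).
Local Notation w := (hardy_w p sigma alpha).

Let base_gt0 x : 0 < h x. Proof. exact: ker_neg_gt0. Qed.

Let base_decreasing x y : (`|x| <= `|y|)%N -> h y <= h x.
Proof. exact: ker_neg_decreasing. Qed.

Let kpow_bdd : zbounded (kpow alpha a). Proof. by apply: kpow_bounded; rewrite ?ltW. Qed.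

Let base_bdd : zbounded h. Proof. exact: ker_neg_bounded. Qed.

Let dens x y : R := hardy_density a (h x) (h y).

Let densE x y : dens x y =
  (a + 1)^-1 / kpow alpha a x * (kpow alpha a x - kpow alpha a y) +
  (1 - (a + 1)^-1) / h x * (h x - h y).
Proof.
have hx := base_gt0 x; have hy := base_gt0 y.
have hxa : 0 < h x `^ a by rewrite powR_gt0.
rewrite /dens /hardy_density /kpow powRM ?(ltW hy) ?invr_ge0 ?(ltW hx) //.
rewrite -[(h x)^-1]powR_inv1 ?(ltW hx) // -powRrM mulN1r powRN.
rewrite powR_inv1 ?(ltW hx) //.
have aa : a + 1 != 0 by rewrite gt_eqF // addr_gt0.
by field; rewrite aa !gt_eqF.
Qed.

Let zsummable_dens x : zsummable (fun y => dens x y * k (x - y)).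
Proof.
have s1 := zsummableZ ((a + 1)^-1 / kpow alpha a x)
  (zsummable_fracLap x s0 s12 kpow_bdd).
have s2 := zsummableZ ((1 - (a + 1)^-1) / h x)
  (zsummable_fracLap x s0 s12 base_bdd).
have := zsummableD s1 s2; congr zsummable; apply/funext => y.
by rewrite densE; ring.
Qed.

Let hardy_w_density x : w x = zsum (fun y => dens x y * k (x - y)).
Proof.
have s1 := zsummable_fracLap x s0 s12 kpow_bdd.
have s2 := zsummable_fracLap x s0 s12 base_bdd.
have -> : (fun y => dens x y * k (x - y)) = (fun y =>
    (a + 1)^-1 / kpow alpha a x * ((kpow alpha a x - kpow alpha a y) * k (x - y)) +
    (1 - (a + 1)^-1) / h x * ((h x - h y) * k (x - y))).
  by apply/funext => y; rewrite densE; ring.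
rewrite zsumD; last 2 first.
- exact: zsummableZ.
- exact: zsummableZ.
rewrite (zsumZ _ s1) (zsumZ _ s2) /hardy_w -/(fracLap sigma (kpow alpha a) x) -/(fracLap sigma h x).
have aa : a + 1 != 0 by rewrite gt_eqF // addr_gt0.
have hx : h x != 0 by rewrite gt_eqF // base_gt0.
have hxa : kpow alpha a x != 0 by rewrite gt_eqF // powR_gt0 // base_gt0.
by field; rewrite aa hx hxa.
Qed.

Lemma fracLap_base_gt0 x : 0 < fracLap sigma h x.
Proof.
have d0 : 0 < alpha - sigma by rewrite subr_gt0.
have d1 : alpha - sigma < 2^-1 by lra_param.
by rewrite fracLap_ker // ker_neg //; exact: coef_neg_gt0.
Qed.

(** Concavity of [t ^ a]: the Laplacian of [h ^ a] at [x] is at least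
    [a * h x ^ (a - 1)] times the Laplacian of [h]. *)
Lemma fracLap_kpow_gt0 x : 0 < fracLap sigma (kpow alpha a) x.
Proof.
have l0 := fracLap_base_gt0 x.
have c0 : 0 < a * h x `^ (a - 1) by rewrite mulr_gt0 ?powR_gt0 ?base_gt0.
apply: lt_le_trans (mulr_gt0 c0 l0) _.
have sh := zsummable_fracLap x s0 s12 base_bdd.
rewrite /fracLap -zsumZ //; apply: ler_zsum.
- exact: zsummableZ.
- exact: (zsummable_fracLap x s0 s12 kpow_bdd).
move=> y; rewrite mulrA ler_wpM2r ?ker_pos_ge0 // /kpow.
have := powR_le_tangent (ltW a0) a1 (base_gt0 x) (ltW (base_gt0 y)).
move: (a * _) (h x `^ a) (h y `^ a) => c X Y hh; lra_param.
Qed.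

Lemma hardy_w_gt0 x : 0 < w x.
Proof.
have l0 := fracLap_base_gt0 x.
have a10 : 0 < a + 1 by rewrite addr_gt0.
have hx := base_gt0 x; have ha : 0 < kpow alpha a x by rewrite powR_gt0.
rewrite /hardy_w; apply: addr_gt0; apply: mulr_gt0.
- exact: divr_gt0.
- exact: (divr_gt0 (fracLap_kpow_gt0 x)).
- exact: divr_gt0.
- exact: (divr_gt0 l0).
Qed.

Let dens_le0 x y : (`|y| <= `|x|)%N -> dens x y <= 0.
Proof.
move=> yx; have r1 : 1 <= h y / h x.
  by rewrite ler_pdivlMr ?base_gt0 // mul1r base_decreasing.
have r1a : 1 <= (h y / h x) `^ a.
  by rewrite -(powRr0 (h y / h x)) ler_powR // ltW.
have l1 : (a + 1)^-1 <= 1 by rewrite invf_le1; lra_param.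
have l0 : 0 <= (a + 1)^-1 by rewrite invr_ge0; lra_param.
rewrite /dens /hardy_density.
move: l0 l1 r1 r1a; move: (_ / _) (_ `^ _) (_^-1) => r ra l; nra_param.
Qed.

Let dens_le1 x y : dens x y <= 1.
Proof.
have l1 : (a + 1)^-1 <= 1 by rewrite invf_le1; lra_param.
have l0 : 0 <= (a + 1)^-1 by rewrite invr_ge0; lra_param.
have r0 : 0 <= h y / h x by rewrite divr_ge0 // ltW // base_gt0.
have ra0 : 0 <= (h y / h x) `^ a by rewrite powR_ge0.
rewrite /dens /hardy_density.
move: l0 l1 r0 ra0; move: (_ / _) (_ `^ _) (_^-1) => r ra l; nra_param.
Qed.

(** One step of the product formula lowers [h] by at most the fraction [2 / (m + 1)]
    of [h m]. *)
Let base_ratio (m n : nat) : (m <= n)%N ->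
  1 - h (Posz n) / h (Posz m) <= 2 * (n%:R - m%:R) / m.+1%:R.
Proof.
move=> mn; have hm := base_gt0 (Posz m).
have hE i : h (Posz i) = center_coef (- alpha) * coef_ratio (- alpha) i.
  by rewrite ker_neg.
rewrite -(subnKC mn); elim: (n - m)%N => [|j IH].
  by rewrite addn0 divff ?gt_eqF // !subrr mulr0 mul0r.
set i := (m + j)%N in IH *; rewrite addnS -/i.
have step : h (Posz i) - h (Posz i.+1) <= h (Posz m) * (2 / m.+1%:R).
  have hi : h (Posz i) <= h (Posz m) by apply: base_decreasing; rewrite /i !absz_nat leq_addr.
  have i0 : m%:R <= i%:R :> R by rewrite ler_nat /i leq_addr.
  have m0 := ler0n R m.
  have d0 : 0 < i%:R + 1 - alpha by lra_param.
  have -> : h (Posz i) - h (Posz i.+1) = h (Posz i) * ((1 - 2 * alpha) / (i%:R + 1 - alpha)).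
    rewrite !hE coef_ratioS opprK; field.
    by rewrite gt_eqF.
  apply: ler_pM => //; first exact: ltW (base_gt0 _).
    by rewrite divr_ge0 //; lra_param.
  rewrite ler_pdivrMr // mulrAC ler_pdivlMr ?ltr0n // -natr1.
  have : 0 <= alpha * m%:R by rewrite mulr_ge0 // ltW.
  by lra_param.
have -> : 1 - h (Posz i.+1) / h (Posz m) =
    (1 - h (Posz i) / h (Posz m)) + (h (Posz i) - h (Posz i.+1)) / h (Posz m).
  by rewrite mulrBl; ring.
have -> : 2 * (i.+1%:R - m%:R) / m.+1%:R = 2 * (i%:R - m%:R) / m.+1%:R + 2 / m.+1%:R :> R.
  by rewrite -[i.+1%:R]natr1; ring.
by apply: lerD => //; rewrite ler_pdivrMr // mulrC.
Qed.

Let dens_le_ratio x y : (`|x| <= `|y|)%N -> dens x y <= 1 - h y / h x.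
Proof.
move=> xy; have hx := base_gt0 x; have hy := base_gt0 y.
have r0 : 0 < h y / h x by rewrite divr_gt0.
have r1 : h y / h x <= 1 by rewrite ler_pdivrMr // mul1r base_decreasing.
have ra : h y / h x <= (h y / h x) `^ a by rewrite ger1_powR // r0.
have l0 : 0 <= (a + 1)^-1 by rewrite invr_ge0; lra_param.
rewrite /dens /hardy_density.
move: l0 ra; move: (_ / _) (_ `^ _) (_^-1) => r rra l; nra_param.
Qed.

(** The density is at most [0] for [|y| <= |x|], and beyond [x] it is bounded by the
    relative decrease of [h]. *)
Let dens_le_modulus x y : dens x y <= 2 * modulus sigma x y.
Proof.
case: (leqP `|y|%N `|x|%N) => [/dens_le0 h0|xy].
  by apply: le_trans h0 _; rewrite mulr_ge0 // modulus_ge0.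
rewrite -ler_pdivrMl //; apply: modulus_ge; [by lra_param|by lra_param| |].
  by have := dens_le1 x y; lra_param.
rewrite ler_pdivrMl //; apply: le_trans (dens_le_ratio (ltnW xy)) _.
have e z : h z = h (Posz `|z|%N) by rewrite !ker_neg // /coef absz_nat.
rewrite e [h x]e; apply: le_trans (base_ratio (ltnW xy)) _.
rewrite -mulrA ler_pM2l // wt_nat ler_wpM2r ?invr_ge0 //.
by rewrite lerBlDr -natrD ler_nat; lia.
Qed.

(** The weight is the difference of the sums of [dp] and [dm]; they are kept apart so
    that the double sums of the identity have nonnegative terms. *)
Let dp x y : R := Num.max (dens x y) 0 * k (x - y).
Let dm x y : R := Num.max (- dens x y) 0 * k (x - y).

Let dp_ge0 x y : 0 <= dp x y.
Proof. by rewrite mulr_ge0 ?ker_pos_ge0 // le_max lexx orbT. Qed.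

Let dm_ge0 x y : 0 <= dm x y.
Proof. by rewrite mulr_ge0 ?ker_pos_ge0 // le_max lexx orbT. Qed.

Let dpm x y : dp x y - dm x y = dens x y * k (x - y).
Proof.
rewrite /dp /dm -mulrBl; congr (_ * _).
by case: (lerP (dens x y) 0); case: (lerP (- dens x y) 0); lra_param.
Qed.

Let zsummable_dp x : zsummable (dp x).
Proof.
apply: zsummable_le (zsummable_dens x) => y; rewrite /dp !normrM ler_wpM2r //.
rewrite ger0_norm; last by rewrite le_max lexx orbT.
by rewrite ge_max ler_norm normr_ge0.
Qed.

Let zsummable_dm x : zsummable (dm x).
Proof.
apply: zsummable_le (zsummable_dens x) => y; rewrite /dm !normrM ler_wpM2r //.
rewrite ger0_norm; last by rewrite le_max lexx orbT.
by rewrite ge_max normr_ge0 andbT -normrN ler_norm.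
Qed.

Let hardy_w_dp x : w x + zsum (dm x) = zsum (dp x).
Proof.
rewrite hardy_w_density -zsumD //; congr zsum; apply/funext => y.
by rewrite -dpm subrK.
Qed.

Local Notation dsum f :=
  (\esum_(x in [set: int]) \esum_(y in [set: int]) (f x y)%:E)%E.

Definition hardy_remainder u x y : R :=
  (sb_integrand p (u x) (u y) -
   (`|u x| `^ p * dens x y + `|u y| `^ p * dens y x)) * k (x - y).

Lemma hardy_remainder_ge0 u x y : 0 <= hardy_remainder u x y.
Proof.
rewrite mulr_ge0 ?ker_pos_ge0 // subr_ge0.
apply: le_trans (sb_integrand_ge (u x) (u y) p1).
exact: (young_density a0 (base_gt0 x) (base_gt0 y) (powR_ge0 _ _) (powR_ge0 _ _)).
Qed.

Let ereal_cancel (W f r : \bar R) (c : R) :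
  (f + (c%:E + c%:E) = (W + c%:E) + (W + c%:E) + r -> f = W + W + r)%E.
Proof.
by case: W f r => [W||] [f||] [r||] //=; rewrite -?EFinD => // -[e]; congr EFin; lra.
Qed.

Let ereal_half (W : \bar R) : ((2^-1)%:E * (W + W) = W)%E.
Proof.
case: W => [W||] /=; first by rewrite -EFinD -EFinM; congr EFin; field.
- by rewrite mulry gtr0_sg ?mul1e // invr_gt0.
- by rewrite mulrNy gtr0_sg ?mul1e // invr_gt0.
Qed.

(** The equality [pointwise] is summed over [x] and [y], all the terms being
    nonnegative. The total [dsum N] of the negative parts is finite and cancels: by
    positivity of the weight, each sum of [dm] is dominated by the one of [dp], hence by
    [(1 + |x|) ^ (- 2 sigma)]. *)
Lemma hardy_identity u : ellp p (fun x => wt x `^ (- (2 * sigma))) u ->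
  SBform p sigma u =
  (wsum p w u + (2^-1)%:E * dsum (hardy_remainder u))%E.
Proof.
move=> lu; pose U x := `|u x| `^ p.
have U0 x : 0 <= U x by exact: powR_ge0.
pose F x y := sb_integrand p (u x) (u y) * k (x - y).
have F0 x y : 0 <= F x y.
  by rewrite mulr_ge0 ?ker_pos_ge0 // sb_integrand_ge0.
pose N x y := U x * dm x y; pose P x y := U x * dp x y.
have N0 x y : 0 <= N x y by rewrite mulr_ge0.
have P0 x y : 0 <= P x y by rewrite mulr_ge0.
have R0 := hardy_remainder_ge0 u.
have pointwise x y : F x y + (N x y + N y x) =
    (P x y + P y x) + hardy_remainder u x y.
  have eP z t : P z t = N z t + U z * (dens z t * k (z - t)).
    by rewrite /P /N -mulrDr -dpm addrC subrK.
  by rewrite !eP /F /hardy_remainder -/(U x) -/(U y) (ker_sym sigma y x); ring.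
have zm0 x : 0 <= zsum (dm x) by exact: zsum_ge0.
have wE : wsum p w u = (\esum_(x in [set: int]) (U x * w x)%:E)%E.
  by apply: eq_esum => x _; rewrite mulrC.
have sN : zsummable (fun x => U x * zsum (dm x)).
  have [C C0 hC] := kernel_modulus_bound s0 s12.
  have su : zsummable (fun x => U x * wt x `^ (- (2 * sigma))).
    rewrite /zsummable; under eq_esum do rewrite ger0_norm ?mulr_ge0 ?powR_ge0 //.
    exact: lu.
  apply: zsummable_le (zsummableZ (2 * C) su) => x.
  rewrite ger0_norm ?mulr_ge0 // ger0_norm ?mulr_ge0 ?powR_ge0 //.
  rewrite mulrCA ler_wpM2l //; apply: le_trans (_ : zsum (dp x) <= _).
    by rewrite -hardy_w_dp lerDr ltW // hardy_w_gt0.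
  apply: (hC (dp x) x 2 _ _).2 => // y; rewrite dp_ge0 ler_wpM2r ?ker_pos_ge0 //.
  by rewrite ge_max dens_le_modulus mulr_ge0 // modulus_ge0.
have eN : dsum N = (zsum (fun x => U x * zsum (dm x)))%:E.
  rewrite dsum_weighted // zsum_ge0_esum // => x; exact: mulr_ge0.
have eP : dsum P = (wsum p w u + dsum N)%E.
  rewrite wE !dsum_weighted // -esumD; last 2 first.
  - by move=> x _; rewrite lee_fin mulr_ge0 // ltW // hardy_w_gt0.
  - by move=> x _; rewrite lee_fin mulr_ge0.
  by apply: eq_esum => x _; rewrite -EFinD -mulrDr hardy_w_dp.
have total : (dsum F + (dsum N + dsum N) =
    (dsum P + dsum P) + dsum (hardy_remainder u))%E.
  rewrite -{2}(dsum_swap N0) -{2}(dsum_swap P0) -!dsumD //.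
  - by apply: eq_esum => x _; apply: eq_esum => y _; rewrite pointwise.
  - by move=> x y; rewrite addr_ge0.
  - by move=> x y; rewrite addr_ge0.
rewrite eP eN in total.
have w0 : (0 <= wsum p w u)%E.
  apply: esum_ge0 => x _; rewrite lee_fin mulr_ge0 ?powR_ge0 //.
  exact: ltW (hardy_w_gt0 x).
have D0 : (0 <= dsum (hardy_remainder u))%E.
  by apply: esum_ge0 => x _; apply: esum_ge0 => y _; rewrite lee_fin.
rewrite /SBform -/(dsum F).
have -> : dsum F = (wsum p w u + wsum p w u + dsum (hardy_remainder u))%E.
  by apply: (ereal_cancel total).
by rewrite ge0_muleDr ?adde_ge0 // ereal_half.
Qed.

Lemma hardy_inequality u : ellp p (fun x => wt x `^ (- (2 * sigma))) u ->
  (wsum p w u <= SBform p sigma u)%E.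
Proof.
move=> lu; rewrite hardy_identity // leeDl // mule_ge0 ?lee_fin //.
apply: esum_ge0 => x _; apply: esum_ge0 => y _.
by rewrite lee_fin hardy_remainder_ge0.
Qed.

Lemma finite_support_ellp (mu : int -> R) u : (forall x, 0 <= mu x) ->
  finite_set [set x | u x != 0] -> ellp p mu u.
Proof.
move=> mu0 fu; rewrite /ellp.
have := esum_mkcond [set x | u x != 0] (fun x => (`|u x| `^ p * mu x)%:E).
rewrite (_ : (\esum_(i in setT) _ = \esum_(x in setT) (`|u x| `^ p * mu x)%:E)%E).
  move=> <-; rewrite esum_fset // => [|x _]; first by rewrite fsumEFin // ltry.
  by rewrite lee_fin mulr_ge0 ?powR_ge0.
apply: eq_esum => x _; case: ifPn => //; rewrite notin_setE /= => /negP.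
rewrite negbK => /eqP ->; rewrite normr0 powR0 ?mul0r //.
by rewrite gt_eqF // (lt_trans ltr01).
Qed.

Lemma hardy_weight_w : hardy_weight p sigma w.
Proof.
split=> [x|u fu]; first exact: ltW (hardy_w_gt0 x).
by apply: hardy_inequality; apply: finite_support_ellp => // x; exact: powR_ge0.
Qed.

End HardyIdentity.

(** * Criticality *)

Section LogarithmicCutoff.
Context {R : realType}.
Implicit Types (s L z : R) (x y : int).

(** By [ln (1 + t) <= t] at [t = - 1 / (n + 2)], a term is at most an increment of
    the logarithm. *)
Lemma harmonic_le n : (0 < n)%N -> \sum_(i < n) i.+1%:R^-1 <= 1 + ln n%:R :> R.
Proof.
elim: n => // -[|n] IH _; first by rewrite big_ord1 ln1 addr0 invr1.
rewrite big_ord_recr /=; apply: le_trans (lerD (IH isT) (lexx _)) _.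
rewrite -addrA lerD2l.
have n1 : 0 < n.+1%:R :> R by rewrite ltr0n.
have n2 : 0 < n.+2%:R :> R by rewrite ltr0n.
have r0 : 0 < n.+1%:R / n.+2%:R :> R by rewrite divr_gt0.
have := le_ln1Dx (_ : -1 < n.+1%:R / n.+2%:R - 1 :> R).
rewrite ltrBrDr addNr => /(_ r0); rewrite addrCA subrr addr0 ln_div ?posrE //.
have -> : n.+1%:R / n.+2%:R - 1 = - n.+2%:R^-1 :> R.
  move: n2; rewrite -natr1; move: n.+1%:R => t t0.
  by field; rewrite gt_eqF.
by move: (ln _) (ln _) (_^-1) => A B C h; lra.
Qed.

(** Up to [z = 1] by [ln (1 + z) <= z]; beyond, by [ln w <= (2 / s) * w ^ (s / 2)] at
    [w = 1 + z]. *)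
Lemma ln_sqr_le s z : 0 < s -> s < 1 -> 0 <= z ->
  ln (1 + z) ^+ 2 <= 8 / s ^+ 2 * Num.min z (z `^ s).
Proof.
move=> s0 s1 z0; have l0 : 0 <= ln (1 + z) by rewrite ln_ge0 // lerDl.
have lz : ln (1 + z) <= z by apply: le_ln1Dx; lra.
have c1 : 1 <= 8 / s ^+ 2.
  rewrite ler_pdivlMr ?exprn_gt0 // mul1r; apply: (@le_trans _ _ 1); last by lra.
  by rewrite expr_le1 // ltW.
have [z1|z1] := lerP z 1.
  have hz : z <= z `^ s.
    move: z0; rewrite le_eqVlt => /predU1P[<-|z0]; first exact: powR_ge0.
    by apply: ger1_powR; rewrite ?z0 ?z1 ?ltW.
  rewrite (min_idPl hz); apply: (@le_trans _ _ z).
    apply: (@le_trans _ _ (z ^+ 2)); first by rewrite ler_sqr ?nnegrE.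
    by rewrite expr2 ler_piMl.
  by rewrite ler_peMl.
have hz : z `^ s <= z by rewrite -[leRHS]powRr1 // ler_powR // ltW.
rewrite (min_idPr hz).
have s20 : 0 < s / 2 by lra.
have w0 : 0 < 1 + z by lra.
have : ln ((1 + z) `^ (s / 2)) <= (1 + z) `^ (s / 2).
  by apply: le_trans (ltW (ln_sublinear _)) _; rewrite ?powR_gt0.
rewrite ln_powR -ler_pdivlMl // => h.
have h0 : 0 <= (s / 2)^-1 * (1 + z) `^ (s / 2) by apply: le_trans h.
have : ln (1 + z) ^+ 2 <= ((s / 2)^-1 * (1 + z) `^ (s / 2)) ^+ 2.
  by rewrite ler_sqr ?nnegrE.
move=> {}h; apply: le_trans h _; rewrite exprMn.
rewrite -[((1 + z) `^ _) ^+ 2]powR_mulrn ?powR_ge0 // -powRrM divfK //.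
apply: (@le_trans _ _ (((s / 2)^-1) ^+ 2 * (2 * z `^ s))).
  rewrite ler_wpM2l ?sqr_ge0 //; apply: (@le_trans _ _ ((2 * z) `^ s)).
    by apply: ge0_ler_powR; rewrite ?nnegrE; lra.
  rewrite powRM // ler_wpM2r ?powR_ge0 //.
  by rewrite -[leRHS]powRr1 // ler_powR ?ler1n // ltW.
by rewrite le_eqVlt; apply/orP; left; apply/eqP; field; rewrite gt_eqF.
Qed.

Definition cutoff L x : R := Num.max 0 (1 - ln (wt x) / L).

Lemma cutoff_ge0 L x : 0 <= cutoff L x.
Proof. by rewrite le_max lexx. Qed.

Lemma cutoff_eq0 L x : 0 < L -> L <= ln (wt x) -> cutoff L x = 0.
Proof.
by move=> L0 h; apply/max_idPl; rewrite subr_le0 ler_pdivlMr // mul1r.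
Qed.

(** With [z = |x - y| / wt x], the difference is at most [ln (1 + z) / L], as
    [wt y <= wt x * (1 + z)]. *)
Lemma cutoff_diff L s x y : 0 < L -> 0 < s -> s < 1 -> (`|x| <= `|y|)%N ->
  (cutoff L x - cutoff L y) ^+ 2 <= 8 / s ^+ 2 / L ^+ 2 * modulus s x y.
Proof.
move=> L0 s0 s1 xy; pose z : R := (absz (x - y))%:R / wt x.
have z0 : 0 <= z by rewrite divr_ge0 // ltW // wt_gt0.
have xy' : wt x <= wt y :> R by rewrite lerD2l ler_nat.
have yz : ln (wt y) <= ln (wt x) + ln (1 + z).
  rewrite -lnM ?posrE ?wt_gt0 //; last by lra.
  rewrite ler_ln ?posrE ?wt_gt0 ?mulr_gt0 ?wt_gt0 //; last by lra.
  rewrite mulrDr mulr1 mulrC divfK ?gt_eqF ?wt_gt0 //.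
  by rewrite /wt -addrA lerD2l -natrD ler_nat; lia.
have lxy : ln (wt x) <= ln (wt y) :> R by rewrite ler_ln ?posrE ?wt_gt0.
have key : 0 <= cutoff L x - cutoff L y <= ln (1 + z) / L.
  have d : ln (wt x) / L <= ln (wt y) / L by rewrite ler_wpM2r // invr_ge0 ltW.
  have e : ln (wt y) / L <= ln (wt x) / L + ln (1 + z) / L.
    by rewrite -mulrDl ler_wpM2r // invr_ge0 ltW.
  move: d e; rewrite /cutoff; move: (_ / L) (_ / L) (_ / L) => X Y Z d e.
  case: (lerP 0 (1 - Y)); case: (lerP 0 (1 - Z)) => *; apply/andP; split; lra.
have /andP[k0 k1] := key.
have h1 : (cutoff L x - cutoff L y) ^+ 2 <= (ln (1 + z) / L) ^+ 2.
  by rewrite ler_sqr ?nnegrE // (le_trans k0).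
apply: le_trans h1 _; rewrite expr_div_n [leRHS]mulrAC ler_wpM2r ?invr_ge0 ?sqr_ge0 //.
exact: ln_sqr_le.
Qed.

End LogarithmicCutoff.

Section Criticality.
Context {R : realType} (p sigma alpha : R).
Hypotheses (p1 : 1 < p) (s0 : 0 < sigma) (sa : sigma < alpha) (a12 : alpha < 2^-1).
Implicit Types (x y z : int) (u v : int -> R) (L : R).

Local Notation h := (ker (- alpha)).
Local Notation k := (ker sigma).
Local Notation a := (a_ p).
Local Notation w := (hardy_w p sigma alpha).
Local Notation dsum f :=
  (\esum_(x in [set: int]) \esum_(y in [set: int]) (f x y)%:E)%E.

Let alpha0 : 0 < alpha. Proof. exact: lt_trans sa. Qed.
Let s12 : sigma < 2^-1. Proof. exact: lt_trans a12. Qed.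
Let a0 : 0 < a_ p. Proof. exact: a_gt0. Qed.
Let a1 : a_ p <= 1. Proof. exact: a_le1. Qed.
Let base0 x : 0 < h x. Proof. exact: ker_neg_gt0. Qed.

(** Without the cutoff, [u ^ p = h ^ (a + 1)] makes both arguments of each
    Young inequality equal. *)
Definition near_ground_state L x : R :=
  (h x `^ (a + 1) * cutoff L x ^+ 2) `^ p^-1.

Let ngs_ge0 L x : 0 <= near_ground_state L x. Proof. exact: powR_ge0. Qed.

Lemma near_ground_state_powR L x :
  near_ground_state L x `^ p = h x `^ (a + 1) * cutoff L x ^+ 2.
Proof.
rewrite /near_ground_state -powRrM mulVf ?gt_eqF ?(lt_trans ltr01) // powRr1 //.
by rewrite mulr_ge0 ?powR_ge0 ?sqr_ge0.
Qed.

(** On the pairs with [|x| <= |y|] the factor of the remainder bound that involves [h]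
    is at most [2 * h x ^ (a + 1)]; the other pairs are obtained by exchanging [x] and
    [y]. *)
Let half_remainder L x y : R := if (`|x| <= `|y|)%N
  then 2 * h x `^ (a + 1) * (cutoff L x - cutoff L y) ^+ 2 * k (x - y) else 0.

Let half_remainder_ge0 L x y : 0 <= half_remainder L x y.
Proof.
rewrite /half_remainder; case: ifP => // _.
by rewrite mulr_ge0 ?ker_pos_ge0 // mulr_ge0 ?sqr_ge0 // mulr_ge0 ?powR_ge0.
Qed.

Let half_bound L x y : (`|x| <= `|y|)%N ->
  (h x * h y `^ a + h x `^ a * h y) * (cutoff L x - cutoff L y) ^+ 2 * k (x - y) <=
  half_remainder L x y.
Proof.
move=> xy; rewrite /half_remainder xy ler_wpM2r ?ker_pos_ge0 //.
rewrite ler_wpM2r ?sqr_ge0 //.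
have hyx : h y <= h x by exact: ker_neg_decreasing.
have hyxa : h y `^ a <= h x `^ a.
  by apply: ge0_ler_powR; rewrite ?nnegrE ?(ltW (base0 _)) ?(ltW a0).
have -> : h x `^ (a + 1) = h x * h x `^ a.
  by rewrite powRD ?(gt_eqF (base0 x)) ?implybT // powRr1 ?(ltW (base0 x)) // mulrC.
have -> : 2 * (h x * h x `^ a) = h x * h x `^ a + h x `^ a * h x by ring.
by apply: lerD; rewrite ler_wpM2l ?powR_ge0 // ltW.
Qed.

Lemma remainder_near_ground_state L x y :
  hardy_remainder p sigma alpha (near_ground_state L) x y <=
  half_remainder L x y + half_remainder L y x.
Proof.
rewrite /hardy_remainder sb_integrand_nonneg // !ger0_norm // !near_ground_state_powR.
have up := young_density_upper a0 a1 (base0 x) (base0 y)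
  (cutoff_ge0 L x) (cutoff_ge0 L y) erefl erefl.
apply: le_trans (ler_wpM2r (ker_pos_ge0 (x - y) s0 s12) up) _.
case: (leqP `|x|%N `|y|%N) => [xy|/ltnW yx].
  by apply: le_trans (half_bound L xy) _; rewrite lerDl.
apply: le_trans _ (_ : half_remainder L y x <= _); last by rewrite lerDr.
apply: le_trans (half_bound L yx); rewrite (ker_sym _ x y).
rewrite le_eqVlt; apply/orP; left; apply/eqP; ring.
Qed.

Hypothesis alpha_le : alpha <= (2 * sigma + a_ p) / (2 * (a_ p + 1)).

(** The hypothesis on [alpha] is [(1 - 2 * alpha) * (a + 1) + 2 * sigma >= 1]. *)
Lemma ground_state_decay : exists2 C : R, 0 <= C & forall x,
  h x `^ (a + 1) * wt x `^ (- (2 * sigma)) <= C * (wt x)^-1.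
Proof.
have [C C0 hC] := ker_neg_decay alpha0 a12.
have a10 : 0 < a + 1 by move: (a0) => ?; lra.
exists (C `^ (a + 1)) => [|x]; first exact: powR_ge0.
have W0 : 0 < wt x :> R by exact: wt_gt0.
apply: (@le_trans _ _ ((C * wt x `^ (- (1 - 2 * alpha))) `^ (a + 1) *
    wt x `^ (- (2 * sigma)))).
  rewrite ler_wpM2r ?powR_ge0 //; apply: ge0_ler_powR (hC x); rewrite ?nnegrE ?(ltW a10) //.
    exact: ltW.
  by rewrite mulr_ge0 ?powR_ge0.
rewrite powRM ?powR_ge0 // -powRrM -mulrA ler_wpM2l ?powR_ge0 //.
rewrite -powRD ?(gt_eqF W0) ?implybT // -[leRHS]powR_inv1 ?(ltW W0) //.
rewrite ler_powR ?wt_ge1 //.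
have : alpha * (2 * (a + 1)) <= 2 * sigma + a.
  by rewrite -ler_pdivlMr //; move: (a0) => ?; lra.
by move=> ?; nra.
Qed.

Lemma zsum_half_remainder : exists2 K : R, 0 <= K & forall L x, 0 < L ->
  zsummable (half_remainder L x) /\
  zsum (half_remainder L x) <=
    if ln (wt x) < L then K / L ^+ 2 * (wt x)^-1 else 0.
Proof.
have [C C0 hC] := ground_state_decay; have [D D0 hD] := kernel_modulus_bound s0 s12.
have K0 : 0 <= 16 / sigma ^+ 2 :> R by rewrite divr_ge0 ?sqr_ge0.
exists (16 / sigma ^+ 2 * D * C) => [|L x L0]; first by apply: mulr_ge0 => //; exact: mulr_ge0.
have L2 : 0 <= (L ^+ 2)^-1 by rewrite invr_ge0 sqr_ge0.
pose c := 16 / sigma ^+ 2 / L ^+ 2 * h x `^ (a + 1).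
have c0 : 0 <= c by apply: mulr_ge0; [exact: mulr_ge0|exact: powR_ge0].
have bound y : 0 <= half_remainder L x y <= c * modulus sigma x y * k (x - y).
  rewrite half_remainder_ge0 /half_remainder; case: ifP => [xy|_]; last first.
    by rewrite mulr_ge0 ?ker_pos_ge0 // mulr_ge0 ?modulus_ge0.
  have s1 : sigma < 1 by move: (s12) => ?; lra.
  have := ler_wpM2l (_ : 0 <= 2 * h x `^ (a + 1)) (cutoff_diff L0 s0 s1 xy).
  rewrite mulr_ge0 ?powR_ge0 // => /(_ isT) hh.
  rewrite ler_wpM2r ?ker_pos_ge0 //; apply: le_trans hh _.
  by rewrite le_eqVlt /c; apply/orP; left; apply/eqP; ring.
have [sm le] := hD _ x c c0 bound; split => //.
case: ltP => hL.
  apply: le_trans le _; rewrite /c.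
  have e1 : 0 <= 16 / sigma ^+ 2 / L ^+ 2 * D.
    by apply: mulr_ge0 => //; exact: mulr_ge0.
  have := ler_wpM2l e1 (hC x) => hh; apply: le_trans _ (le_trans hh _).
    by rewrite le_eqVlt; apply/orP; left; apply/eqP; ring.
  by rewrite le_eqVlt; apply/orP; left; apply/eqP; ring.
suff z y : half_remainder L x y = 0 * half_remainder L x y.
  by rewrite (funext z) zsumZ // mul0r.
rewrite mul0r /half_remainder; case: ifP => // xy.
rewrite !cutoff_eq0 ?subrr ?expr0n ?mulr0 ?mul0r //.
by apply: le_trans hL _; rewrite ler_ln ?posrE ?wt_gt0 // lerD2l ler_nat.
Qed.

(** The cutoff contributes [(ln n) ^ -2], and the sum of [1 / wt x] over its support
    only one factor [ln n]. *)
Lemma remainder_vanishes : exists2 K : R, 0 <= K & forall n, (1 < n)%N ->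
  (dsum (hardy_remainder p sigma alpha (near_ground_state (ln n%:R))) <=
   (K * (1 + ln n%:R) / ln n%:R ^+ 2)%:E)%E.
Proof.
have [K K0 hK] := zsum_half_remainder; exists (4 * K) => [|n n1]; first by rewrite mulr_ge0.
set L := ln n%:R; have L0 : 0 < L by rewrite ln_gt0 // ltr1n.
have h0 := half_remainder_ge0 L.
have L2 : 0 <= K / L ^+ 2 by rewrite mulr_ge0 // invr_ge0 sqr_ge0.
apply: (@le_trans _ _ (dsum (fun x y => half_remainder L x y + half_remainder L y x))).
  apply: le_esum => x _; apply: le_esum => y _; rewrite lee_fin.
  exact: remainder_near_ground_state.
rewrite dsumD // (dsum_swap h0).
have -> : dsum (half_remainder L) =
    (\esum_(x in [set: int]) (zsum (half_remainder L x))%:E)%E.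
  by apply: eq_esum => x _; rewrite zsum_ge0_esum //; exact: (hK L x L0).1.
have le : (\esum_(x in [set: int]) (zsum (half_remainder L x))%:E <=
    (2 * K * (1 + L) / L ^+ 2)%:E)%E.
  apply: esum_int_le => [x|m]; first exact: zsum_ge0.
  pose g i : R := if (i < n)%N then K / L ^+ 2 * i.+1%:R^-1 else 0.
  have g0 i : 0 <= g i.
    by rewrite /g; case: ifP => // _; rewrite mulr_ge0 // invr_ge0.
  have hg x i : (i <= `|x|)%N -> zsum (half_remainder L x) <= g i.
    move=> ix; apply: le_trans (hK L x L0).2 _.
    case: ltP => // hL; rewrite /g ifT; last first.
      move: hL; rewrite /L wt_nat ltr_ln ?posrE ?ltr0n ?(ltnW n1) // ltr_nat.
      by apply: leq_ltn_trans; rewrite (leq_trans ix).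
    rewrite ler_wpM2l // lef_pV2 ?posrE ?ltr0n ?wt_gt0 //.
    by rewrite wt_nat ler_nat ltnS.
  rewrite /zpartial; apply: (@le_trans _ _ (\sum_(0 <= i < m) 2 * g i)).
    apply: ler_sum => i _; rewrite mulr_natl mulr2n; apply: lerD; exact: hg.
  rewrite -mulr_sumr (_ : 2 * K * (1 + L) / L ^+ 2 = 2 * (K / L ^+ 2 * (1 + L))).
    rewrite ler_wpM2l //; apply: (@le_trans _ _ (\sum_(0 <= i < n) g i)).
      apply: (@le_trans _ _ (\sum_(0 <= i < m + n) g i)).
        by rewrite [leRHS](big_cat_nat (n := m)) ?leq_addr //= lerDl sumr_ge0.
      rewrite (big_cat_nat (n := n)) ?leq_addl //= gerDl big_nat_cond big1 // => i.
      by rewrite andbT /g => /andP[ni _]; rewrite ltnNge ni.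
    apply: le_trans (ler_wpM2l L2 (harmonic_le (ltnW n1))).
    rewrite big_mkord mulr_sumr; apply: ler_sum => i _.
    by rewrite /g ltn_ord.
  by ring.
apply: le_trans (leeD le le) _; rewrite -EFinD lee_fin.
by rewrite le_eqVlt; apply/orP; left; apply/eqP; ring.
Qed.

Lemma near_ground_state_support L : 0 < L ->
  finite_set [set x | near_ground_state L x != 0].
Proof.
move=> L0; have [N hN] : exists N : nat, expR L <= N%:R.
  exists (Num.bound (expR L)); exact: ltW (archi_boundP (expR_ge0 _)).
have fin : finite_set [set x : int | (`|x| <= N)%N].
  apply: (@sub_finite_set _ _ ((Posz @` `I_N.+1) `|` ((fun n => - Posz n) @` `I_N.+1))).
    move=> x /= xN; case: (intP x) xN => [|n|n] xN.
    - by left; exists 0%N.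
    - by left; exists n.+1.
    - by right; exists n.+1.
  by rewrite finite_setU; split; apply: finite_image; exact: finite_II.
apply: sub_finite_set fin => x /=; apply: contraNT; rewrite -ltnNge => xN.
rewrite /near_ground_state cutoff_eq0 // ?expr0n ?mulr0 ?powR0 //.
  by rewrite invr_eq0 gt_eqF // (lt_trans ltr01).
rewrite -[leLHS]expRK ler_ln ?posrE ?expR_gt0 ?wt_gt0 //.
apply: le_trans hN _; rewrite wt_nat ler_nat; exact: leqW (ltnW xN).
Qed.

(** On the functions [near_ground_state L] a larger Hardy weight can gain at most the
    remainder. This tends to [0], whereas the functions tend pointwise to a positive
    one. *)
Lemma hardy_w_critical : critical p sigma w.
Proof.
split; first exact: (hardy_weight_w p1 s0 sa a12).
move=> w' [w'0 w'H] ww' x; apply/eqP; rewrite eq_le ww' andbT leNgt; apply/negP => wx.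
have [K K0 hK] := remainder_vanishes.
have d0 : 0 < w' x - w x by rewrite subr_gt0.
pose c := (w' x - w x) * h x `^ (a + 1).
have c0 : 0 < c by rewrite mulr_gt0 ?powR_gt0.
have gain n : (1 < n)%N ->
    c * cutoff (ln n%:R) x ^+ 2 <= K * (1 + ln n%:R) / ln n%:R ^+ 2.
  move=> n1; set L := ln n%:R; have L0 : 0 < L by rewrite ln_gt0 // ltr1n.
  pose u := near_ground_state L.
  have fu : finite_set [set x | u x != 0] by exact: near_ground_state_support.
  have lu (mu : int -> R) : (forall x, 0 <= mu x) -> ellp p mu u.
    by move=> mu0; exact: finite_support_ellp.
  have w0 z : 0 <= w z by exact: ltW (hardy_w_gt0 p1 s0 sa a12 z).
  have := w'H u fu.
  rewrite (hardy_identity p1 s0 sa a12); last by apply: lu => z; exact: powR_ge0.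
  have -> : wsum p w' u = (wsum p w u + wsum p (fun z => (w' z - w z)%R) u)%E.
    rewrite /wsum -esumD; last 2 first.
    - by move=> z _; rewrite lee_fin mulr_ge0 ?powR_ge0.
    - by move=> z _; rewrite lee_fin mulr_ge0 ?powR_ge0 // subr_ge0.
    by apply: eq_esum => z _; rewrite -EFinD -mulrDl subrKC.
  have fw : wsum p w u \is a fin_num.
    rewrite ge0_fin_numE; last by apply: esum_ge0 => z _; rewrite lee_fin mulr_ge0 ?powR_ge0.
    apply: le_lt_trans (lu w w0); apply: le_esum => z _.
    by rewrite mulrC.
  rewrite leeD2lE // => le1.
  have le2 : ((c * cutoff L x ^+ 2)%:E <= wsum p (fun z => (w' z - w z)%R) u)%E.
    rewrite /c -mulrA -near_ground_state_powR -[near_ground_state L x]ger0_norm //.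
    apply: esum_ge; exists [set x]; first by split => //; exact: finite_set1.
    by rewrite fsbig_set1.
  have D0 : (0 <= dsum (hardy_remainder p sigma alpha u))%E.
    apply: esum_ge0 => z _; apply: esum_ge0 => y _; rewrite lee_fin.
    exact: (hardy_remainder_ge0 p1 s0 sa a12).
  have le3 : ((2^-1)%:E * dsum (hardy_remainder p sigma alpha u) <=
      dsum (hardy_remainder p sigma alpha u))%E.
    by rewrite -[leRHS]mul1e lee_wpmul2r // lee_fin invf_le1 // ler1n.
  have := le_trans le2 (le_trans le1 (le_trans le3 (hK n n1))).
  by rewrite lee_fin.
(* [L >= 2 ln (wt x)] makes the cutoff at [x] at least [1 / 2], and the last bound
   contradicts [gain] *)
pose M := Num.max 1 (Num.max (2 * ln (wt x)) (8 * K / c + 1)).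
have [n hn] : exists n : nat, expR M <= n%:R.
  exists (Num.bound (expR M)); exact: ltW (archi_boundP (expR_ge0 _)).
have n0 : 0 < n%:R :> R by exact: lt_le_trans (expR_gt0 _) hn.
have LM : M <= ln n%:R by rewrite -[leLHS]expRK ler_ln ?posrE ?expR_gt0.
have n1 : (1 < n)%N.
  rewrite -(ltr1n R); apply: lt_le_trans hn; rewrite expR_gt1.
  by rewrite lt_max ltr01.
have := gain n n1; move: LM; set L := ln n%:R => LM.
have L1 : 1 <= L by apply: le_trans LM; rewrite le_max lexx.
have L0 : 0 < L by apply: lt_le_trans L1.
have Lw : 2 * ln (wt x) <= L by apply: le_trans LM; rewrite !le_max lexx orbT.
have LK : 8 * K / c + 1 <= L by apply: le_trans LM; rewrite !le_max lexx !orbT.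
have cut : 2^-1 <= cutoff L x.
  rewrite le_max; apply/orP; right.
  have : ln (wt x) / L <= 2^-1 by rewrite ler_pdivrMr //; lra.
  by move=> ?; lra.
apply/negP; rewrite -ltNge.
have cut2 : c / 4 <= c * cutoff L x ^+ 2.
  rewrite ler_pM2l // (_ : 4^-1 = 2^-1 ^+ 2); last by field.
  by rewrite ler_sqr ?nnegrE ?cutoff_ge0.
apply: lt_le_trans cut2.
apply: (@le_lt_trans _ _ (K * (2 * L) / L ^+ 2)).
  by rewrite ler_wpM2r ?invr_ge0 ?sqr_ge0 // ler_wpM2l //; lra.
rewrite (_ : K * (2 * L) / L ^+ 2 = 2 * K / L); last by field; rewrite gt_eqF.
rewrite ltr_pdivrMr // mulrAC ltr_pdivlMr //.
have : 8 * K / c < L by lra.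
by rewrite ltr_pdivrMr // => ?; lra.
Qed.

End Criticality.

(** * Asymptotics of the weight *)

Section WeightAsymptotics.
Context {R : realType}.
Implicit Types (a b s t e : R) (x z : int).

Lemma powR_dist1 b t : 0 <= b -> b <= 1 -> 0 <= t -> `|t `^ b - 1| <= `|t - 1|.
Proof.
move=> b0 b1 t0; have [t1|t1] := lerP 1 t.
  have h1 : 1 <= t `^ b by rewrite -(powRr0 t) ler_powR.
  have h2 : t `^ b <= t by rewrite -[leRHS]powRr1 // ler_powR.
  by rewrite !ger0_norm; lra.
have h2 : t `^ b <= 1.
  have <- : (1 : R) `^ b = 1 by rewrite powR1.
  by apply: ge0_ler_powR; rewrite ?nnegrE // ltW.
have h1 : t <= t `^ b.
  move: t0; rewrite le_eqVlt => /predU1P[<-|t0]; first exact: powR_ge0.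
  by apply: ger1_powR => //; rewrite t0 ltW.
by rewrite !ler0_norm; lra.
Qed.

Lemma kpow_asymp a b z : 0 < a -> a < 2^-1 -> 0 <= b -> b <= 1 -> z != 0 ->
  `|kpow a b z - cA a `^ b * `|z|%N%:R `^ (- (b * (1 - 2 * a)))| <=
  cA a `^ b * `|z|%N%:R `^ (- (b * (1 - 2 * a))) / `|z|%N%:R.
Proof.
move=> a0 a1 b0 b1 z0; have zn : 0 < `|z|%N%:R :> R by rewrite ltr0n absz_gt0.
have c0 : 0 < cA a := cA_gt0 a0 a1.
set m := cA a * `|z|%N%:R `^ (- (1 - 2 * a)).
have m0 : 0 < m by rewrite mulr_gt0 ?powR_gt0.
have -> : cA a `^ b * `|z|%N%:R `^ (- (b * (1 - 2 * a))) = m `^ b.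
  by rewrite /m powRM ?powR_ge0 ?(ltW c0) // -powRrM; congr (_ * _ `^ _); ring.
have h0 := ker_neg_gt0 z a0 a1.
have t0 : 0 <= ker (- a) z / m by rewrite divr_ge0 ?ltW.
have -> : kpow a b z = m `^ b * (ker (- a) z / m) `^ b.
  by rewrite -powRM ?(ltW m0) // mulrC divfK // gt_eqF.
rewrite -[X in _ - X]mulr1 -mulrBr normrM (ger0_norm (powR_ge0 _ _)) ler_wpM2l ?powR_ge0 //.
apply: le_trans (powR_dist1 b0 b1 t0) _.
rewrite -(ler_pM2l m0) -{1}(gtr0_norm m0) -normrM mulrBr mulr1 mulrC divfK ?gt_eqF //.
exact: ker_neg_asymp.
Qed.

(** The leading term of [kpow a b] is that of a multiple of [ker (- g)], on which the
    fractional Laplacian is explicit; the difference [f] decays one power faster. Three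
    relative errors arise: [n ^ -1] from the two kernels, and, for the Laplacian of [f],
    the powers [n ^ (c2 - 1)] and [n ^ (2 s - 1)] from the decays of [coef s] and of [f]. The
    maximum in the exponent is the larger of [2 s] and the bound [1 - 2 a] for [c2]. *)
Lemma quotient_asymp s a b : 0 < s -> s < a -> a < 2^-1 -> 0 < b -> b <= 1 ->
  let g := (1 - b * (1 - 2 * a)) / 2 in
  exists C : R, forall x : int, (2 <= `|x|)%N ->
  `|fracLap s (kpow a b) x / kpow a b x - cA (g - s) / cA g / `|x|%N%:R `^ (2 * s)|
  <= C * `|x|%N%:R `^ (- (2 * s + 1 - Num.max (2 * s) (1 - 2 * a))).
Proof.
move=> s0 sa a1 b0 b1 g; have a0 : 0 < a by exact: lt_trans sa.
have s1 : s < 2^-1 by exact: lt_trans a1.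
set c2 := b * (1 - 2 * a).
have a2 : 0 < 1 - 2 * a by lra.
have c20 : 0 < c2 by rewrite mulr_gt0.
have c2a : c2 <= 1 - 2 * a by rewrite ler_piMl // ltW.
have gE : 1 - 2 * g = c2 by rewrite /g -/c2; field.
have g1 : g < 2^-1 by lra.
have sg : s < g by lra.
have g0 : 0 < g by exact: lt_trans sg.
have cg0 := cA_gt0 g0 g1; have ca0 := cA_gt0 a0 a1.
have gs0 : 0 < g - s by rewrite subr_gt0.
have gs1 : g - s < 2^-1 by lra.
have cgs0 := cA_gt0 gs0 gs1.
pose c := cA a `^ b; have c0 : 0 < c by rewrite powR_gt0.
have [kap kap0 kapE] : exists2 t : R, 0 < t & t = c / cA g.
  by exists (c / cA g) => //; exact: divr_gt0.
pose f z := kpow a b z - kap * ker (- g) z.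
have kb : zbounded (ker (- g)) := ker_neg_bounded g0 g1.
have df : decays c2 f.
  apply: (@decays_tail _ c2 (2 * c)) => // [|z z0]; first by rewrite mulr_ge0 // ltW.
  have h1 := kpow_asymp a0 a1 (ltW b0) b1 z0.
  have h2 : `|kap * ker (- g) z - c * `|z|%N%:R `^ (- c2)| <=
      c * `|z|%N%:R `^ (- c2) / `|z|%N%:R.
    have cE : c = kap * cA g by rewrite kapE divfK // gt_eqF.
    have := ker_neg_asymp g0 g1 z0; rewrite gE cE.
    move: (_ `^ _) (ker _ z) => P K h.
    rewrite (_ : _ - _ = kap * (K - cA g * P)); last by ring.
    rewrite normrM (gtr0_norm kap0) (_ : _ / _ = kap * (cA g * P / `|z|%N%:R)); last by ring.
    by rewrite ler_pM2l.
  move: h1; rewrite -/c2 -/c => h1.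
  have zn : 0 < `|z|%N%:R :> R by rewrite ltr0n absz_gt0.
  have -> : `|z|%N%:R `^ (- c2 - 1) = `|z|%N%:R `^ (- c2) / `|z|%N%:R.
    by rewrite powRD ?(gt_eqF zn) ?implybT // powR_inv1 // ltW.
  rewrite /f (_ : _ - _ = (kpow a b z - c * `|z|%N%:R `^ (- c2)) -
     (kap * ker (- g) z - c * `|z|%N%:R `^ (- c2))); last by ring.
  apply: le_trans (ler_normB _ _) _; apply: le_trans (lerD h1 h2) _.
  by rewrite le_eqVlt; apply/orP; left; apply/eqP; ring.
have dc := coef_pos_decays s0 s1.
have bf := decays_bounded c20 df.
have s20 : 0 < 2 * s by rewrite mulr_gt0.
have [D D0 hD] := conv_decay s20 c20 dc df.
exists (4 * D / c + 4 * (cA (g - s) / cA g)) => x x2.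
have xn0 : x != 0 by rewrite -absz_gt0 (ltn_trans _ x2).
set n : R := `|x|%N%:R; have n2 : 2 <= n by rewrite ler_nat.
have n0 : 0 < n by lra.
have n1 : 1 <= n by lra.
set M := Num.max _ _; have M1 : 2 * s <= M by rewrite le_max lexx.
have M2 : 1 - 2 * a <= M by rewrite le_max lexx orbT.
have [E1 E2 E3] : [/\ 2 * s + 1 - M <= 2 * s + 1, 2 * s + 1 - M <= 1 &
    2 * s + 1 - M <= 2 * s + 1 - c2] by split; lra.
move: (2 * s + 1 - M) E1 E2 E3 => E E1 E2 E3.
have pD u v : n `^ u * n `^ v = n `^ (u + v).
  by rewrite powRD ?(gt_eqF n0) ?implybT.
have mono u v : u <= v -> n `^ u <= n `^ v by exact: ler_powR.
set H := kpow a b x.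
have [e1 e1n HE] : exists2 e : R, `|e| <= n^-1 & H = c * n `^ (- c2) * (1 + e).
  have := kpow_asymp a0 a1 (ltW b0) b1 xn0; rewrite -/c2 -/c -/n -/H.
  have m0 : 0 < c * n `^ (- c2) by rewrite mulr_gt0 ?powR_gt0.
  move: (c * _) m0 => m m0 h; exists (H / m - 1).
    rewrite -(ler_pM2l m0) -{1}(gtr0_norm m0) -normrM mulrBr mulr1 mulrC divfK ?gt_eqF //.
  by rewrite addrC subrK mulrC divfK // gt_eqF.
have [e2 e2n KE] : exists2 e : R, `|e| <= n^-1 &
    ker (- (g - s)) x = cA (g - s) * n `^ (- (c2 + 2 * s)) * (1 + e).
  have := ker_neg_asymp gs0 gs1 xn0.
  rewrite (_ : 1 - 2 * (g - s) = c2 + 2 * s); last by rewrite -gE; ring.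
  rewrite -/n; have m0 : 0 < cA (g - s) * n `^ (- (c2 + 2 * s)) by rewrite mulr_gt0 ?powR_gt0.
  move: (cA (g - s) * _) m0 (ker _ x) => m m0 K h; exists (K / m - 1).
    rewrite -(ler_pM2l m0) -{1}(gtr0_norm m0) -normrM mulrBr mulr1 mulrC divfK ?gt_eqF //.
  by rewrite addrC subrK mulrC divfK // gt_eqF.
have nv : n^-1 <= 2^-1 by rewrite lef_pV2 ?posrE.
have nv0 : 0 < n^-1 by rewrite invr_gt0.
have e1h : 2^-1 <= 1 + e1.
  by move: (ler_normlP _ _ e1n) => -[? ?]; lra.
have H0 : 0 < H by rewrite HE mulr_gt0 ?mulr_gt0 ?powR_gt0 //; lra.
have LE : fracLap s (kpow a b) x = conv (coef s) f x + kap * ker (- (g - s)) x.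
  rewrite -fracLap_conv // -fracLap_ker // -fracLap_lin //.
  by congr (fracLap s _ x); apply/funext => y; rewrite /f subrK.
rewrite LE; move: (conv _ _ x) (hD x) => q hq.
rewrite [(q + _) / H]mulrDl -addrA; apply: le_trans (ler_normD _ _) _; rewrite [leRHS]mulrDl.
apply: lerD.
  rewrite normrM normfV (gtr0_norm H0) ler_pdivrMr //.
  apply: le_trans hq _.
  have wn (u : R) : 0 < u -> wt x `^ (- u - 1) <= n `^ (- u - 1).
    move=> u0; rewrite -!opprD !powRN lef_pV2 ?posrE ?powR_gt0 ?wt_gt0 //.
    apply: ge0_ler_powR; rewrite ?nnegrE ?(ltW (wt_gt0 _)) ?(ltW n0) //; first by lra.
    by rewrite /wt lerDr.
  have Hl : c * n `^ (- c2) / 2 <= H.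
    by rewrite HE ler_wpM2l // mulr_ge0 ?powR_ge0 // ltW.
  have q0 : 0 <= 4 * D / c * n `^ (- E).
    by rewrite mulr_ge0 ?powR_ge0 // divr_ge0 ?(ltW c0) // mulr_ge0.
  apply: le_trans (ler_wpM2l q0 Hl).
  rewrite (_ : _ * (_ / 2) = D * (2 * (n `^ (- E) * n `^ (- c2)))); last first.
    by field; rewrite gt_eqF.
  rewrite ler_wpM2l // pD [2 * _ `^ _]mulr_natl mulr2n; apply: lerD.
    by apply: le_trans (wn _ s20) _; apply: mono; lra.
  by apply: le_trans (wn _ c20) _; apply: mono; lra.
have -> : kap * ker (- (g - s)) x / H - cA (g - s) / cA g / n `^ (2 * s) =
    cA (g - s) / cA g * n `^ (- (2 * s)) * ((e2 - e1) / (1 + e1)).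
  rewrite KE HE opprD -pD !powRN kapE; field.
  have n2s : n `^ (2 * s) != 0 by rewrite gt_eqF ?powR_gt0.
  have nc2 : n `^ c2 != 0 by rewrite gt_eqF ?powR_gt0.
  by rewrite n2s nc2 !gt_eqF //; lra.
move: (cA (g - s) / cA g) (divr_gt0 cgs0 cg0) => Q Q0.
rewrite normrM normrM (gtr0_norm Q0) (ger0_norm (powR_ge0 _ _)).
rewrite (_ : 4 * Q * _ = Q * (4 * n `^ (- E))); last by ring.
rewrite -mulrA ler_pM2l //.
have e12 : `|(e2 - e1) / (1 + e1)| <= 4 * n^-1.
  rewrite normrM normfV [`|1 + e1|]gtr0_norm ?ler_pdivrMr; [|lra|lra].
  have := le_trans (ler_normB e2 e1) (lerD e2n e1n).
  have : 4 * n^-1 * 2^-1 <= 4 * n^-1 * (1 + e1) by rewrite ler_wpM2l // mulr_ge0 // ltW.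
  by move=> *; lra.
apply: le_trans (ler_wpM2l (powR_ge0 _ _) e12) _.
rewrite mulrCA ler_wpM2l // -[n^-1]powR_inv1 ?(ltW n0) // pD.
by apply: mono; lra.
Qed.

End WeightAsymptotics.

(** * Properties of the weight *)

(** The weight combines the quotients for [b = a_ p] and [b = 1]; in the second case the
    exponent [g] of [quotient_asymp] is [alpha]. *)
Lemma hardy_w_asymp (R : realType) (p sigma alpha : R) : 1 < p -> 0 < sigma ->
  sigma < alpha -> alpha < 2^-1 ->
  bigO_at_infty
    (fun x => hardy_w p sigma alpha x
              - Psi p sigma alpha / (`|x|%N%:R `^ (2 * sigma)))
    (fun x => 1 / (`|x|%N%:R `^
       (2 * sigma + 1 - Num.max (2 * sigma) (1 - 2 * alpha)))).
Proof.
move=> p1 s0 sa a12; have a0 := a_gt0 p1; have a1 := a_le1 p1.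
have alpha0 : 0 < alpha by exact: lt_trans sa.
have [C hC] := quotient_asymp s0 sa a12 a0 a1.
have [D hD] := quotient_asymp s0 sa a12 ltr01 (lexx 1).
have kE : kpow alpha 1 = ker (- alpha).
  by apply/funext => y; rewrite /kpow powRr1 // ltW // ker_neg_gt0.
have gE : (1 - 1 * (1 - 2 * alpha)) / 2 = alpha by field.
rewrite kE gE in hD.
have l0 : 0 <= 1 / (a_ p + 1) by rewrite divr_ge0 //; lra.
have l1 : 0 <= a_ p / (a_ p + 1) by rewrite divr_ge0 //; lra.
exists (1 / (a_ p + 1) * C + a_ p / (a_ p + 1) * D), 2%N => x x2.
rewrite (_ : `|1 / _| = `|x|%N%:R `^
    (- (2 * sigma + 1 - Num.max (2 * sigma) (1 - 2 * alpha)))); last first.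
  by rewrite powRN div1r ger0_norm // invr_ge0 powR_ge0.
have {}hC := ler_wpM2l l0 (hC x x2).
have {}hD := ler_wpM2l l1 (hD x x2).
move: (_ `^ (- _)) hC hD => Z hC hD.
rewrite (_ : (_ * C + _ * D) * Z =
  1 / (a_ p + 1) * (C * Z) + a_ p / (a_ p + 1) * (D * Z)); last by ring.
apply: le_trans (lerD hC hD).
have pull (c t : R) : 0 <= c -> c * `|t| = `|c * t|.
  by move=> c0; rewrite normrM ger0_norm.
rewrite (pull _ _ l0) (pull _ _ l1).
apply: le_trans (ler_normD _ _); rewrite le_eqVlt; apply/orP; left; apply/eqP.
by congr `|_|; rewrite /hardy_w /Psi /gamma_; ring.
Qed.

Theorem theorem1p6 (R : realType) (p sigma alpha : R)
  (hp : 1 < p) (hsigma0 : 0 < sigma) (hsigma1 : sigma < 1 / 2)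
  (halpha0 : sigma < alpha) (halpha1 : alpha < 1 / 2) :
  (* the fractional Laplacians in the definition of the weight make sense *)
  (fracLap_dom sigma (kpow alpha (a_ p)) /\ fracLap_dom sigma (ker (- alpha))) /\
  (forall u : int -> R,
     ellp p (fun x => (1 + `|x|%N%:R) `^ (- (2 * sigma))) u ->
     (wsum p (hardy_w p sigma alpha) u <= SBform p sigma u)%E) /\
  hardy_weight p sigma (hardy_w p sigma alpha) /\
  (forall x : int, 0 < hardy_w p sigma alpha x) /\
  bigO_at_infty
    (fun x => hardy_w p sigma alpha x
              - Psi p sigma alpha / (`|x|%N%:R `^ (2 * sigma)))
    (fun x => 1 / (`|x|%N%:R `^
       (2 * sigma + 1 - Num.max (2 * sigma) (1 - 2 * alpha)))) /\
  (alpha <= (2 * sigma + a_ p) / (2 * (a_ p + 1)) ->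
     critical p sigma (hardy_w p sigma alpha)).
Proof.
rewrite div1r in halpha1 hsigma1.
have alpha0 : 0 < alpha by exact: lt_trans halpha0.
split; first split.
- apply: fracLap_dom_bounded => //; apply: kpow_bounded => //.
  by rewrite ltW // a_gt0.
- exact: fracLap_dom_bounded (ker_neg_bounded _ _).
split; first by move=> u; exact: hardy_inequality.
split; first exact: hardy_weight_w.
split; first exact: hardy_w_gt0.
split; first exact: hardy_w_asymp.
exact: hardy_w_critical.
Qed.
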